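(* For every constant $p>1/2$, with probability tending to $1$ as $n\to\infty$, there exists $k\in\{\lfloor n/2\rfloor,\lceil n/2\rceil\}$ such that every largest antichain in $X=\mathcal{P}(n)_p$ consists of sets in $X\cap\binom{[n]}{k}$ together with nearly isolated sets in $\binom{[n]}{k-1}\cup\binom{[n]}{k+1}$.
   Context: $\mathcal{P}(n)$ is the family of all subsets of $[n]=\{1,\dots,n\}$ ordered by inclusion; $\binom{[n]}{k}$ is the family of $k$-element subsets of $[n]$. $X=\mathcal{P}(n)_p$ is the random subfamily containing each subset of $[n]$ independently with probability $p$. An antichain is a family of pairwise incomparable sets. For $v\in\binom{[n]}{j}$ with $j\ge\lceil n/2\rceil$ (resp. $j\le\lfloor n/2\rfloor$), $v$ is called nearly isolated if $v\in X$ but at most one subset (resp. superset) of $v$ of size $j-1$ (resp. $j+1$) lies in $X$.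
   Formalization: The case p = 1 is excluded (so 1/2 < p < 1): at p = 1 and odd n ≥ 3 both middle layers are largest antichains and contain no nearly isolated sets, so no single k works and the claim fails. *)

(* Defs.v *)
From HB Require Import structures.
From mathcomp Require Import all_boot all_order all_algebra.
From mathcomp Require Import classical_sets reals topology normedtype sequences.

Set Implicit Arguments.
Unset Strict Implicit.
Unset Printing Implicit Defensive.

Import Order.TTheory GRing.Theory Num.Theory.
Import numFieldNormedType.Exports.

Local Open Scope set_scope.
Local Open Scope ring_scope.

(* [n] is modelled by 'I_n, and families of subsets by {set {set 'I_n}}. *)

Definition layer (n k : nat) : {set {set 'I_n}} :=
  [set v : {set 'I_n} | #|v| == k].

Definition antichain (n : nat) (A : {set {set 'I_n}}) : bool :=
  [forall u in A, forall v in A, (u \subset v) ==> (u == v)].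

Definition largest_antichain (n : nat) (X A : {set {set 'I_n}}) : bool :=
  [&& A \subset X, antichain A &
      [forall B : {set {set 'I_n}},
         (B \subset X) && antichain B ==> (#|B| <= #|A|)%N]].

Definition lower_nbrs (n : nat) (X : {set {set 'I_n}}) (v : {set 'I_n})
    : {set {set 'I_n}} :=
  [set u in X | (u \subset v) && (#|u|.+1 == #|v|)].

Definition upper_nbrs (n : nat) (X : {set {set 'I_n}}) (v : {set 'I_n})
    : {set {set 'I_n}} :=
  [set w in X | (v \subset w) && (#|w| == #|v|.+1)].

(* Here uphalf n is the ceiling of n/2 and n./2 its floor. Both clauses apply
   only when #|v| = n/2 exactly. *)
Definition nearly_isolated (n : nat) (X : {set {set 'I_n}}) (v : {set 'I_n})
    : bool :=
  (v \in X) &&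
  [|| (uphalf n <= #|v|)%N && (#|lower_nbrs X v| <= 1)%N
    | (#|v| <= n./2)%N && (#|upper_nbrs X v| <= 1)%N].

(* The layer of index k - 1 is written k = #|v|.+1, so it is empty for k = 0. *)
Definition near_layer (n : nat) (X : {set {set 'I_n}}) (k : nat)
    (A : {set {set 'I_n}}) : bool :=
  [forall v in A,
     (v \in X :&: layer n k)
     || nearly_isolated X v && ((#|v|.+1 == k) || (#|v| == k.+1))].

Definition largest_antichains_near_middle (n : nat) (X : {set {set 'I_n}})
    : bool :=
  has (fun k : nat => [forall A : {set {set 'I_n}},
                         largest_antichain X A ==> near_layer X k A])
      [:: n./2; uphalf n].

(* The probability that P(n)_p satisfies E: a family X has mass
   p^|X| (1 - p)^(2^n - |X|). *)
Definition Pr_random_family (R : realType) (p : R) (n : nat)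
    (E : pred {set {set 'I_n}}) : R :=
  \sum_(X : {set {set 'I_n}} | E X) p ^+ #|X| * (1 - p) ^+ #|~: X|.

(* Main.v *)
(* Work with complements to treat only the upper half of the cube, and let [A]
   be a largest antichain of [X].  Levels are emptied from the top: if [S] is
   the part of [A] on level [i + 1] that has linearly many neighbours below it,
   then [S] can be replaced by its shadow [T] in [X], provided [|S| < |T|] with
   some surplus.  Counting the edges between [T] and level [i + 1] gives
     p (i + 1) (|T| - |S|) = p (2 i + 1 - n) |T| + (degree errors) + e,
   where [e] counts the edges of [X] from [T] that avoid [S].  Individual degree
   errors are of order sqrt n, but their averages over spheres of radius 2 are
   tiny.  [S] and [T] are smoothed to sets [F], [G] of vertices with many
   neighbours in [S] or [T]; random sampling of short paths bounds the edges
   of the full cube leaving [F] and [G] by a multiple of [e], so that the errors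
   can be averaged and are absorbed by [e] and by the drift.  On the middle pair
   of levels the drift vanishes and edge isoperimetry in the swap graph shows
   that [e] is of order [|S|] unless [S] fills more than half of its level.
   Vertices with few neighbours below them are so rare, as [1 - p < 1/2], that
   no two of them share a neighbour, and a leftover vertex has at most one
   neighbour below it.

   For odd [n] each largest antichain lies near one of the two middle layers,
   and the best sizes attainable near them differ with high probability: the
   difference moves by one with each of many independent, well separated sets of
   the lower middle layer, so it is unlikely to be 0. *)

Require Import Defs.
From HB Require Import structures.
From mathcomp Require Import all_boot all_order all_algebra all_fingroup.
From mathcomp Require Import reals sequences exp.
From mathcomp Require Import ring lra zify.

Set Implicit Arguments.
Unset Strict Implicit.
Unset Printing Implicit Defensive.

Import Order.TTheory GRing.Theory Num.Theory.
Local Open Scope ring_scope.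

(** * Concentration for random subsets *)

(** Just above the middle the drift is only about [p * |T|], whereas single degrees err by order
    [sqrt n]. Since [A], and hence [S], depends on [X], and there are far too many sets [S] for a
    union bound, every probabilistic input has to be local: a statement about one vertex and its
    surroundings, failing with probability well below [2 ^- n].

    This fixes the radius 2. A sphere of two swaps has order [n ^ 4] vertices, and its mean degree
    error exceeds a constant with probability [exp (- c n ^ 2)]; the same variance estimate for one
    swap yields only a constant exponent.

    Exceptional vertices come in two strengths. A degree off by [eps * n] cannot be excluded
    everywhere, but [M + 1] such vertices in one ball are nearly independent and together cost more
    than the [2 ^ n] centres. A degree below [kap * n] is rarer: two such vertices with a common
    lower neighbour see at least [n] sets almost all absent from [X], which has probability close to
    [(1 - p) ^ n], and here [p > 1 / 2] enters. The first kind is carried as an error term; the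
    second cannot be matched into its shadow, and pushing downwards has to work around it. *)

Section RandomSubset.
Variables (R : realType) (T : finType) (p : R).
Hypotheses (p_ge0 : 0 <= p) (p_le1 : p <= 1).
Implicit Types (X Y W : {set T}) (w : T).

Definition mass X : R := p ^+ #|X| * (1 - p) ^+ #|~: X|.
Definition Ex (F : {set T} -> R) : R := \sum_X mass X * F X.
Definition Pr (E : pred {set T}) : R := \sum_(X | E X) mass X.

Lemma q_ge0 : 0 <= 1 - p. Proof. by rewrite subr_ge0. Qed.

Lemma mass_ge0 X : 0 <= mass X.
Proof. by rewrite mulr_ge0 ?exprn_ge0 ?q_ge0. Qed.

Lemma massE X : mass X = \prod_w (if w \in X then p else 1 - p).
Proof.
rewrite (bigID (mem X)) /=; congr (_ * _).
  by rewrite (eq_bigr (fun=> p)) => [|w ->//]; rewrite prodr_const.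
rewrite (eq_bigr (fun=> 1 - p)) => [|w /negPf ->//].
by rewrite prodr_const; congr (_ ^+ _); apply: eq_card => w; rewrite !inE.
Qed.

Lemma Ex_prod (F G : T -> R) :
  Ex (fun X => \prod_w (if w \in X then F w else G w)) =
  \prod_w (p * F w + (1 - p) * G w).
Proof.
rewrite (bigA_distr _ _ _ _) /= /Ex; apply: eq_bigr => X _.
by rewrite massE -big_split /=; apply: eq_bigr => w _; case: ifP.
Qed.

Lemma sum_mass : \sum_X mass X = 1.
Proof.
have := Ex_prod (fun=> 1) (fun=> 1).
rewrite /Ex [RHS]big1 => [<-|w _]; last by ring.
by apply: eq_bigr => X _; rewrite big1 ?mulr1 // => w _; case: ifP.
Qed.

(** Membership of [w] is independent of everything else, so it may be integrated out first. Both
    sides reduce to a sum over the sets avoiding [w], each paired with [w |: X]. *)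
Lemma Ex_flip w F : Ex F = Ex (fun X => p * F (w |: X) + (1 - p) * F (X :\ w)).
Proof.
have split_w G : Ex G = \sum_(X : {set T} | w \notin X)
    (mass X * G X + mass (w |: X) * G (w |: X)).
  rewrite /Ex (bigID (fun X : {set T} => w \in X)) /= big_split addrC /=; congr (_ + _).
  rewrite (reindex_onto (fun X : {set T} => w |: X) (fun X => X :\ w)) /=; last first.
    by move=> X wX; rewrite setD1K.
  apply: eq_bigl => X; rewrite setU11 /=; apply/eqP/idP => [<-|wX].
    by rewrite setD11.
  by rewrite setU1K.
rewrite !split_w; apply: eq_bigr => X wX.
have XD : X :\ w = X by apply/setDidPl; rewrite disjoint_sym disjoints1.
rewrite setU1K // XD.
have -> : w |: (w |: X) = w |: X by rewrite setUA setUid.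
rewrite /mass cardsU1 wX /=.
have -> : #|~: X| = (#|~: (w |: X)|).+1.
  rewrite -[~: X](setD1K (a := w)) ?inE // cardsU1 !inE eqxx /= add1n.
  by congr (_.+1); apply: eq_card => v; rewrite !inE negb_or.
by rewrite add1n !exprS; ring.
Qed.

Lemma le_Ex (F G : {set T} -> R) : (forall X, F X <= G X) -> Ex F <= Ex G.
Proof. by move=> FG; apply: ler_sum => X _; rewrite ler_wpM2l ?mass_ge0. Qed.

Lemma PrE (E : pred {set T}) : Pr E = Ex (fun X => (E X)%:R).
Proof.
rewrite /Pr /Ex big_mkcond; apply: eq_bigr => X _.
by case: (E X); rewrite ?mulr1 ?mulr0.
Qed.

Lemma le_Pr (E1 E2 : pred {set T}) : (forall X, E1 X -> E2 X) -> Pr E1 <= Pr E2.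
Proof.
move=> E12; rewrite !PrE; apply: le_Ex => X; rewrite ler_nat.
by case: (E1 X) (E12 X) => // ->.
Qed.

Lemma Pr_ge0 E : 0 <= Pr E.
Proof. by apply: sumr_ge0 => X _; apply: mass_ge0. Qed.

Lemma Pr_compl E : Pr (predC E) = 1 - Pr E.
Proof. by rewrite -sum_mass [in RHS](bigID E) /= addrAC subrr add0r. Qed.

Lemma PrU (E1 E2 : pred {set T}) : Pr (predU E1 E2) <= Pr E1 + Pr E2.
Proof.
rewrite !PrE -big_split /=; apply: ler_sum => X _.
rewrite -mulrDr ler_wpM2l ?mass_ge0 //.
by case: (E1 X); case: (E2 X) => /=; rewrite ?addr0 ?add0r ?lexx // lerDl.
Qed.

Lemma Pr_union (I : finType) (A : pred I) (E : I -> pred {set T}) (D : pred {set T}) c :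
    (forall X, D X -> exists2 i, A i & E i X) ->
    (forall i, A i -> Pr (E i) <= c) ->
  Pr D <= #|A|%:R * c.
Proof.
move=> DE Ec; apply: (@le_trans _ _ (\sum_(i | A i) Pr (E i))); last first.
  by rewrite mulr_natl -sumr_const; apply: ler_sum.
under eq_bigr do rewrite PrE.
rewrite PrE exchange_big /=; apply: ler_sum => X _; rewrite -mulr_sumr.
rewrite ler_wpM2l ?mass_ge0 //; case DX: (D X); last first.
  by apply: sumr_ge0 => i _; apply: ler0n.
have [i Ai EiX] := DE X DX.
by rewrite (bigD1 i) //= EiX lerDl sumr_ge0 // => j _; apply: ler0n.
Qed.

Lemma markov (F : {set T} -> R) (E : pred {set T}) c :
    (forall X, 0 <= F X) -> (forall X, E X -> c <= F X) ->
  c * Pr E <= Ex F.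
Proof.
move=> F0 EF; rewrite PrE /Ex mulr_sumr; apply: ler_sum => X _.
rewrite mulrCA ler_wpM2l ?mass_ge0 //; case EX: (E X); rewrite ?mulr1 ?mulr0 //.
exact: EF.
Qed.

(** Made for centred variables: in expectation the linear term vanishes and only [expR (2 * x ^+ 2)]
    survives. Above [1 / 2] one has [x <= 2 * x ^+ 2]; below [- (1 / 2)] the left side is at most 1;
    in between [expR x <= 1 / (1 - x) <= 1 + x + 2 * x ^+ 2]. *)
Lemma expR_le_quad (x : R) : expR x <= x + expR (2 * x ^+ 2).
Proof.
have h2 := expR_ge1Dx (2 * x ^+ 2).
have [xs|xb] := lerP x (1 / 2); last first.
  have : expR x <= expR (2 * x ^+ 2) by rewrite ler_expR; nra.
  by lra.
have [xn|xn] := lerP x (- (1 / 2)).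
  have : expR x <= 1 by rewrite -expR0 ler_expR; lra.
  nra.
have h1 := expR_ge1Dx (- x); rewrite expRN in h1.
have e0 := expR_gt0 x.
have : expR x * (1 - x) <= 1.
  by rewrite -[X in _ <= X](divff (lt0r_neq0 e0)) ler_pM2l.
nra.
Qed.

Lemma mgf_bernoulli (s : R) :
  p * expR (s * (1 - p)) + (1 - p) * expR (s * (0 - p)) <= expR (2 * s ^+ 2).
Proof.
have a1 := expR_le_quad (s * (1 - p)); have a2 := expR_le_quad (s * (0 - p)).
have q0 := q_ge0; have [p0 p1] : 0 <= p /\ p <= 1 by [].
have b1 : expR (2 * (s * (1 - p)) ^+ 2) <= expR (2 * s ^+ 2).
  rewrite ler_expR exprMn ler_pM2l // ler_piMr ?sqr_ge0 //; nra.
have b2 : expR (2 * (s * (0 - p)) ^+ 2) <= expR (2 * s ^+ 2).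
  rewrite ler_expR exprMn ler_pM2l // ler_piMr ?sqr_ge0 //; nra.
nra.
Qed.

(* The exponential of the linear form, divided by its variance proxy, is a
   supermartingale when the coordinates of [s] are revealed one by one. *)
Lemma Ex_exp_linear (l : R) (s : seq T) (c : {set T} -> T -> R) :
    uniq s -> (forall X w v, w \in s -> c (w |: X) v = c (X :\ w) v) ->
  Ex (fun X => expR (\sum_(w <- s) (l * c X w * ((w \in X)%:R - p)
                                     - 2 * (l * c X w) ^+ 2))) <= 1.
Proof.
elim: s => [|w s IHs] /= => [_ _|/andP[ws us] hc].
  by rewrite /Ex; under eq_bigr do rewrite big_nil expR0 mulr1; rewrite sum_mass.
have hcs : forall X w' v, w' \in s -> c (w' |: X) v = c (X :\ w') v.
  by move=> X w' v w's; apply: hc; rewrite inE w's orbT.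
apply: le_trans (IHs us hcs); rewrite (Ex_flip w).
pose G X := expR (\sum_(v <- s) (l * c (X :\ w) v * ((v \in X)%:R - p)
                                     - 2 * (l * c (X :\ w) v) ^+ 2)).
have inv X v : c X v = c (X :\ w) v.
  have [wX|wX] := boolP (w \in X); first by rewrite -{1}(setD1K wX) hc ?mem_head //; congr (c _ v); apply/setP => x; rewrite !inE andbA andbb.
  by congr (c _ v); apply/esym/setDidPl; rewrite disjoint_sym disjoints1.
have GE X : expR (\sum_(v <- s) (l * c X v * ((v \in X)%:R - p)
                                     - 2 * (l * c X v) ^+ 2)) = G X.
  by rewrite /G; congr expR; apply: eq_bigr => v _; rewrite -inv.
apply: le_Ex => X; rewrite GE !big_cons !expRD !GE.
have memU v : v \in s -> (v \in w |: X) = (v \in X).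
  by rewrite !inE; case: eqP => // ->; rewrite (negPf ws).
have memD v : v \in s -> (v \in X :\ w) = (v \in X).
  by rewrite !inE; case: eqP => // ->; rewrite (negPf ws).
have cU v : c (w |: X) v = c (X :\ w) v by rewrite hc ?mem_head.
have GU : G (w |: X) = G X.
  rewrite /G; congr expR; rewrite !big_seq; apply: eq_bigr => v vs.
  have -> : c ((w |: X) :\ w) v = c (X :\ w) v by rewrite -inv cU.
  by rewrite memU.
have GD : G (X :\ w) = G X.
  rewrite /G; congr expR; rewrite !big_seq; apply: eq_bigr => v vs.
  have -> : c ((X :\ w) :\ w) v = c (X :\ w) v by rewrite -inv.
  by rewrite memD.
rewrite GU GD cU !inE eqxx /=.
set s0 := l * c (X :\ w) w.
have G0 : 0 < G X by apply: expR_gt0.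
have := mgf_bernoulli s0.
set a := expR (2 * s0 ^+ 2) => h.
have a0 : 0 < a by apply: expR_gt0.
rewrite mulr1n mulr0n !expRN -/a.
have -> : p * (expR (s0 * (1 - p)) / a * G X) + (1 - p) * (expR (s0 * (0 - p)) / a * G X) =
  (p * expR (s0 * (1 - p)) + (1 - p) * expR (s0 * (0 - p))) / a * G X by ring.
rewrite -[X in _ <= X]mul1r ler_pM2r //.
by rewrite ler_pdivrMr // mul1r.
Qed.

(** Coefficients may depend on [X] outside [W], so that one level of the cube can be frozen while
    the next stays random: given [X :\: W], the form is linear in independent centred indicators. *)
Lemma hoeffding W (c : {set T} -> T -> R) (B t : R) :
    (forall X Y, X :\: W = Y :\: W -> c X =1 c Y) ->
    (forall X, \sum_(w in W) c X w ^+ 2 <= B) -> 0 < B -> 0 <= t ->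
  Pr (fun X => t <= \sum_(w in W) c X w * ((w \in X)%:R - p)) <= expR (- (t ^+ 2 / (8 * B))).
Proof.
(* This [l] maximises [l * t - 2 * l ^+ 2 * B], and the maximum is [t ^+ 2 / (8 * B)]. *)
move=> hc hB B0 t0; set l := t / (4 * B).
have hcW X w v : w \in enum W -> c (w |: X) v = c (X :\ w) v.
  rewrite mem_enum => wW; apply: hc; apply/setP => x; rewrite !inE.
  by case: eqP => // ->; rewrite wW.
have := Ex_exp_linear l (enum_uniq W) hcW.
set F := (fun X => expR _) => EF.
have l0 : 0 <= l by rewrite divr_ge0 // mulr_ge0 // ltW.
have F0 X : 0 <= F X by apply: expR_ge0.
have key X : t <= \sum_(w in W) c X w * ((w \in X)%:R - p) ->
    expR (t ^+ 2 / (8 * B)) <= F X.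
  move=> tX; rewrite /F ler_expR big_enum /= sumrB.
  have -> : \sum_(w in W) l * c X w * ((w \in X)%:R - p) =
            l * \sum_(w in W) c X w * ((w \in X)%:R - p).
    by rewrite mulr_sumr; apply: eq_bigr => w _; rewrite mulrA.
  have -> : \sum_(w in W) 2 * (l * c X w) ^+ 2 = 2 * l ^+ 2 * \sum_(w in W) c X w ^+ 2.
    by rewrite mulr_sumr; apply: eq_bigr => w _; ring.
  have h1 : l * t <= l * \sum_(w in W) c X w * ((w \in X)%:R - p) by rewrite ler_wpM2l.
  have h2 : 2 * l ^+ 2 * \sum_(w in W) c X w ^+ 2 <= 2 * l ^+ 2 * B.
    by rewrite ler_wpM2l // mulr_ge0 // sqr_ge0.
  have -> : t ^+ 2 / (8 * B) = l * t - 2 * l ^+ 2 * B.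
    by rewrite /l; field; rewrite (gt_eqF B0).
  lra.
have := markov F0 key; rewrite expRN => h.
rewrite -[X in _ <= X]mul1r ler_pdivlMr ?expR_gt0 // mulrC.
exact: le_trans h EF.
Qed.

(** Markov's inequality for [x ^+ #|X :&: W|], a product of independent factors of mean
    [1 - p + p * x]. When [p > 1 / 2] and [x] is small this base is below [1 / 2], so that sets [W]
    of size [n] beat a union bound over all [2 ^ n] vertices. *)
Lemma low_count_bound W (x : R) (t : nat) : 0 < x <= 1 ->
  Pr (fun X => #|X :&: W| <= t)%N <= x ^- t * (1 - p + p * x) ^+ #|W|.
Proof.
move=> /andP[x0 x1].
pose F X := \prod_w (if w \in X then (if w \in W then x else 1) else 1).
have FE X : F X = x ^+ #|X :&: W|.
  rewrite -prodr_const /F -big_mkcond /= -big_mkcondr /=.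
  by apply: eq_bigl => w; rewrite inE.
have EF : Ex F = (1 - p + p * x) ^+ #|W|.
  rewrite Ex_prod -prodr_const [RHS]big_mkcond; apply: eq_bigr => w _.
  by case: ifP => _; ring.
rewrite -EF mulrC ler_pdivlMr ?exprn_gt0 // mulrC; apply: markov => X.
  by rewrite FE exprn_ge0 // ltW.
by rewrite FE => h; apply: ler_wiXn2l => //; apply: ltW.
Qed.

End RandomSubset.

(** * The covering relation of the cube *)

Section DoubleCounting.
Variables (R : realType) (A B : finType).

Lemma double_count (P : {set A}) (Q : {set B}) (r : A -> B -> bool) (m k : R) :
    (forall a, a \in P -> m <= #|[set b in Q | r a b]|%:R) ->
    (forall b, b \in Q -> #|[set a in P | r a b]|%:R <= k) ->
  m * #|P|%:R <= k * #|Q|%:R.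
Proof.
move=> hm hk.
have sP : m * #|P|%:R <= \sum_(a in P) #|[set b in Q | r a b]|%:R.
  by rewrite mulr_natr -sumr_const; apply: ler_sum.
have sQ : \sum_(b in Q) #|[set a in P | r a b]|%:R <= k * #|Q|%:R.
  by rewrite mulr_natr -sumr_const; apply: ler_sum.
apply: le_trans sP (le_trans _ sQ); rewrite -!natr_sum ler_nat.
under eq_bigr => a _ do rewrite -sum1dep_card big_mkcondr.
under [leqRHS]eq_bigr => b _ do rewrite -sum1dep_card big_mkcondr.
by rewrite exchange_big.
Qed.

End DoubleCounting.

Lemma leq_card_exists2 (A B : finType) (P : {set A}) (Q : {set B}) (f : B -> A) :
  (forall a, a \in P -> exists2 b, b \in Q & a = f b) -> (#|P| <= #|Q|)%N.
Proof.
move=> h; apply: leq_trans (leq_imset_card f Q); apply: subset_leq_card.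
by apply/subsetP => a /h[b bQ ->]; apply: imset_f.
Qed.

Section Lattice.
Variable n : nat.
Notation V := {set 'I_n}.
Implicit Types (u v w z : V) (x y : 'I_n).

Definition adj u v := (u \subset v) && (#|v| == #|u|.+1).
Definition up u := [set v | adj u v].
Definition dn v := [set u | adj u v].

Lemma in_up u v : (v \in up u) = adj u v. Proof. by rewrite inE. Qed.

Lemma in_dn u v : (u \in dn v) = adj u v. Proof. by rewrite inE. Qed.

Lemma adj_add u y : y \notin u -> adj u (y |: u).
Proof. by move=> yu; rewrite /adj subsetUr cardsU1 yu eqxx. Qed.

Lemma adj_del v x : x \in v -> adj (v :\ x) v.
Proof. by move=> xv; rewrite /adj subsetDl (cardsD1 x v) xv eqxx. Qed.

Lemma adj_addP u v : adj u v -> exists2 y, y \notin u & v = y |: u.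
Proof.
case/andP=> uv /eqP cv.
have : #|v :\: u| == 1%N by rewrite cardsD (setIidPr uv) cv subSnn.
case/cards1P=> y vuy; exists y.
  have : y \in v :\: u by rewrite vuy set11.
  by rewrite inE => /andP[].
by rewrite -vuy setUC -{1}(setID v u) (setIidPr uv).
Qed.

Lemma adj_delP u v : adj u v -> exists2 x, x \in v & u = v :\ x.
Proof.
by move=> /adj_addP[y yu ->]; exists y; rewrite ?setU11 ?setU1K.
Qed.

Lemma card_dn v : #|dn v| = #|v|.
Proof.
have -> : dn v = [set v :\ x | x in v].
  apply/setP => u; rewrite inE; apply/idP/imsetP => [/adj_delP[x xv ->]|[x xv ->]].
    by exists x.
  exact: adj_del.
rewrite card_in_imset // => x y xv yv /setP/(_ x).
by rewrite !inE eqxx xv andbT /=; case: eqP.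
Qed.

Lemma card_up u : #|up u| = (n - #|u|)%N.
Proof.
have -> : up u = [set x |: u | x in ~: u].
  apply/setP => v; rewrite inE; apply/idP/imsetP => [/adj_addP[x xv ->]|[x xv ->]].
    by exists x; rewrite ?inE.
  by apply: adj_add; rewrite inE in xv.
rewrite card_in_imset; first by rewrite cardsCs setCK card_ord.
move=> x y; rewrite !inE => xv yv.
by move=> /setP/(_ x); rewrite !inE eqxx (negPf xv) orbF /=; case: eqP.
Qed.

Lemma card_leqn u : (#|u| <= n)%N.
Proof. by have := max_card u; rewrite card_ord. Qed.

Lemma card_dn_le v : (#|dn v| <= n)%N.
Proof. by rewrite card_dn card_leqn. Qed.

Lemma card_up_le u : (#|up u| <= n)%N.
Proof. by rewrite card_up leq_subr. Qed.

Lemma adj_card u v : adj u v -> #|v| = #|u|.+1.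
Proof. by case/andP=> _ /eqP. Qed.

Lemma adjC u v : adj (~: v) (~: u) = adj u v.
Proof.
rewrite /adj setCS; apply: andb_id2l => uv; have := subset_leq_card uv.
have := cardsC u; have := cardsC v; rewrite card_ord; lia.
Qed.

Lemma adj_meet u v w : adj u v -> adj u w -> v != w -> u = v :&: w.
Proof.
move=> uv uw; apply: contraNeq => neq.
have [/andP[suv _] /andP[suw _]] := (uv, uw).
have ps : u \proper v :&: w.
  by rewrite properE subsetI suv suw /=; apply: contra neq => s; rewrite eqEsubset s subsetI suv suw.
have := proper_card ps; have := adj_card uv; have := adj_card uw => cw cv lt.
have e1 : v :&: w == v by rewrite eqEcard subsetIl cv.
have e2 : v :&: w == w by rewrite eqEcard subsetIr cw.
by rewrite -(eqP e1).
Qed.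

Lemma adj_join u v w : adj v u -> adj w u -> v != w -> u = v :|: w.
Proof.
move=> vu wu vw; rewrite -[u]setCK -[v]setCK -[w]setCK -setCI; congr (~: _).
by apply: adj_meet; rewrite ?adjC // (inj_eq (can_inj (@setCK _))).
Qed.

Definition dist u v : nat := (#|u :\: v| + #|v :\: u|)%N.

Lemma distC u v : dist u v = dist v u. Proof. exact: addnC. Qed.

Lemma dist0 u : dist u u = 0%N. Proof. by rewrite /dist setDv cards0. Qed.

Lemma dist_tri v u w : (dist u w <= dist u v + dist v w)%N.
Proof.
have sub (a b c : V) : (#|a :\: c| <= #|a :\: b| + #|b :\: c|)%N.
  apply: leq_trans (leq_card_setU _ _); apply: subset_leq_card.
  by apply/subsetP => x; rewrite !inE => /andP[-> ->]; case: (x \in b).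
by have := sub u v w; have := sub w v u; rewrite /dist; lia.
Qed.

Lemma dist_adj u v : adj u v -> dist u v = 1%N.
Proof.
move=> uv; have /andP[suv _] := uv; rewrite /dist cardsD (setIidPl suv) subnn.
by rewrite cardsD (setIidPr suv) (adj_card uv) subSnn.
Qed.

Lemma dist_setC u v : dist (~: u) (~: v) = dist u v.
Proof. by rewrite distC /dist !setDE !setCK; congr (_ + _)%N; rewrite setIC. Qed.

Definition ball z r : {set V} := [set v | (dist v z <= r)%N].

(** Each unit of distance is undone by flipping one coordinate. [None] is the move that stays in
    place, so there are [n + 1] moves per step. *)
Lemma card_ball z r : (#|ball z r| <= n.+1 ^ r)%N.
Proof.
elim: r => [|r IHr].
  rewrite expn0 -(cards1 z); apply: subset_leq_card; apply/subsetP => v.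
  rewrite !inE leqn0 addn_eq0 !cards_eq0 !setD_eq0 => /andP[? ?].
  by rewrite eqEsubset; apply/andP.
pose f (o : option 'I_n) v := if o is Some x then (if x \in v then v :\ x else x |: v) else v.
have -> : (n.+1 ^ r.+1 = #|{: option 'I_n}| * n.+1 ^ r)%N by rewrite card_option card_ord expnS.
apply: leq_trans (_ : _ <= #|setX [set: option 'I_n] (ball z r)|)%N _; last first.
  by rewrite cardsX cardsT leq_mul2l IHr orbT.
apply: (@leq_card_exists2 _ _ _ _ (fun a => f a.1 a.2)) => v; rewrite inE => dv.
have [dr|dr] := leqP (dist v z) r; first by exists (None, v); rewrite // !inE.
have [vz0|[x xv]] := set_0Vmem (v :\: z).
  have [zv0|[x xz]] := set_0Vmem (z :\: v).
    by move: dr; rewrite /dist vz0 zv0 cards0.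
  have [xv xzz] : x \notin v /\ x \in z by move: xz; rewrite inE => /andP[].
  exists (Some x, x |: v); last by rewrite /= setU11 setU1K.
  rewrite !inE /=; apply: leq_trans (_ : (dist v z).-1 <= r)%N; last by lia.
  have e1 : (x |: v) :\: z = v :\: z.
    by apply/setP => y; rewrite !inE; case: eqP => // ->; rewrite xzz /=.
  have e2 : z :\: (x |: v) = (z :\: v) :\ x.
    by apply/setP => y; rewrite !inE negb_or andbA.
  by rewrite /dist e1 e2 (cardsD1 x (z :\: v)) xz; lia.
have [xz xvv] : x \notin z /\ x \in v by move: xv; rewrite inE => /andP[].
exists (Some x, v :\ x); last by rewrite /= setD11 setD1K.
rewrite !inE /=; apply: leq_trans (_ : (dist v z).-1 <= r)%N; last by lia.
have e1 : (v :\ x) :\: z = (v :\: z) :\ x.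
  by apply/setP => y; rewrite !inE andbCA.
have e2 : z :\: (v :\ x) = z :\: v.
  by apply/setP => y; rewrite !inE negb_and negbK; case: eqP => // ->; rewrite (negPf xz) !andbF.
by rewrite /dist e1 e2 (cardsD1 x (v :\: z)) xv; lia.
Qed.

(** The sphere of radius [r] in the Johnson graph of a level: [r] swaps apart, which is distance
    [2 * r] in the cube. *)
Definition sph r u w := (#|u| == #|w|) && (#|u :\: w| == r).

Lemma card_setD_eq u w : #|u| = #|w| -> #|u :\: w| = #|w :\: u|.
Proof. by move=> e; rewrite !cardsD e setIC. Qed.

Lemma sphC r u w : sph r u w = sph r w u.
Proof. by rewrite /sph eq_sym; apply: andb_id2l => /eqP e; rewrite card_setD_eq. Qed.

Lemma dist_sph r u w : sph r u w -> dist u w = r.*2.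
Proof.
by case/andP=> /eqP e /eqP h; rewrite /dist -(card_setD_eq e) h addnn.
Qed.

Lemma card_sph r u : #|[set w | sph r u w]| = ('C(#|u|, r) * 'C(n - #|u|, r))%N.
Proof.
have cC : #|~: u| = (n - #|u|)%N by rewrite cardsCs setCK card_ord.
rewrite -cC -!cards_draws -cardsX.
set D := setX _ _; pose f (a : V * V) := (u :\: a.1) :|: a.2.
have fD a : a \in D -> (u :\: f a = a.1) /\ (f a :\: u = a.2).
  rewrite !inE => /andP[/andP[/subsetP s1 _] /andP[/subsetP s2 _]].
  split; apply/setP => x; rewrite !inE.
    have := s1 x; have := s2 x; rewrite !inE.
    by case: (x \in a.1); case: (x \in a.2); case: (x \in u) => //= h1 h2;
       (try by have := h1 isT); (try by have := h2 isT).
  have := s1 x; have := s2 x; rewrite !inE.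
  by case: (x \in a.1); case: (x \in a.2); case: (x \in u) => //= h1 h2;
     (try by have := h1 isT); (try by have := h2 isT).
have -> : [set w | sph r u w] = f @: D.
  apply/setP => w; rewrite inE; apply/idP/imsetP => [/andP[/eqP e /eqP c]|].
    exists (u :\: w, w :\: u).
      rewrite !inE subsetDl c eqxx /= -(card_setD_eq e) c eqxx andbT.
      by apply/subsetP => x; rewrite !inE => /andP[].
    by apply/setP => x; rewrite !inE /=; case: (x \in u); case: (x \in w).
  case=> a aD ->; have [e1 e2] := fD a aD; rewrite /sph e1.
  move: aD; rewrite !inE => /andP[/andP[s1 /eqP c1] /andP[s2 /eqP c2]].
  rewrite c1 eqxx andbT -(cardsID (f a) u) -(cardsID u (f a)) e1 e2 c1 c2.
  by rewrite setIC.
by rewrite card_in_imset // => a b /fD[a1 a2] /fD[b1 b2] e; rewrite [a]surjective_pairing [b]surjective_pairing -a1 -a2 -b1 -b2 e.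
Qed.

Lemma sph_step r u w : sph r.+1 u w -> exists2 v, sph 1 u v & sph r v w.
Proof.
case/andP=> /eqP e /eqP c; have c' := c; rewrite card_setD_eq // in c'.
have [x xu] : exists x, x \in u :\: w by apply/card_gt0P; rewrite c.
have [y yw] : exists y, y \in w :\: u by apply/card_gt0P; rewrite c'.
have [xw xuu] : x \notin w /\ x \in u by move: xu; rewrite inE => /andP[].
have [yu yww] : y \notin u /\ y \in w by move: yw; rewrite inE => /andP[].
have xy : x != y by apply: contraNneq xw => ->.
exists (y |: (u :\ x)).
  apply/andP; split; first by rewrite cardsU1 !inE (negPf yu) andbF (cardsD1 x u) xuu.
  have -> : u :\: (y |: u :\ x) = [set x].
    apply/setP => t; rewrite !inE; case: (t =P x) => [->|_] /=.
      by rewrite xuu orbF xy.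
    by case: (t \in u); rewrite ?orbT ?andbF.
  by rewrite cards1.
apply/andP; split.
  by rewrite cardsU1 !inE (negPf yu) andbF -e (cardsD1 x u) xuu.
have -> : (y |: u :\ x) :\: w = (u :\: w) :\ x.
  apply/setP => t; rewrite !inE; case: (t =P y) => [->|_] /=.
    by rewrite yww andbF.
  by rewrite andbCA.
by move: c; rewrite (cardsD1 x (u :\: w)) xu add1n => -[->].
Qed.

Lemma swapP u w : sph 1 u w -> exists x y, [/\ x \in u, y \notin u & w = y |: (u :\ x)].
Proof.
case/andP=> /eqP e /cards1P[x ux].
have : #|w :\: u| == 1%N by rewrite -(card_setD_eq e) ux cards1.
case/cards1P=> y wy; exists x, y.
have xu : x \in u :\: w by rewrite ux set11.
have yw : y \in w :\: u by rewrite wy set11.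
move: (xu) (yw); rewrite !inE => /andP[xw xuu] /andP[yu yww]; split=> //.
apply/setP => t; rewrite !inE.
have := congr1 (fun s : {set 'I_n} => t \in s) ux.
have := congr1 (fun s : {set 'I_n} => t \in s) wy; rewrite !inE.
by case: (t \in u); case: (t \in w) => //= <- <-.
Qed.

Lemma swap_up u w : sph 1 u w -> exists2 v, adj u v & adj w v.
Proof.
case/swapP=> x [y [xu yu ->]]; exists (y |: u); first exact: adj_add.
have xy : x != y by apply: contraNneq yu => <-.
have -> : y |: u :\ x = (y |: u) :\ x.
  by apply/setP => t; rewrite !inE; case: (t =P x) => [->|] //=; rewrite (negPf xy).
by apply: adj_del; rewrite !inE xu orbT.
Qed.

Lemma swap_dn u w : sph 1 u w -> exists2 v, adj v u & adj v w.
Proof.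
case/swapP=> x [y [xu yu ->]]; exists (u :\ x); first exact: adj_del.
by apply: adj_add; rewrite !inE (negPf yu) andbF.
Qed.

Lemma card_swap_le u : (#|[set w | sph 1 u w]| <= n ^ 2)%N.
Proof.
by rewrite card_sph !bin1 -mulnn leq_mul ?leq_subr ?card_leqn.
Qed.

End Lattice.

(** * Edge isoperimetry for swaps *)

Section Isoperimetry.
Variable n : nat.
Notation V := {set 'I_n}.
Implicit Types (u v w z : V) (s : {perm 'I_n}) (F : {set V}).

Lemma count_enum_ord (P : pred 'I_n) : count P (enum 'I_n) = #|P|.
Proof. by rewrite -sum1_count big_enum_cond /= -sum1_card. Qed.

(** A pair of sets is read as the word of its membership patterns along [enum 'I_n]. Two swap pairs
    of one level contain each of the four letters equally often, so one word is a rearrangement of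
    the other. *)
Lemma perm_swap_pair v v' w w' : sph 1 v v' -> sph 1 w w' -> #|v| = #|w| ->
  exists s : {perm 'I_n}, s @: v = w /\ s @: v' = w'.
Proof.
move=> /andP[/eqP cv /eqP dv] /andP[/eqP cw /eqP dw] vw.
pose c (a b : V) := [seq (i \in a, i \in b) | i <- enum 'I_n].
have cI (a b : V) : #|a| = (#|a :&: b| + #|a :\: b|)%N by rewrite cardsID.
have c1 : #|v :&: v'| = #|w :&: w'| by have := cI v v'; have := cI w w'; lia.
have d' : #|v' :\: v| = #|w' :\: w|.
  by rewrite -(card_setD_eq cv) -(card_setD_eq cw) dv dw.
have cU (a b : V) : (#|~: (a :|: b)| = n - (#|a| + #|b :\: a|))%N.
  by rewrite cardsCs setCK card_ord -cardsUI (setIC a) setDE -setIA (setIC (~: a)) setICr setI0 cards0 addn0 setUIr setUCr setIT.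
have pe : perm_eq (c w w') (c v v').
  have cm (a b : V) P : count P (c a b) = #|preim (fun i : 'I_n => (i \in a, i \in b)) P|.
    by rewrite /c count_map count_enum_ord.
  apply/allP => -[b1 b2] _ /=; rewrite !cm.
  have cE (a b : V) : #|preim (fun i : 'I_n => (i \in a, i \in b)) (pred1 (b1, b2))| =
      if b1 then (if b2 then #|a :&: b| else #|a :\: b|)
      else (if b2 then #|b :\: a| else #|~: (a :|: b)|).
    by case: b1; case: b2; apply: eq_card => i; rewrite !inE xpair_eqE;
       case: (i \in a); case: (i \in b).
  by rewrite !cE !cU d' -vw dv dw c1 eqxx.
have sz : size (c v v') == n by rewrite size_map size_enum_ord.
have /(@tuple_permP _ _ _ (Tuple sz))[s hs] := pe.
have hi i : (i \in w, i \in w') = (s i \in v, s i \in v').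
  have := congr1 (fun t => nth (false, false) t i) hs.
  rewrite (nth_map i) ?size_enum_ord // nth_ord_enum => ->.
  rewrite -tnth_nth tnth_mktuple (tnth_nth (false, false)) /= (nth_map i) ?size_enum_ord //.
  by rewrite nth_ord_enum.
exists (s^-1)%g; split; apply/setP => i.
  have [-> _] := hi i; rewrite -{1}(permK s i) mem_imset //; exact: perm_inj.
have [_ ->] := hi i; rewrite -{1}(permK s i) mem_imset //; exact: perm_inj.
Qed.

(** Up to the factor [n!], the probability that a random image of [F] under the symmetric group
    separates [v] and [w]. It satisfies the triangle inequality, and by transitivity it takes the
    same value on all swap pairs of a level. *)
Definition disagree F v w : nat := #|[set s : {perm 'I_n} | (s @: v \in F) != (s @: w \in F)]|.

Lemma disagree_tri F v u w : (disagree F v w <= disagree F v u + disagree F u w)%N.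
Proof.
apply: leq_trans (leq_card_setU _ _); apply: subset_leq_card; apply/subsetP => s.
by rewrite !inE; case: (_ \in F); case: (_ \in F); case: (_ \in F).
Qed.

Lemma disagree_swap F v v' w w' : sph 1 v v' -> sph 1 w w' -> #|v| = #|w| ->
  disagree F v v' = disagree F w w'.
Proof.
move=> vv ww vw; have [t [<- <-]] := perm_swap_pair vv ww vw.
rewrite /disagree -(card_imset (mem [set s : {perm 'I_n} | _ != (s @: (t @: v') \in F)]) (mulgI t)).
apply: eq_card => s; rewrite inE; apply/idP/imsetP => [h|[r]].
  exists (t^-1 * s)%g; last by rewrite mulKVg.
  have e (a : V) : (t^-1 * s)%g @: (t @: a) = s @: a.
    by rewrite -imset_comp; apply: eq_imset => x /=; rewrite permM permK.
  by rewrite inE !e.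
rewrite inE => h ->.
have e (a : V) : (t * r)%g @: a = r @: (t @: a).
  by rewrite -imset_comp; apply: eq_imset => x /=; rewrite permM.
by rewrite !e.
Qed.

Lemma disagree_sph F r v w a b : sph 1 a b -> #|a| = #|v| -> sph r v w ->
  (disagree F v w <= r * disagree F a b)%N.
Proof.
move=> ab; elim: r v => [|r IHr] v av.
  case/andP=> /eqP e; rewrite cards_eq0 setD_eq0 => s.
  have -> : v = w by apply/eqP; rewrite eqEcard s e leqnn.
  rewrite /disagree mul0n leqn0 cards_eq0; apply/eqP/setP => t; rewrite !inE.
  by rewrite eqxx.
move=> /sph_step[u vu uw]; apply: leq_trans (disagree_tri _ _ u _) _.
rewrite mulSn leq_add //; first by rewrite (disagree_swap F vu ab).
by apply: IHr => //; rewrite av; case/andP: vu => /eqP.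
Qed.

Lemma card_perm_imset s v : #|s @: v| = #|v|.
Proof. by rewrite card_imset //; apply: perm_inj. Qed.

Definition cut_pairs r F : {set V * V} :=
  [set e | sph r e.1 e.2 & (e.1 \in F) != (e.2 \in F)].

(** For a fixed permutation, applying it to both entries is a bijection of the pairs in [P]; hence
    every permutation separates the same number of them. *)
Lemma sum_disagree F (P : rel V) :
    (forall s v w, P (s @: v) (s @: w) = P v w) ->
  (\sum_(e : V * V | P e.1 e.2) disagree F e.1 e.2 =
   #|{: {perm 'I_n}}| * #|[set e : V * V | P e.1 e.2 & (e.1 \in F) != (e.2 \in F)]|)%N.
Proof.
move=> hP; under eq_bigr => e _ do rewrite /disagree -sum1dep_card big_mkcond /=.
rewrite exchange_big /= -sum1_card big_distrl /=; apply: eq_bigr => s _.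
rewrite mul1n -big_mkcondr /= -sum1dep_card.
pose f (e : V * V) := (s @: e.1, s @: e.2).
pose g (e : V * V) := ((s^-1)%g @: e.1, (s^-1)%g @: e.2).
rewrite [RHS](reindex_onto f g) /=; last first.
  by move=> [a b] _; rewrite /f /g /= -!imset_comp;
     congr pair; rewrite -[RHS]imset_id; apply: eq_imset => x /=; rewrite permKV.
apply: eq_bigl => -[a b] /=; rewrite hP.
have -> : g (f (a, b)) = (a, b).
  by rewrite /f /g /= -!imset_comp;
     congr pair; rewrite -[RHS]imset_id; apply: eq_imset => x /=; rewrite permK.
by rewrite eqxx andbT.
Qed.

Lemma card_cut_all F j : F \subset layer n j ->
  #|[set e : V * V | (e.1 \in layer n j) && (e.2 \in layer n j) & (e.1 \in F) != (e.2 \in F)]|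
  = (2 * (#|F| * #|layer n j :\: F|))%N.
Proof.
move=> FL; rewrite mul2n -addnn -{2}[(_ * _)%N]mulnC -!cardsX.
have dj : setX F (layer n j :\: F) :&: setX (layer n j :\: F) F = set0.
  apply/setP => -[a b]; rewrite !inE /=.
  by case: (a \in F); rewrite /= ?andbF.
rewrite -[RHS]subn0 -(cards0 (V * V)%type) -dj -cardsU.
apply: eq_card => -[a b]; rewrite !inE /=.
have := subsetP FL a; have := subsetP FL b; rewrite !inE.
by case: (a \in F); case: (b \in F); case: (#|a| == j); case: (#|b| == j) => //= h1 h2;
   (try by have := h1 isT); (try by have := h2 isT).
Qed.

(** Two sets of the level are at most [n] swaps apart, so a random image of [F] separates them with
    at most [n] times the probability [D0] that it separates one swap pair. Summing over all pairs
    of the level bounds [|F| * |layer \ F|] by [D0]; summing over swap pairs only bounds [D0] by the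
    cut. *)
Lemma isoperimetry F j : (0 < j < n)%N -> F \subset layer n j ->
  (2 * (#|F| * #|layer n j :\: F|) * (j * (n - j)) <= #|layer n j| * n * #|cut_pairs 1 F|)%N.
Proof.
move=> /andP[j0 jn] FL.
have [a0 ca] : exists a : V, #|a| = j.
  have : (0 < #|[set A : V | A \subset setT & #|A| == j]|)%N.
    by rewrite cards_draws cardsT card_ord bin_gt0 ltnW.
  by case/card_gt0P=> a; rewrite inE => /andP[_ /eqP]; exists a.
have [b0 ab] : exists b, sph 1 a0 b.
  have : (0 < #|[set w | sph 1 a0 w]|)%N by rewrite card_sph !bin1 ca muln_gt0 j0 subn_gt0.
  by case/card_gt0P=> b; rewrite inE; exists b.
set D0 := disagree F a0 b0; set N := #|layer n j|; set G := #|{: {perm 'I_n}}|.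
have G0 : (0 < G)%N by apply/card_gt0P; exists (1%g : {perm 'I_n}).
have Lperm s v : (s @: v \in layer n j) = (v \in layer n j) by rewrite !inE card_perm_imset.
have eqA := @sum_disagree F (fun v w => (v \in layer n j) && (w \in layer n j))
   (fun s v w => congr2 andb (Lperm s v) (Lperm s w)).
rewrite /= card_cut_all // -/G in eqA.
have sphperm s v w : sph 1 (s @: v) (s @: w) = sph 1 v w.
  have e : (s @: v) :\: (s @: w) = s @: (v :\: w).
    apply/setP => x; rewrite -(permKV s x) inE !mem_imset ?inE //; exact: perm_inj.
  by rewrite /sph e !card_perm_imset.
have hB s v w : (v \in layer n j) && sph 1 v w = (s @: v \in layer n j) && sph 1 (s @: v) (s @: w).
  by rewrite Lperm sphperm.
have eqB := @sum_disagree F (fun v w => (v \in layer n j) && sph 1 v w) (fun s v w => esym (hB s v w)).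
have leB : (#|[set e : V * V | (e.1 \in layer n j) && sph 1 e.1 e.2 & (e.1 \in F) != (e.2 \in F)]| <= #|cut_pairs 1 F|)%N.
  by apply: subset_leq_card; apply/subsetP => e; rewrite !inE => /andP[/andP[_ ->] ->].
have sumA : (G * (2 * (#|F| * #|layer n j :\: F|)) <= N * N * (n * D0))%N.
  rewrite -eqA -cardsX -sum_nat_const.
  rewrite [leqRHS](eq_bigl (fun e : V * V => (e.1 \in layer n j) && (e.2 \in layer n j))); last first.
    by case=> a b; rewrite !inE.
  apply: leq_sum => -[a b] /=; rewrite !inE => /andP[/eqP aj /eqP bj].
  have hs : sph #|a :\: b| a b by rewrite /sph aj bj !eqxx.
  apply: leq_trans (@disagree_sph F _ _ _ _ _ ab _ hs) _; first by rewrite ca aj.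
  by rewrite leq_mul2r card_leqn orbT.
have sumB : (N * (j * (n - j)) * D0 <= G * #|cut_pairs 1 F|)%N.
  apply: leq_trans (_ : _ <= G * #|[set e : V * V | (e.1 \in layer n j) && sph 1 e.1 e.2 & (e.1 \in F) != (e.2 \in F)]|)%N _; last by rewrite leq_mul2l leB orbT.
  rewrite -eqB.
  have -> : (\sum_(e : V * V | (e.1 \in layer n j) && sph 1 e.1 e.2) disagree F e.1 e.2 =
     \sum_(e : V * V | (e.1 \in layer n j) && sph 1 e.1 e.2) D0)%N.
    apply: eq_bigr => e /andP[]; rewrite inE => /eqP cj he.
    by apply: disagree_swap => //; rewrite ca.
  rewrite -(pair_big_dep (fun v => v \in layer n j) (fun v w => sph 1 v w) (fun _ _ => D0)) /=.
  rewrite -mulnA -sum_nat_const leq_sum // => v; rewrite inE => /eqP vj.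
  rewrite sum_nat_const; have := card_sph 1 v; rewrite cardsE !bin1 vj => <-.
  by rewrite leqnn.
have N0 : (0 < N)%N by apply/card_gt0P; exists a0; rewrite inE ca.
rewrite -(leq_pmul2l G0) -(leq_pmul2l N0).
have := leq_mul sumA (leqnn (j * (n - j))); have := leq_mul sumB (leqnn (N * n)).
set x := #|F|; set y := #|layer n j :\: F|; set c := #|cut_pairs 1 F|; nia.
Qed.

End Isoperimetry.

(** * Degrees, and averaging them over spheres *)

Section Degrees.
Variables (R : realType) (p : R) (n : nat) (X : {set {set 'I_n}}).
Notation V := {set 'I_n}.
Implicit Types (u v w z : V).

Definition dX v : nat := #|dn v :&: X|.
Definition uX u : nat := #|up u :&: X|.
Definition low (k : R) v := (dX v)%:R < k * n%:R.
Definition ulow (k : R) u := (uX u)%:R < k * n%:R.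
Definition badd (e : R) v := e * n%:R < `|(dX v)%:R - p * #|v|%:R|.
Definition badu (e : R) u := e * n%:R < `|(uX u)%:R - p * (n - #|u|)%:R|.

(** The patterns built around a centre below stay within distance 6 of it, so radius 8 leaves room
    for all of them. *)
Definition sparse (P : pred V) (i M : nat) : bool :=
  [forall z, #|[set v in ball z 8 | (#|v| == i) && P v]| <= M]%N.

(* The pair [(z, x)] stands for the edge from [u + z - x] to [u + z - x + y],
   the middle step of a detour around the edge from [u] to [u + y]. *)
Definition mixing (g : R) (i : nat) : bool :=
  [forall u : V, forall y, forall A : V, forall B : V,
    [&& #|u| == i, y \notin u, A \subset ~: (y |: u) & B \subset u] ==>
    (p ^+ 2 * (#|A|%:R * #|B|%:R) - g * n%:R ^+ 2 <=
     #|[set zx : 'I_n * 'I_n | [&& zx.1 \in A, zx.2 \in B, (zx.1 |: u) :\ zx.2 \in X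
         & y |: ((zx.1 |: u) :\ zx.2) \in X]]|%:R)].

Definition sph2_size (i : nat) : nat := ('C(i, 2) * 'C(n - i, 2))%N.

Definition quiet_up (h : R) (i : nat) : bool :=
  [forall u : V, (#|u| == i) ==>
    (`|\sum_(w in X | sph 2 u w) ((uX w)%:R - p * (n - i)%:R)| <= h * (sph2_size i)%:R)].

Definition quiet_dn (h : R) (i : nat) : bool :=
  [forall u : V, (#|u| == i) ==>
    (`|\sum_(w in X | sph 2 u w) ((dX w)%:R - p * i%:R)| <= h * (sph2_size i)%:R)].

End Degrees.

(** * Sphere averages and cuts at one and two swaps *)

Section Smoothing.
Variables (R : realType) (n i : nat).
Notation V := {set 'I_n}.

Lemma cut_card (F : {set V}) r (e : V * V) : F \subset layer n i ->
  e \in cut_pairs r F -> #|e.1| = i /\ #|e.2| = i.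
Proof.
move=> /subsetP FL; rewrite inE => /andP[/andP[/eqP c _]].
case h1: (e.1 \in F); first by have := FL _ h1; rewrite inE => /eqP <- _; rewrite c.
by case h2: (e.2 \in F) => // _; have := FL _ h2; rewrite inE c => /eqP.
Qed.

(** Summing [h] over ordered pairs two swaps apart, once with the weight of the first entry in [F]
    and once with that of the second, gives [sph2_size] times the sum over [F], respectively the
    sphere sums centred in [F]. The two weights differ only on the pairs cut by [F]. *)
Lemma smoothing (F : {set V}) (h : V -> R) (a b : R) :
    F \subset layer n i -> (forall u : V, #|u| = i -> `|h u| <= a) ->
    (forall w : V, #|w| = i -> `|\sum_(u | sph 2 w u) h u| <= b) ->
  (sph2_size n i)%:R * `|\sum_(u : V | u \in F) h u| <= b * #|F|%:R + a * #|cut_pairs 2 F|%:R.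
Proof.
move=> FL ha hb; have FLi u : u \in F -> #|u| = i by move/(subsetP FL); rewrite inE => /eqP.
rewrite -[X in X * _]ger0_norm ?ler0n // -normrM.
have -> : (sph2_size n i)%:R * \sum_(u : V | u \in F) h u =
    \sum_(w : V | w \in F) \sum_(u | sph 2 w u) h u +
    \sum_(e : V * V | sph 2 e.1 e.2) ((e.1 \in F)%:R - (e.2 \in F)%:R) * h e.1.
  have e1 : (sph2_size n i)%:R * \sum_(u : V | u \in F) h u =
      \sum_(e : V * V | sph 2 e.1 e.2) (e.1 \in F)%:R * h e.1.
    rewrite -(pair_big_dep xpredT (fun u w => sph 2 u w) (fun u _ => (u \in F)%:R * h u)) /=.
    rewrite mulr_sumr [LHS]big_mkcond; apply: eq_bigr => u _; rewrite sumr_const.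
    case uF: (u \in F); last by rewrite mul0r mul0rn.
    have -> : #|sph 2 u| = sph2_size n i by rewrite /sph2_size -(FLi _ uF) -card_sph cardsE.
    by rewrite mul1r mulr_natl.
  have e2 : \sum_(w : V | w \in F) \sum_(u | sph 2 w u) h u =
      \sum_(e : V * V | sph 2 e.1 e.2) (e.2 \in F)%:R * h e.1.
    rewrite -(pair_big_dep xpredT (fun u w => sph 2 u w) (fun u w => (w \in F)%:R * h u)) /=.
    rewrite [RHS](exchange_big_dep xpredT) //= [LHS]big_mkcond; apply: eq_bigr => w _.
    under eq_bigl do rewrite sphC.
    case: (w \in F); first by apply: eq_bigr => u _; rewrite mul1r.
    by rewrite big1 // => u _; rewrite mul0r.
  rewrite e1 e2 -big_split /=; apply: eq_bigr => e _; ring.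
apply: le_trans (ler_normD _ _) _; apply: lerD.
  apply: le_trans (ler_norm_sum _ _ _) _; rewrite mulr_natr -sumr_const.
  by apply: ler_sum => w wF; apply: hb; apply: FLi.
apply: le_trans (ler_norm_sum _ _ _) _; rewrite mulr_natr -sumr_const.
rewrite [leRHS](eq_bigl (fun e : V * V => sph 2 e.1 e.2 && ((e.1 \in F) != (e.2 \in F)))); last first.
  by move=> e; rewrite inE.
rewrite [leRHS]big_mkcondr /=; apply: ler_sum => e he; rewrite normrM.
case: ifP => [hF|/negbFE/eqP ->]; last by rewrite subrr normr0 mul0r.
have [c1 _] : #|e.1| = i /\ #|e.2| = i by apply: (@cut_card F 2) => //; rewrite inE he hF.
have := ha _ c1; move: hF; case: (e.1 \in F); case: (e.2 \in F) => //= _.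
  by rewrite subr0 normr1 mul1r.
by rewrite sub0r normrN normr1 mul1r.
Qed.

(** A cut pair two swaps apart has a midpoint, and one of its two halves is cut. One cut swap is a
    half of at most [2 * n ^ 2] such pairs. *)
Lemma cut2_cut1 (F : {set V}) : (#|cut_pairs 2 F| <= 2 * n ^ 2 * #|cut_pairs 1 F|)%N.
Proof.
pose r (e f : V * V) := ((e.1 == f.1) && sph 1 f.2 e.2) || ((e.2 == f.2) && sph 1 f.1 e.1).
suff : 1 * (#|cut_pairs 2 F|%:R : R) <= (2 * n ^ 2)%:R * #|cut_pairs 1 F|%:R.
  by rewrite mul1r -natrM ler_nat.
apply: (double_count (r := r)) => [e|f].
  rewrite inE => /andP[/sph_step[v ev ve] hF]; rewrite (ler_nat _ 1) card_gt0.
  case h : ((e.1 \in F) != (v \in F)).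
    apply/set0Pn; exists (e.1, v); rewrite !inE /= ev h /r /= eqxx /=.
    by rewrite ve.
  apply/set0Pn; exists (v, e.2); rewrite !inE /= ve /r /= eqxx /= (sphC _ v) ev orbT.
  by move: h hF; case: (_ \in F); case: (_ \in F); case: (_ \in F).
move=> _; rewrite ler_nat mul2n -addnn.
apply: leq_trans (_ : _ <= #|setX [set f.1] [set w | sph 1 f.2 w]| + #|setX [set w | sph 1 f.1 w] [set f.2]|)%N _.
  apply: leq_trans (leq_card_setU _ _); apply: subset_leq_card; apply/subsetP => e.
  by rewrite !inE => /andP[_ /orP[] /andP[-> ->]]; rewrite ?orbT.
by rewrite !cardsX !cards1 mul1n muln1 leq_add ?card_swap_le.
Qed.

(* [G] lives on the neighbouring level above, and is compared with [F] along
   the covering relation of the lattice. *)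
Lemma cut1_up (F G : {set V}) : F \subset layer n i ->
  (#|cut_pairs 1 F| <= 2 * n * #|[set e : V * V | [&& adj e.1 e.2, #|e.2| == i.+1 & (e.1 \in F) != (e.2 \in G)]]|)%N.
Proof.
move=> FL; set Q := [set _ | _].
pose r (e f : V * V) := ((e.1 == f.1) && adj e.2 f.2) || ((e.2 == f.1) && adj e.1 f.2).
suff : 1 * (#|cut_pairs 1 F|%:R : R) <= (2 * n)%:R * #|Q|%:R.
  by rewrite mul1r -natrM ler_nat.
apply: (double_count (r := r)) => [e|f].
  move=> eF; have [c1 c2] := cut_card FL eF.
  move: eF; rewrite inE => /andP[/swap_up[v ev ve] hF]; rewrite (ler_nat _ 1) card_gt0.
  have cv : #|v| == i.+1 by rewrite (adj_card ev) c1.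
  case h : ((e.1 \in F) != (v \in G)).
    by apply/set0Pn; exists (e.1, v); rewrite !inE /= ev h cv /r /= eqxx ve.
  apply/set0Pn; exists (e.2, v); rewrite !inE /= ve cv /r /= eqxx ev orbT /= andbT.
  by move: h hF; case: (_ \in F); case: (_ \in F); case: (_ \in G).
move=> _; rewrite ler_nat mul2n -addnn.
apply: leq_trans (_ : _ <= #|setX [set f.1] (dn f.2)| + #|setX (dn f.2) [set f.1]|)%N _.
  apply: leq_trans (leq_card_setU _ _); apply: subset_leq_card; apply/subsetP => e.
  by rewrite !inE => /andP[_ /orP[] /andP[-> ->]]; rewrite ?orbT.
by rewrite !cardsX !cards1 mul1n muln1 leq_add ?card_dn_le.
Qed.

Lemma cut1_dn (F G : {set V}) : G \subset layer n i.+1 ->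
  (#|cut_pairs 1 G| <= 2 * n * #|[set e : V * V | [&& adj e.1 e.2, #|e.2| == i.+1 & (e.1 \in F) != (e.2 \in G)]]|)%N.
Proof.
move=> GL; set Q := [set _ | _].
pose r (e f : V * V) := ((e.1 == f.2) && adj f.1 e.2) || ((e.2 == f.2) && adj f.1 e.1).
suff : 1 * (#|cut_pairs 1 G|%:R : R) <= (2 * n)%:R * #|Q|%:R.
  by rewrite mul1r -natrM ler_nat.
apply: (double_count (r := r)) => [e|f].
  rewrite inE => /andP[he hF]; have /swap_dn[v ve ev] := he; rewrite (ler_nat _ 1) card_gt0.
  have ce : #|e.1| = #|e.2| by case/andP: he => /eqP.
  have c1 : #|e.1| == i.+1.
    move: hF; case h1: (e.1 \in G); first by have := subsetP GL _ h1; rewrite inE.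
    by case h2: (e.2 \in G) => // _; have := subsetP GL _ h2; rewrite inE ce.
  have c2 : #|e.2| == i.+1 by rewrite -ce.
  case h : ((v \in F) != (e.1 \in G)).
    by apply/set0Pn; exists (v, e.1); rewrite !inE /= ve h c1 /r /= eqxx ev.
  apply/set0Pn; exists (v, e.2); rewrite !inE /= ev c2 /r /= eqxx ve orbT /= andbT.
  by move: h hF; case: (_ \in G); case: (_ \in G); case: (_ \in F).
move=> _; rewrite ler_nat mul2n -addnn.
apply: leq_trans (_ : _ <= #|setX [set f.2] (up f.1)| + #|setX (up f.1) [set f.2]|)%N _.
  apply: leq_trans (leq_card_setU _ _); apply: subset_leq_card; apply/subsetP => e.
  by rewrite !inE => /andP[_ /orP[] /andP[-> ->]]; rewrite ?orbT.
by rewrite !cardsX !cards1 mul1n muln1 leq_add ?card_up_le.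
Qed.

End Smoothing.

(** * Comparing a set with its shadow *)

Section Core.
Variables (R : realType) (p : R) (n i : nat).
Notation V := {set 'I_n}.
Variables (X S : {set V}) (kap : R).
Notation nu := (n%:R : R).
Hypotheses (SX : S \subset X :&: layer n i.+1) (Snl : forall v, v \in S -> ~~ low X kap v).
Hypotheses (kap0 : 0 < kap) (knu : 4 <= kap * nu).
Implicit Types (u v w : V) (x y z : 'I_n).

Definition shadow : {set V} := [set u in X | [exists v in S, adj u v]].
Notation T := shadow.
Definition boundary : {set V * V} :=
  [set e | [&& adj e.1 e.2, e.1 \in T, e.2 \in X & e.2 \notin S]].
Notation E := boundary.

Lemma nu_gt0 : 0 < nu.
Proof. by rewrite ltr0n lt0n; apply/eqP => n0; move: knu; rewrite n0 mulr0; lra. Qed.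

Lemma S_X v : v \in S -> v \in X.
Proof. by move/(subsetP SX); rewrite inE => /andP[]. Qed.

Lemma S_card v : v \in S -> #|v| = i.+1.
Proof. by move/(subsetP SX); rewrite !inE => /andP[_ /eqP]. Qed.

Lemma shadowI u v : v \in S -> adj u v -> u \in X -> u \in T.
Proof. by move=> vS uv uX; rewrite inE uX; apply/existsP; exists v; rewrite vS. Qed.

Lemma shadow_ex u : u \in T -> exists2 v, v \in S & adj u v.
Proof. by rewrite inE => /andP[_ /existsP[v /andP[]]]; exists v. Qed.

Lemma shadow_X u : u \in T -> u \in X.
Proof. by rewrite inE => /andP[]. Qed.

Lemma shadow_card u : u \in T -> #|u| = i.
Proof. by case/shadow_ex=> v /S_card cv /adj_card; rewrite cv => -[]. Qed.

(** Every member of [X] just below a set of [S] lies in [T], so the edges of [X] going up from [T]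
    are those ending in [S], counted from above by [dX], together with [boundary]. *)
Lemma sum_degrees : (\sum_(v in S) dX X v + #|E| = \sum_(u in T) uX X u)%N.
Proof.
have hd v : v \in S -> dX X v = (\sum_(u in T) adj u v)%N.
  move=> vS; rewrite /dX -sum1_card big_mkcond [RHS]big_mkcond; apply: eq_bigr => u _.
  rewrite !inE; case uv: (adj u v) => /=; last by rewrite if_same.
  case: (u \in X) => //=.
  by have -> : [exists v0 in S, adj u v0] by apply/existsP; exists v; rewrite vS.
have hu u : (uX X u = \sum_(v in S) adj u v + \sum_(v in X :\: S) adj u v)%N.
  rewrite /uX -sum1_card (bigID (mem S)) /=; congr (_ + _)%N.
    rewrite big_mkcond [RHS]big_mkcond; apply: eq_bigr => v _; rewrite !inE.
    by case vS: (v \in S); rewrite ?andbF // (S_X vS) !andbT; case: (adj u v).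
  rewrite big_mkcond [RHS]big_mkcond; apply: eq_bigr => v _; rewrite !inE.
  by case: (v \in S); case: (v \in X); case: (adj u v).
rewrite (eq_bigr _ hd) (eq_bigr _ (fun u _ => hu u)) big_split /= exchange_big /=.
congr (_ + _)%N; rewrite pair_big_dep /= -sum1_card big_mkcond [RHS]big_mkcond.
apply: eq_bigr => -[u v] _; rewrite !inE /=.
by case: (adj u v); case: (u \in X); case: [exists _ in _, _]; case: (v \in X); case: (v \in S).
Qed.

(** The roles cross: [Fset] is defined through [S] but approximates the shadow on level [i], and
    [Gset], defined through [T], approximates [S]. Neither is confined to [X], so isoperimetry and
    sphere averages of the full cube apply to them. *)
Definition Fset : {set V} := [set u in layer n i | kap / 2 * nu <= #|up u :&: S|%:R].
Definition Gset : {set V} := [set v in layer n i.+1 | kap / 2 * nu <= #|dn v :&: T|%:R].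

Lemma card_Fset : kap / 2 * #|Fset|%:R <= #|S|%:R.
Proof.
have nu0 := nu_gt0.
have : kap / 2 * nu * #|Fset|%:R <= nu * #|S|%:R.
  apply: (double_count (r := @adj n)) => [u|v].
    rewrite !inE => /andP[_ h]; apply: (le_trans h); rewrite ler_nat; apply: subset_leq_card.
    by apply/subsetP => v; rewrite !inE andbC.
  move=> _; rewrite ler_nat; apply: leq_trans (card_dn_le v); apply: subset_leq_card.
  by apply/subsetP => u; rewrite !inE => /andP[].
by rewrite -mulrA mulrCA ler_pM2l.
Qed.

Lemma card_Gset : kap / 2 * #|Gset|%:R <= #|T|%:R.
Proof.
have nu0 := nu_gt0.
have : kap / 2 * nu * #|Gset|%:R <= nu * #|T|%:R.
  apply: (double_count (r := fun v u => adj u v)) => [v|u].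
    rewrite inE => /andP[_ h]; apply: (le_trans h); rewrite ler_nat; apply: subset_leq_card.
    by apply/subsetP => u; rewrite in_setI !inE andbC.
  move=> _; rewrite ler_nat; apply: leq_trans (card_up_le u); apply: subset_leq_card.
  by apply/subsetP => v; rewrite !inE => /andP[].
by rewrite -mulrA mulrCA ler_pM2l.
Qed.

Notation cJ := (p ^+ 2 * kap ^+ 2 / 32).

Section Grid.
Hypothesis mix : mixing p X cJ i.

Definition grid u y (P Q : pred V) : {set 'I_n * 'I_n} :=
  [set zx | [&& zx.1 \notin y |: u, P (zx.1 |: u), zx.2 \in u, Q ((y |: u) :\ zx.2),
     (zx.1 |: u) :\ zx.2 \in X & y |: ((zx.1 |: u) :\ zx.2) \in X]].

(** Excluding the direction of the edge itself costs one choice on each side, and [knu] turns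
    [kap / 2 * nu - 1] into at least [kap / 4 * nu]. The expected number of detours is then at least
    [p ^+ 2 * (kap / 4 * nu) ^+ 2], which is [2 * cJ * nu ^+ 2]; [mixing] loses at most half of
    it. *)
Lemma card_grid u y (P Q : pred V) : #|u| = i -> y \notin u ->
    kap / 2 * nu <= #|[set w in up u | P w]|%:R ->
    kap / 2 * nu <= #|[set w in dn (y |: u) | Q w]|%:R ->
  cJ * nu ^+ 2 <= #|grid u y P Q|%:R.
Proof.
move=> ui yu hP hQ.
pose A : V := [set z | (z \notin y |: u) && P (z |: u)].
pose B : V := [set x in u | Q ((y |: u) :\ x)].
have cA : kap / 4 * nu <= #|A|%:R.
  have : (#|[set w in up u | P w]| <= #|A| + 1)%N.
    apply: leq_trans (_ : _ <= #|[set z |: u | z in A] :|: [set y |: u]|)%N _.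
      apply: subset_leq_card; apply/subsetP => w; rewrite !inE => /andP[/adj_addP[z zu ->] Pw].
      case: (z =P y) => [->|/eqP zy]; first by rewrite eqxx orbT.
      by apply/orP; left; apply/imsetP; exists z; rewrite // !inE negb_or zy zu.
    apply: leq_trans (leq_card_setU _ _) _; rewrite cards1 leq_add2r; exact: leq_imset_card.
  by rewrite -(ler_nat R) natrD; move: hP; have := knu; lra.
have cB : kap / 4 * nu <= #|B|%:R.
  have : (#|[set w in dn (y |: u) | Q w]| <= #|B| + 1)%N.
    apply: leq_trans (_ : _ <= #|[set (y |: u) :\ x | x in B] :|: [set u]|)%N _.
      apply: subset_leq_card; apply/subsetP => w; rewrite !inE => /andP[/adj_delP[x xv ->] Qw].
      case: (x =P y) => [->|/eqP xy]; first by rewrite setU1K // eqxx orbT.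
      by apply/orP; left; apply/imsetP; exists x; rewrite // !inE Qw andbT; move: xv; rewrite !inE (negPf xy).
    apply: leq_trans (leq_card_setU _ _) _; rewrite cards1 leq_add2r; exact: leq_imset_card.
  by rewrite -(ler_nat R) natrD; move: hQ; have := knu; lra.
have sA : A \subset ~: (y |: u) by apply/subsetP => z; rewrite !inE => /andP[].
have sB : B \subset u by apply/subsetP => x; rewrite !inE => /andP[].
have := mix; rewrite /mixing => /forallP/(_ u)/forallP/(_ y)/forallP/(_ A)/forallP/(_ B).
rewrite ui eqxx yu sA sB /= => h.
have AB : kap / 4 * nu * (kap / 4 * nu) <= #|A|%:R * #|B|%:R.
  by apply: ler_pM => //; rewrite mulr_ge0 // divr_ge0 // ltW.
have p2 : 0 <= p ^+ 2 by apply: sqr_ge0.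
have AB2 : p ^+ 2 * (kap / 4 * nu * (kap / 4 * nu)) <= p ^+ 2 * (#|A|%:R * #|B|%:R) by rewrite ler_wpM2l.
have sub : #|[set zx : 'I_n * 'I_n | [&& zx.1 \in A, zx.2 \in B, (zx.1 |: u) :\ zx.2 \in X
         & y |: ((zx.1 |: u) :\ zx.2) \in X]]|%:R <= (#|grid u y P Q|%:R : R).
  rewrite ler_nat; apply: subset_leq_card; apply/subsetP => -[z x]; rewrite !inE /=.
  by move=> /and4P[/andP[-> ->] /andP[-> ->] -> ->].
apply: le_trans (le_trans h sub); move: AB2; nra.
Qed.

Lemma grid_adj u y z x : y \notin u -> z \notin y |: u -> x \in u ->
  let b := (z |: u) :\ x in
  [/\ adj b (z |: u), adj b (y |: b), adj ((y |: u) :\ x) (y |: b) &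
      y |: b = z |: ((y |: u) :\ x)].
Proof.
rewrite !inE negb_or => yu /andP[zy zu] xu b.
have xz : x != z by apply: contraNneq zu => <-.
have xy : x != y by apply: contraNneq yu => <-.
have e : y |: b = z |: ((y |: u) :\ x).
  apply/setP => t; rewrite !inE; case: (t =P x) => [->|_] /=; last by rewrite orbCA.
  by rewrite (negPf xy) (negPf xz).
split=> //.
- by apply: adj_del; rewrite !inE xu orbT.
- by apply: adj_add; rewrite !inE (negPf yu) orbF (eq_sym y z) (negPf zy) andbF.
- by rewrite e; apply: adj_add; rewrite !inE (negPf zu) orbF (negPf zy) andbF.
Qed.

(* Edges of the full cube along which [Fset] and [Gset] disagree; each of them
   is charged to edges of [boundary] on its detours. *)
Definition dis1 : {set V * V} :=
  [set e | [&& adj e.1 e.2, #|e.2| == i.+1, e.1 \in Fset, e.2 \notin Gset & ~~ low X kap e.2]].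
Definition dis2 : {set V * V} :=
  [set e | [&& adj e.1 e.2, #|e.2| == i.+1, e.1 \notin Fset, e.2 \in Gset & ~~ ulow X kap e.1]].

Lemma card_pairs_le (A : finType) (P : {set A}) (f : 'I_n * 'I_n -> A) :
  (forall a, a \in P -> exists zx, a = f zx) -> (#|P| <= n ^ 2)%N.
Proof.
move=> h; have -> : (n ^ 2 = #|[set: 'I_n * 'I_n]|)%N by rewrite cardsT card_prod card_ord -mulnn.
by apply: (@leq_card_exists2 _ _ _ _ f) => a /h[zx ->]; exists zx.
Qed.

(** Take [z] with [z |: u] in [S] and [x] with [(y |: u) :\ x] in [X] but not in [T]. If the detour
    edge from [b = (z |: u) :\ x] to [y |: b] is in [X], then [b] is in [T], being below [S], and
    [y |: b] is not in [S], being above a member of [X] outside [T]: a boundary edge. It is reached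
    from at most [n ^ 2] edges, since [z] and [x] recover the start. *)
Lemma card_dis1 : cJ * #|dis1|%:R <= #|E|%:R.
Proof.
have nu0 : 0 < nu ^+ 2 by rewrite exprn_gt0 // nu_gt0.
pose f (g : V * V) (zx : 'I_n * 'I_n) := ((zx.2 |: g.1) :\ zx.1, (zx.2 |: g.2) :\ zx.1).
have : cJ * nu ^+ 2 * #|dis1|%:R <= nu ^+ 2 * #|E|%:R.
  apply: (double_count (r := fun e g => [exists zx, e == f g zx])) => [[u v]|g _]; last first.
    rewrite -natrX ler_nat; apply: (@card_pairs_le _ _ (f g)) => e.
    by rewrite inE => /andP[_ /existsP[zx /eqP ->]]; exists zx.
  rewrite inE /= => /and5P[/adj_addP[y yu ->] /eqP cv uF vG nl].
  have ui : #|u| = i by move: cv; rewrite cardsU1 yu => -[].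
  have hP : kap / 2 * nu <= #|[set w in up u | w \in S]|%:R.
    by move: uF; rewrite !inE => /andP[_ h]; apply: (le_trans h); rewrite ler_nat subset_leq_card //; apply/subsetP => w; rewrite !inE.
  have hQ : kap / 2 * nu <= #|[set w in dn (y |: u) | (w \in X) && (w \notin T)]|%:R.
    move: nl vG; rewrite /low -leNgt inE inE cv eqxx /= -ltNge => h1 h2.
    have : (dX X (y |: u) <= #|dn (y |: u) :&: T| + #|[set w in dn (y |: u) | (w \in X) && (w \notin T)]|)%N.
      rewrite -cardsUI; apply: leq_trans (leq_addr _ _); apply: subset_leq_card.
      apply/subsetP => w; rewrite in_setI => /andP[wd wX].
      by rewrite in_setU in_setI [X in _ || X]inE wd wX /=; case: (w \in T).
    by rewrite -(ler_nat R) natrD; lra.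
  apply: (le_trans (card_grid ui yu hP hQ)); rewrite ler_nat.
  pose h (zx : 'I_n * 'I_n) := ((zx.1 |: u) :\ zx.2, y |: ((zx.1 |: u) :\ zx.2)).
  have hinj : {in grid u y (fun w => w \in S) (fun w => (w \in X) && (w \notin T)) &, injective h}.
    move=> [z x] [z' x']; rewrite !inE /= => /and5P[/norP[_ zu] _ xu _ _] /and5P[/norP[_ zu'] _ xu' _ _] [e _].
    have ez : z = z'.
      have xz : z != x by apply: contraNneq zu => ->.
      have := congr1 (fun s : V => z \in s) e; rewrite !inE eqxx (negPf zu) !orbF xz /=.
      by move/esym/andP=> [_ /eqP].
    have := congr1 (fun s : V => x \in s) e; rewrite !inE eqxx xu !orbT !andbT /=.
    by rewrite ez; case: (x =P x') => [->|].
  rewrite -(card_in_imset hinj); apply: subset_leq_card; apply/subsetP => g /imsetP[[z x]].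
  rewrite [in X in X -> _]inE /= => /and5P[zv zS xu /andP[tX tT] /andP[bX aX]] ->.
  have [ab1 ab2 ab3 ab4] := grid_adj yu zv xu.
  rewrite inE; apply/andP; split.
    rewrite inE /= ab2 aX /= (shadowI zS ab1 bX) /=.
    by apply: contra tT => aS; apply: (shadowI aS ab3 tX).
  apply/existsP; exists (z, x); rewrite /f /h /=; apply/eqP.
  move: zv; rewrite !inE negb_or => /andP[zy zu].
  have e1 : u = (x |: ((z |: u) :\ x)) :\ z.
    apply/setP => t; rewrite !inE; case: (t =P x) => [->|_] /=.
      by rewrite xu andbT; apply/esym; apply: contraNneq zu => <-.
    by case: (t =P z) => [->|_] //=; rewrite (negPf zu).
  have e2 : y |: u = (x |: (y |: ((z |: u) :\ x))) :\ z.
    rewrite {1}e1; apply/setP => t; rewrite !inE; case: (t =P z) => [->|_] //=.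
      by rewrite (negPf zy).
    by rewrite orbCA.
  by rewrite -e1 -e2.
by rewrite mulrAC -[X in X <= _]mulrC ler_pM2l.
Qed.

(** Now [z |: u] is in [X] but not in [S], and [(y |: u) :\ x] is in [T]. Let [b] and [y |: b] be
    the ends of the detour edge. If [y |: b] is not in [S], the edge to it from [(y |: u) :\ x] is
    in the boundary; otherwise [b] is in [T] and the edge from [b] to [z |: u] is. One factor 2
    comes from keeping the more frequent case, the other from the two ways, [f1] and [f2], of
    reaching a given boundary edge. *)
Lemma card_dis2 : cJ * #|dis2|%:R <= 4 * #|E|%:R.
Proof.
have nu0 : 0 < nu ^+ 2 by rewrite exprn_gt0 // nu_gt0.
pose f1 (g : V * V) (xy : 'I_n * 'I_n) := ((xy.1 |: g.1) :\ xy.2, xy.1 |: g.1).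
pose f2 (g : V * V) (zy : 'I_n * 'I_n) := (g.2 :\ zy.1, zy.2 |: (g.2 :\ zy.1)).
have : cJ * nu ^+ 2 / 2 * #|dis2|%:R <= 2 * nu ^+ 2 * #|E|%:R.
  apply: (double_count (r := fun e g => [exists zx, e == f1 g zx] || [exists zx, e == f2 g zx])) => [[u v]|g _]; last first.
    rewrite -natrX -(natrM _ 2) ler_nat mul2n -addnn.
    apply: leq_trans (_ : _ <= #|[set e | [exists zx, e == f1 g zx]]| + #|[set e | [exists zx, e == f2 g zx]]|)%N _.
      apply: leq_trans (leq_card_setU _ _); apply: subset_leq_card; apply/subsetP => e.
      by rewrite !inE => /andP[].
    apply: leq_add; [apply: (@card_pairs_le _ _ (f1 g)) | apply: (@card_pairs_le _ _ (f2 g))];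
      by move=> e; rewrite inE => /existsP[zx /eqP ->]; exists zx.
  rewrite inE /= => /and5P[/adj_addP[y yu ->] /eqP cv uF vG nl].
  have ui : #|u| = i by move: cv; rewrite cardsU1 yu => -[].
  have hQ : kap / 2 * nu <= #|[set w in dn (y |: u) | w \in T]|%:R.
    move: vG; rewrite inE => /andP[_ h]; apply: (le_trans h); rewrite ler_nat; apply: subset_leq_card.
    by apply/subsetP => w; rewrite in_setI inE => /andP[-> ->].
  have hP : kap / 2 * nu <= #|[set w in up u | (w \in X) && (w \notin S)]|%:R.
    move: nl uF; rewrite /ulow -leNgt inE inE ui eqxx /= -ltNge => h1 h2.
    have : (uX X u <= #|up u :&: S| + #|[set w in up u | (w \in X) && (w \notin S)]|)%N.
      rewrite -cardsUI; apply: leq_trans (leq_addr _ _); apply: subset_leq_card.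
      apply/subsetP => w; rewrite in_setI => /andP[wd wX].
      by rewrite in_setU in_setI [X in _ || X]inE wd wX /=; case: (w \in S).
    by rewrite -(ler_nat R) natrD; lra.
  have := card_grid ui yu hP hQ; set GG := grid _ _ _ _ => hG.
  pose a (zx : 'I_n * 'I_n) := y |: ((zx.1 |: u) :\ zx.2).
  pose G1 := [set zx in GG | a zx \notin S]; pose G2 := [set zx in GG | a zx \in S].
  set Q := [set _ in E | _].
  have G12 : (#|GG| <= #|G1| + #|G2|)%N.
    apply: leq_trans (leq_card_setU _ _); apply: subset_leq_card; apply/subsetP => zx h.
    by rewrite in_setU; apply/orP; case aS: (a zx \in S); [right|left]; rewrite inE h aS.
  pose h1 (zx : 'I_n * 'I_n) := ((y |: u) :\ zx.2, a zx).
  pose h2 (zx : 'I_n * 'I_n) := ((zx.1 |: u) :\ zx.2, zx.1 |: u).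
  have memG z x : (z, x) \in GG -> [/\ z \notin y |: u, (z |: u \in X) && (z |: u \notin S), x \in u,
      (y |: u) :\ x \in T & (((z |: u) :\ x \in X) && (y |: ((z |: u) :\ x) \in X))%bool].
    by rewrite [in X in X -> _]inE /= => /and5P[-> -> -> -> ->].
  have c1 : (#|G1| <= #|Q|)%N.
    have inj1 : {in G1 &, injective h1}.
      move=> [z x] [z' x'] /setIdP[/memG[zv _ xu _ _] _] /setIdP[/memG[zv' _ xu' _ _] _] [e1 e2].
      have [_ _ _ b1] := grid_adj yu zv xu; have [_ _ _ b2] := grid_adj yu zv' xu'.
      move: e2; rewrite /a /= b1 b2 e1 => e2.
      have zn : z \notin (y |: u) :\ x' by rewrite -e1 inE negb_and zv orbT.
      have ez : z = z'.
        have := congr1 (fun s : V => z \in s) e2; rewrite in_setU1 eqxx in_setU1 (negPf zn) !orbF /=.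
        by move/esym/eqP.
      have := congr1 (fun s : V => x \in s) e1; rewrite !inE eqxx xu !orbT !andbT /=.
      by rewrite ez; case: (x =P x') => [->|].
    rewrite -(card_in_imset inj1); apply: subset_leq_card; apply/subsetP => g /imsetP[[z x]].
    move=> /setIdP[/memG[zv /andP[wX wS] xu tT /andP[bX aX]] aS] ->.
    have [ab1 ab2 ab3 ab4] := grid_adj yu zv xu.
    rewrite inE inE /= ab3 tT aX aS /=; apply/orP; left.
    apply/existsP; exists (x, y); rewrite /f1 /h1 /=; apply/eqP.
    have e : x |: ((y |: u) :\ x) = y |: u by rewrite setD1K // !inE xu orbT.
    by rewrite e setU1K.
  have c2 : (#|G2| <= #|Q|)%N.
    have inj2 : {in G2 &, injective h2}.
      move=> [z x] [z' x'] /setIdP[/memG[zv _ xu _ _] _] /setIdP[/memG[zv' _ xu' _ _] _] [e1 e2].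
      have zu : z \notin u by apply: contra zv => h; rewrite !inE h orbT.
      have ez : z = z'.
        have := congr1 (fun s : V => z \in s) e2; rewrite !inE eqxx (negPf zu) !orbF /=.
        by move/esym/eqP.
      have := congr1 (fun s : V => x \in s) e1; rewrite !inE eqxx xu !orbT !andbT /=.
      by rewrite ez; case: (x =P x') => [->|].
    rewrite -(card_in_imset inj2); apply: subset_leq_card; apply/subsetP => g /imsetP[[z x]].
    move=> /setIdP[/memG[zv /andP[wX wS] xu tT /andP[bX aX]] aS] ->.
    have [ab1 ab2 ab3 ab4] := grid_adj yu zv xu.
    rewrite inE inE /= ab1 (shadowI aS ab2 bX) wX wS /=; apply/orP; right.
    apply/existsP; exists (z, y); rewrite /f2 /h2 /=; apply/eqP.
    by rewrite setU1K //; apply: contra zv => h; rewrite !inE h orbT.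
  have : (#|GG| <= 2 * #|Q|)%N by rewrite mul2n -addnn; apply: leq_trans G12 (leq_add c1 c2).
  by rewrite -(ler_nat R) natrM; lra.
set N2 := nu ^+ 2 in nu0 *; set c := cJ; nra.
Qed.

End Grid.

End Core.

(** * Edges and centres near vertices of low degree *)

Section Leftovers.
Variables (R : realType) (p : R) (n i : nat).
Notation V := {set 'I_n}.
Variables (X S : {set V}) (kap : R) (M : nat).
Notation nu := (n%:R : R).
Hypotheses (SX : S \subset X :&: layer n i.+1) (Snl : forall v, v \in S -> ~~ low X kap v).
Hypotheses (kap0 : 0 < kap) (knu : 4 <= kap * nu).
Hypotheses (spL : sparse (low X kap) i.+1 M) (spU : sparse (ulow X kap) i M).
Hypotheses (hup : nu / 8 + M%:R <= (n - i)%:R) (hdn : nu / 8 + M%:R <= i.+1%:R).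
Notation T := (shadow X S).
Notation E := (boundary X S).
Notation F := (Fset i S kap).
Notation G := (Gset i X S kap).

Lemma sparse_le (P : pred V) k (A : {set V}) (z : V) : sparse P k M ->
  (forall v, v \in A -> [/\ P v, #|v| = k & (dist v z <= 8)%N]) -> (#|A| <= M)%N.
Proof.
move=> /forallP/(_ z) h hA; apply: leq_trans h; apply: subset_leq_card.
by apply/subsetP => v /hA[Pv cv dv]; rewrite !inE dv cv eqxx.
Qed.

Definition left1 : {set V * V} :=
  [set e | [&& adj e.1 e.2, #|e.2| == i.+1, e.1 \in F & low X kap e.2]].
Definition left2 : {set V * V} :=
  [set e | [&& adj e.1 e.2, #|e.2| == i.+1, e.2 \in G & ulow X kap e.1]].

(** The lower end [u] of such an edge has at least [nu / 8] upper neighbours that are not low, as at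
    most [M] are low. Each of them is in [G] or forms an edge of [dis1] with [u]. Conversely a
    vertex of [G] receives at most [M] charges: the low end lies within distance 2 of it and
    determines the edge, because two sets of one level have at most one common lower neighbour. *)
Lemma card_left1 : nu / 8 * #|left1|%:R <= M%:R * (#|G|%:R + #|dis1 i X S kap|%:R).
Proof.
pose Q : {set V + (V * V)} := [set o | match o with inl v => v \in G | inr f => f \in dis1 i X S kap end].
pose r (e : V * V) (o : V + (V * V)) := match o with inl v => adj e.1 v && ~~ low X kap v | inr f => f.1 == e.1 end.
have cQ : (#|Q| <= #|G| + #|dis1 i X S kap|)%N.
  rewrite -[#|G|](card_imset _ (@inl_inj V (V * V)%type)) -[#|dis1 _ _ _ _|](card_imset _ (@inr_inj V (V * V)%type)).
  apply: leq_trans (leq_card_setU _ _); apply: subset_leq_card; apply/subsetP => -[v|f]; rewrite inE in_setU => h.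
    by rewrite imset_f.
  by rewrite orbC imset_f.
apply: (@le_trans _ _ (M%:R * #|Q|%:R)); last by rewrite ler_wpM2l // -natrD ler_nat.
apply: (double_count (r := r)) => [[u v]|[v|f] _]; last 1 first.
- rewrite ler_nat.
  have inj : {in [set e in left1 | r e (inr f)] &, injective (fun e : V * V => e.2)}.
    move=> [a b] [a' b'] /setIdP[_ /eqP e1] /setIdP[_ /eqP e2] /= e3.
    by rewrite /= in e1 e2; rewrite -e1 -e2 e3.
  rewrite -(card_in_imset inj); apply: (sparse_le (z := f.1) spL) => w /imsetP[[a b]].
  rewrite inE => /andP[]; rewrite inE /= => /and4P[ab /eqP cb _ lb] /eqP ea ->; split=> //.
  by rewrite ea distC (dist_adj ab).
- rewrite /= inE => /and4P[uv /eqP cv uF lv].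
  have ui : #|u| = i by have := adj_card uv; rewrite cv => -[].
  pose D := up u :\: [set w | low X kap w].
  have cD : nu / 8 <= #|D|%:R.
    have c1 : (#|up u :&: [set w | low X kap w]| <= M)%N.
      apply: (sparse_le (z := u) spL) => w; rewrite !inE => /andP[uw lw].
      by rewrite lw (adj_card uw) ui distC (dist_adj uw).
    have : (n - i <= #|D| + M)%N.
      by rewrite -{1}ui -card_up -(cardsID [set w | low X kap w] (up u)) addnC leq_add2l.
    by rewrite -(ler_nat R) natrD; have := hup; lra.
  apply: (le_trans cD); rewrite ler_nat.
  pose g w : V + (V * V) := if w \in G then inl w else inr (u, w).
  have ginj : {in D &, injective g}.
    by move=> w w' _ _; rewrite /g; case: ifP => _; case: ifP => _ // [].
  rewrite -(card_in_imset ginj); apply: subset_leq_card; apply/subsetP => o /imsetP[w wD ->].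
  move: wD; rewrite !in_setD inE in_set => /andP[lw uw]; rewrite inE /g.
  case: ifP => wG; rewrite inE /= ?wG ?uw ?lw //= eqxx andbT inE /= uw uF wG lw !andbT.
  by rewrite (adj_card uw) ui eqxx.
- rewrite ler_nat.
  have inj : {in [set e in left1 | r e (inl v)] &, injective (fun e : V * V => e.2)}.
    move=> [a b] [a' b'] /setIdP[h1 /andP[/= av nlv]] /setIdP[h2 /andP[/= av' _]] /= e3.
    move: h1 h2; rewrite !inE /= => /and4P[ab _ _ lb] /and4P[ab' _ _ lb'].
    have nv : b != v by apply: contraTneq lb => ->.
    by rewrite (adj_meet ab av nv) (adj_meet ab' av' _) -e3.
  rewrite -(card_in_imset inj); apply: (sparse_le (z := v) spL) => w /imsetP[[a b]].
  rewrite inE => /andP[]; rewrite inE /= => /and4P[ab /eqP cb _ lb] /andP[av _] ->; split=> //.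
  apply: leq_trans (dist_tri a _ _) _; rewrite (distC b) (dist_adj ab) (dist_adj av) //.
Qed.

Lemma card_left2 : nu / 8 * #|left2|%:R <= M%:R * (#|F|%:R + #|dis2 i X S kap|%:R).
Proof.
pose Q : {set V + (V * V)} := [set o | match o with inl v => v \in F | inr f => f \in dis2 i X S kap end].
pose r (e : V * V) (o : V + (V * V)) := match o with inl u => adj u e.2 && ~~ ulow X kap u | inr f => f.2 == e.2 end.
have cQ : (#|Q| <= #|F| + #|dis2 i X S kap|)%N.
  rewrite -[#|F|](card_imset _ (@inl_inj V (V * V)%type)) -[#|dis2 _ _ _ _|](card_imset _ (@inr_inj V (V * V)%type)).
  apply: leq_trans (leq_card_setU _ _); apply: subset_leq_card; apply/subsetP => -[v|f]; rewrite inE in_setU => h.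
    by rewrite imset_f.
  by rewrite orbC imset_f.
apply: (@le_trans _ _ (M%:R * #|Q|%:R)); last by rewrite ler_wpM2l // -natrD ler_nat.
apply: (double_count (r := r)) => [[u v]|[v|f] _]; last 1 first.
- rewrite ler_nat.
  have inj : {in [set e in left2 | r e (inr f)] &, injective (fun e : V * V => e.1)}.
    move=> [a b] [a' b'] /setIdP[_ /eqP e1] /setIdP[_ /eqP e2] /= e3.
    by rewrite /= in e1 e2; rewrite -e1 -e2 e3.
  rewrite -(card_in_imset inj); apply: (sparse_le (z := f.2) spU) => w /imsetP[[a b]].
  rewrite inE => /andP[]; rewrite inE /= => /and4P[ab /eqP cb _ lb] /eqP ea ->; split=> //.
    by have := adj_card ab; rewrite cb => -[].
  by rewrite ea (dist_adj ab).
- rewrite /= inE => /and4P[uv /eqP cv vG lu].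
  pose D := dn v :\: [set w | ulow X kap w].
  have cD : nu / 8 <= #|D|%:R.
    have c1 : (#|dn v :&: [set w | ulow X kap w]| <= M)%N.
      apply: (sparse_le (z := v) spU) => w; rewrite !inE => /andP[uw lw].
      by rewrite lw (dist_adj uw); have := adj_card uw; rewrite cv => -[].
    have : (i.+1 <= #|D| + M)%N.
      by rewrite -{1}cv -card_dn -(cardsID [set w | ulow X kap w] (dn v)) addnC leq_add2l.
    by rewrite -(ler_nat R) natrD; have := hdn; lra.
  apply: (le_trans cD); rewrite ler_nat.
  pose g w : V + (V * V) := if w \in F then inl w else inr (w, v).
  have ginj : {in D &, injective g}.
    by move=> w w' _ _; rewrite /g; case: ifP => _; case: ifP => _ // [].
  rewrite -(card_in_imset ginj); apply: subset_leq_card; apply/subsetP => o /imsetP[w wD ->].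
  move: wD; rewrite !in_setD inE in_set => /andP[lw uw]; rewrite inE /g.
  by case: ifP => wF; rewrite inE /= ?wF ?uw ?lw //= eqxx andbT inE /= uw vG wF lw !andbT cv eqxx.
- rewrite ler_nat.
  have inj : {in [set e in left2 | r e (inl v)] &, injective (fun e : V * V => e.1)}.
    move=> [a b] [a' b'] /setIdP[h1 /andP[/= av nlv]] /setIdP[h2 /andP[/= av' _]] /= e3.
    move: h1 h2; rewrite !inE /= => /and4P[ab _ _ lb] /and4P[ab' _ _ lb'].
    have nv : a != v by apply: contraTneq lb => ->.
    by rewrite (adj_join ab av nv) (adj_join ab' av' _) -e3.
  rewrite -(card_in_imset inj); apply: (sparse_le (z := v) spU) => w /imsetP[[a b]].
  rewrite inE => /andP[]; rewrite inE /= => /and4P[ab /eqP cb _ lb] /andP[av _] ->; split=> //.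
    by have := adj_card ab; rewrite cb => -[].
  by apply: leq_trans (dist_tri b _ _) _; rewrite (dist_adj ab) distC (dist_adj av).
Qed.

Definition lattice_cut : {set V * V} :=
  [set e | [&& adj e.1 e.2, #|e.2| == i.+1 & (e.1 \in F) != (e.2 \in G)]].

Lemma card_lattice_cut :
  (#|lattice_cut| <= #|dis1 i X S kap| + #|dis2 i X S kap| + #|left1| + #|left2|)%N.
Proof.
set A := dis1 _ _ _ _; set B := dis2 _ _ _ _.
apply: leq_trans (_ : _ <= #|A :|: B :|: left1 :|: left2|)%N _; last first.
  apply: leq_trans (leq_card_setU _ _) _; rewrite leq_add2r.
  by apply: leq_trans (leq_card_setU _ _) _; rewrite leq_add2r leq_card_setU.
apply: subset_leq_card; apply/subsetP => -[u v]; rewrite inE /= => /and3P[uv cv].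
have a1 : ((u, v) \in A) = [&& u \in F, v \notin G & ~~ low X kap v] by rewrite inE /= uv cv.
have a2 : ((u, v) \in B) = [&& u \notin F, v \in G & ~~ ulow X kap u] by rewrite inE /= uv cv.
have a3 : ((u, v) \in left1) = (u \in F) && low X kap v by rewrite inE /= uv cv.
have a4 : ((u, v) \in left2) = (v \in G) && ulow X kap u by rewrite inE /= uv cv.
rewrite !in_setU a1 a2 a3 a4.
by case: (u \in F); case: (v \in G); case: (low X kap v); case: (ulow X kap u).
Qed.

(** Walk from [v] in [S] down to a member [u] of [T] of linear upper degree, then up to another
    member of [X]. The walk ends either in [S] or along a boundary edge, and different walks from
    [v] have different ends. With at least [kap ^+ 2 / 4 * nu ^+ 2] walks per centre, sets near [S]
    are smaller than [|E| + |S|] by a factor of order [n ^ 2]. *)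
Lemma card_near_centers (Z : {set V}) (M2 : nat) :
    (forall z, z \in Z -> exists2 v, v \in S & (dist z v <= 4)%N) ->
    (forall w, #|[set z in Z | (dist z w <= 8)%N]| <= M2)%N -> M%:R <= kap / 2 * nu ->
  kap ^+ 2 / 4 * nu ^+ 2 * #|Z|%:R <= M2%:R * (#|E|%:R + #|S|%:R).
Proof.
move=> hZ hM2 hM.
pose Q : {set (V * V) + V} := [set o | match o with inl f => f \in E | inr v => v \in S end].
pose r (z : V) (o : (V * V) + V) := match o with inl f => (dist z f.1 <= 8)%N | inr v => (dist z v <= 8)%N end.
have cQ : (#|Q| <= #|E| + #|S|)%N.
  rewrite -[#|E|](card_imset _ (@inl_inj (V * V)%type V)) -[#|S|](card_imset _ (@inr_inj (V * V)%type V)).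
  apply: leq_trans (leq_card_setU _ _); apply: subset_leq_card; apply/subsetP => -[f|v]; rewrite inE in_setU => h.
    by rewrite imset_f.
  by rewrite orbC imset_f.
apply: (@le_trans _ _ (M2%:R * #|Q|%:R)); last by rewrite ler_wpM2l // -natrD ler_nat.
apply: (double_count (r := r)) => [z zZ|[f|v] _]; last 2 first.
- by rewrite ler_nat; apply: hM2.
- by rewrite ler_nat; apply: hM2.
have [v vS dv] := hZ z zZ; have cv := S_card SX vS.
pose D := (dn v :&: X) :\: [set u | ulow X kap u].
have cD : kap / 2 * nu <= #|D|%:R.
  have c1 : (#|(dn v :&: X) :&: [set u | ulow X kap u]| <= M)%N.
    apply: (sparse_le (z := v) spU) => u; rewrite !inE => /andP[/andP[uv _] lu].
    by rewrite lu (dist_adj uv); have := adj_card uv; rewrite cv => -[].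
  have : (dX X v <= #|D| + M)%N.
    by rewrite /dX -(cardsID [set u | ulow X kap u] (dn v :&: X)) addnC leq_add2l.
  by have := Snl vS; rewrite /low -leNgt -(ler_nat R) natrD; move: hM; lra.
pose W := [set f : V * V | [&& f.1 \in D, adj f.1 f.2, f.2 \in X & f.2 != v]].
have cW : (kap * nu - 1) * #|D|%:R <= #|W|%:R.
  rewrite -[leRHS]mul1r; apply: (double_count (r := fun u f => f.1 == u)) => [u uD|f _]; last first.
    rewrite (ler_nat _ _ 1) -(cards1 f.1); apply: subset_leq_card; apply/subsetP => u.
    by rewrite !inE => /andP[_ /eqP ->].
  have nl : kap * nu <= (uX X u)%:R by move: (uD); rewrite in_setD inE -leNgt => /andP[].
  have : (uX X u <= #|[set f in W | f.1 == u]| + 1)%N.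
    rewrite /uX; apply: leq_trans (_ : _ <= #|[set f.2 | f in [set f in W | f.1 == u]] :|: [set v]|)%N _.
      apply: subset_leq_card; apply/subsetP => w; rewrite !inE => /andP[uw wX].
      case: (w =P v) => [->|/eqP wv]; first by rewrite orbT.
      rewrite orbF; apply/imsetP; exists (u, w) => //; rewrite inE inE /= uD uw wX wv eqxx //.
    by apply: leq_trans (leq_card_setU _ _) _; rewrite cards1 leq_add2r leq_imset_card.
  by rewrite -(ler_nat R) natrD; move: nl; lra.
apply: (@le_trans _ _ #|W|%:R).
  apply: le_trans cW; have k1 : kap / 2 * nu <= kap * nu - 1 by have := knu; lra.
  have : kap / 2 * nu * (kap / 2 * nu) <= (kap * nu - 1) * #|D|%:R.
    by apply: ler_pM => //; rewrite mulr_ge0 // divr_ge0 // ltW.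
  apply: le_trans; rewrite le_eqVlt; apply/orP; left; apply/eqP; by field.
rewrite ler_nat.
pose g (f : V * V) : (V * V) + V := if f.2 \in S then inr f.2 else inl f.
have WP f : f \in W -> [/\ adj f.1 v, f.1 \in X, adj f.1 f.2, f.2 \in X & f.2 != v].
  rewrite inE => /and4P[]; rewrite in_setD in_setI => /and3P[_ fd ->] -> -> ->; split=> //.
  by move: fd; rewrite inE.
have ginj : {in W &, injective g}.
  move=> f f' /WP[a1 _ a2 _ nv] /WP[a1' _ a2' _ nv']; rewrite /g.
  case: ifP => _; case: ifP => _ // -[]// e.
  rewrite [f]surjective_pairing [f']surjective_pairing e; congr pair.
  by rewrite (adj_meet a1 a2) ?(adj_meet a1' a2') 1?eq_sym // e.
rewrite -(card_in_imset ginj); apply: subset_leq_card; apply/subsetP => o /imsetP[f /WP[a1 fX a2 f2X nv] ->].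
have dz1 : (dist z f.1 <= 5)%N by apply: leq_trans (dist_tri v _ _) _; rewrite (distC v) (dist_adj a1) addn1 ltnS.
have dz2 : (dist z f.2 <= 6)%N by apply: leq_trans (dist_tri f.1 _ _) _; rewrite (dist_adj a2) addn1 ltnS.
rewrite inE /g; case: ifP => fS; rewrite inE /= ?fS.
  by apply: leq_trans dz2 _.
rewrite inE a2 (shadowI vS a1 fX) f2X fS /=; exact: leq_trans dz1 _.
Qed.

(** A single step down gains only a factor of order [n], which suffices where the shadow is at least
    twice as large. *)
Lemma card_near_centers_far (Z : {set V}) (M2 : nat) :
    (forall z, z \in Z -> exists2 v, v \in S & (dist z v <= 4)%N) ->
    (forall w, #|[set z in Z | (dist z w <= 8)%N]| <= M2)%N ->
  kap * nu * #|Z|%:R <= M2%:R * #|T|%:R.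
Proof.
move=> hZ hM2; apply: (double_count (r := fun z u => (dist z u <= 8)%N)) => [z zZ|u _]; last first.
  by rewrite ler_nat; apply: hM2.
have [v vS dv] := hZ z zZ; have := Snl vS; rewrite /low -leNgt => h; apply: (le_trans h).
rewrite ler_nat; apply: subset_leq_card; apply/subsetP => u; rewrite in_setI inE => /andP[uv uX].
rewrite inE (shadowI vS uv uX) /=.
apply: leq_trans (dist_tri v _ _) _; rewrite (distC v) (dist_adj uv) addn1 ltnS.
exact: leq_trans dv _.
Qed.

End Leftovers.

Lemma bin2_ge m : (4 <= m)%N -> (m ^ 2 <= 4 * 'C(m, 2))%N.
Proof.
move=> m4; have := bin_ffact m 2; rewrite ffactnS ffactn1 (_ : 2`! = 2%N) // -mulnn.
move: m4; set c := 'C(m, 2); nia.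
Qed.

Lemma sph2_size_ge (R : realType) n k : (16 <= n)%N -> (n <= 4 * k)%N -> (n <= 4 * (n - k))%N ->
  n%:R ^+ 4 <= 64 * 64 * (sph2_size n k)%:R :> R.
Proof.
move=> n16 h1 h2; rewrite -natrX -!natrM ler_nat /sph2_size.
have k4 : (4 <= k)%N by lia.
have k4' : (4 <= n - k)%N by lia.
have := bin2_ge k4; have := bin2_ge k4'; move: h1 h2; clear; move: (n - k)%N => m.
move: 'C(k, 2) 'C(m, 2) => a b h1 h2 hb ha.
have e1 : (n ^ 2 <= 64 * a)%N.
  apply: leq_trans (_ : (4 * k) ^ 2 <= _)%N; first by rewrite leq_exp2r.
  by rewrite expnMn (_ : 4 ^ 2 = 16)%N // (_ : 64 = 16 * 4)%N // -mulnA leq_mul2l.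
have e2 : (n ^ 2 <= 64 * b)%N.
  apply: leq_trans (_ : (4 * m) ^ 2 <= _)%N; first by rewrite leq_exp2r.
  by rewrite expnMn (_ : 4 ^ 2 = 16)%N // (_ : 64 = 16 * 4)%N // -mulnA leq_mul2l.
have := leq_mul e1 e2; rewrite -expnD => /leq_trans; apply.
by rewrite mulnACA.
Qed.

(** * The expansion inequality *)

Section MainInequality.
Variables (R : realType) (p : R) (n i : nat).
Notation V := {set 'I_n}.
Variables (X S : {set V}) (kap eps eta : R) (M : nat).
Notation nu := (n%:R : R).
Notation cJ := (p ^+ 2 * kap ^+ 2 / 32).
Hypotheses (SX : S \subset X :&: layer n i.+1) (Snl : forall v, v \in S -> ~~ low X kap v).
Hypotheses (p0 : 0 < p) (p1 : p <= 1) (kap0 : 0 < kap) (eps0 : 0 < eps) (eta0 : 0 < eta).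
Hypotheses (hke : kap + eps <= p / 4) (knu : 4 <= kap * nu).
Hypotheses (dim1 : (n <= 4 * i)%N) (dim2 : (n <= 4 * (n - i.+1))%N) (n16 : (16 <= n)%N).
Hypotheses (spB : sparse (badd p X eps) i.+1 M) (spBu : sparse (badu p X eps) i M).
Hypotheses (mix : mixing p X cJ i).
Hypotheses (qup : quiet_up p X eta i) (qdn : quiet_dn p X eta i.+1).
Notation T := (shadow X S).
Notation E := (boundary X S).
Notation F := (Fset i S kap).
Notation G := (Gset i X S kap).
Notation El := (lattice_cut i X S kap).
Implicit Types (u v w : V).

Lemma sparse_sub (P Q : pred V) k : (forall v, #|v| = k -> P v -> Q v) ->
  sparse Q k M -> sparse P k M.
Proof.
move=> PQ /forallP h; apply/forallP => z; apply: leq_trans (h z); apply: subset_leq_card.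
by apply/subsetP => v; rewrite !inE => /and3P[-> /eqP cv Pv]; rewrite cv eqxx PQ.
Qed.

Lemma dims_real : nu <= 4 * i%:R /\ nu <= 4 * (n%:R - i%:R - 1).
Proof.
split; first by rewrite -natrM ler_nat.
have il : (i.+1 <= n)%N by clear -dim2 n16; lia.
have : nu <= 4 * (n - i.+1)%:R by rewrite -natrM ler_nat.
by rewrite natrB // -[i.+1%:R]natr1; lra.
Qed.

Lemma subn_real : (n - i)%:R = n%:R - i%:R :> R.
Proof. by rewrite natrB //; clear -dim2 n16; lia. Qed.

Lemma nonbad_up u : #|u| = i -> ~~ badu p X eps u -> kap * nu <= (uX X u)%:R.
Proof.
move=> ui; rewrite /badu -leNgt ui subn_real ler_distl => /andP[h _].
have [_ d2] := dims_real; have := ler_wpM2l (ltW p0) d2.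
have n0 : 0 <= nu by [].
have := ler_wpM2r n0 hke; have := p0; lra.
Qed.

Lemma nonbad_dn v : #|v| = i.+1 -> ~~ badd p X eps v -> kap * nu <= (dX X v)%:R.
Proof.
move=> vi; rewrite /badd -leNgt vi ler_distl -[i.+1%:R]natr1 => /andP[h _].
have [d1 _] := dims_real; have := ler_wpM2l (ltW p0) d1.
have n0 : 0 <= nu by [].
have := ler_wpM2r n0 hke; have := p0; lra.
Qed.

Lemma sparse_low : sparse (low X kap) i.+1 M.
Proof.
apply: sparse_sub spB => v cv; rewrite /low; apply: contraTT => /(nonbad_dn cv).
by rewrite -leNgt.
Qed.

Lemma sparse_ulow : sparse (ulow X kap) i M.
Proof.
apply: sparse_sub spBu => v cv; rewrite /ulow; apply: contraTT => /(nonbad_up cv).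
by rewrite -leNgt.
Qed.

Hypotheses (hD : (64 * 64) * M%:R <= eta * nu ^+ 3).

(** A cut at two swaps costs at most [4 * nu ^+ 3] per edge of [El], each with error [eps * nu], and
    a sphere has at least [nu ^+ 4 / (64 * 64)] vertices; [4 * (64 * 64)] is [128 * 128]. The second
    [eta] pays for the at most [M] bad vertices on each sphere. *)
Lemma smooth_bound k (H : {set V}) (h : V -> R) :
    (n <= 4 * k)%N -> (n <= 4 * (n - k))%N -> H \subset layer n k ->
    (#|cut_pairs 1 H| <= 2 * n * #|El|)%N ->
    (forall u, #|u| = k -> `|h u| <= eps * nu) ->
    (forall w, #|w| = k -> `|\sum_(u | sph 2 w u) h u| <= eta * (sph2_size n k)%:R + nu * M%:R) ->
  `|\sum_(u in H) h u| <= 2 * eta * #|H|%:R + (128 * 128) * eps * #|El|%:R.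
Proof.
move=> d1 d2 HL hc hh hs; have := smoothing HL hh hs.
have N2 := sph2_size_ge R n16 d1 d2; move: N2; set N := (sph2_size n k)%:R => N2.
have n0 : 0 < nu by rewrite ltr0n; apply: leq_trans n16.
have n4 : 0 < nu ^+ 4 by rewrite exprn_gt0.
have N0 : 0 < N by lra.
have c2 : (#|cut_pairs 2 H|%:R : R) <= 4 * nu ^+ 3 * #|El|%:R.
  have : (#|cut_pairs 2 H| <= 2 * n ^ 2 * (2 * n * #|El|))%N.
    by apply: leq_trans (cut2_cut1 R H) _; rewrite leq_mul2l hc orbT.
  rewrite -(ler_nat R) !natrM => /le_trans; apply; rewrite le_eqVlt; apply/orP; left; apply/eqP; ring.
have nM : nu * M%:R <= eta * N.
  have : nu * ((64 * 64) * M%:R) <= nu * (eta * nu ^+ 3) by rewrite ler_pM2l.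
  have : eta * nu ^+ 4 <= eta * ((64 * 64) * N) by rewrite ler_pM2l.
  rewrite (exprS nu 3); set a := nu ^+ 3; lra.
move=> h1; rewrite -(ler_pM2l N0); apply: (le_trans h1).
have H0 : 0 <= (#|H|%:R : R) by [].
have e1 := ler_wpM2r H0 nM.
have en0 : 0 <= eps * nu by rewrite mulr_ge0 // ltW.
have e2 := ler_wpM2l en0 c2.
have e3 : eps * nu ^+ 4 * #|El|%:R <= eps * ((64 * 64) * N) * #|El|%:R.
  by rewrite ler_wpM2r // ler_pM2l.
have e4 : eps * nu * (4 * nu ^+ 3 * #|El|%:R) = 4 * (eps * nu ^+ 4 * #|El|%:R) by rewrite (exprS nu 3); ring.
rewrite e4 in e2; set a := #|H|%:R in e1 *; set b := #|El|%:R in e2 e3 *; set c := #|cut_pairs 2 H|%:R in e2 *.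
have -> : N * (2 * eta * a + (128 * 128) * eps * b) = 2 * (eta * N * a) + 4 * (eps * ((64 * 64) * N) * b) by ring.
have -> : (eta * N + nu * M%:R) * a = eta * N * a + nu * M%:R * a by ring.
lra.
Qed.

Let al u : R := p * (n - i)%:R - (uX X u)%:R.
Let be v : R := p * i.+1%:R - (dX X v)%:R.

Lemma F_layer : F \subset layer n i.
Proof. by apply/subsetP => u; rewrite inE => /andP[]. Qed.

Lemma G_layer : G \subset layer n i.+1.
Proof. by apply/subsetP => u; rewrite inE => /andP[]. Qed.

Lemma S_sub_G : S \subset G.
Proof.
apply/subsetP => v vS; rewrite inE inE (S_card SX vS) eqxx /=.
have := Snl vS; rewrite /low -leNgt => h.
have : (dX X v <= #|dn v :&: T|)%N.
  apply: subset_leq_card; apply/subsetP => u; rewrite !in_setI => /andP[uv uX]; rewrite uv /=.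
  by apply: shadowI vS _ uX; move: uv; rewrite inE.
by rewrite -(ler_nat R); have := knu; have := kap0; lra.
Qed.

(** A vertex of [G :&: X] outside [S] has [kap / 2 * nu] neighbours in [T], and all these edges are
    in the boundary. *)
Lemma G_minus_S : kap / 2 * nu * #|(G :&: X) :\: S|%:R <= #|E|%:R.
Proof.
rewrite -[leRHS]mul1r; apply: (double_count (r := fun v f => f.2 == v)) => [v|f _]; last first.
  rewrite (ler_nat _ _ 1) -(cards1 f.2); apply: subset_leq_card; apply/subsetP => v.
  by rewrite !inE => /andP[_ /eqP ->].
rewrite in_setD in_setI => /and3P[vS vG vX].
move: vG; rewrite inE => /andP[_ h]; apply: (le_trans h); rewrite ler_nat.
have inj : {in dn v :&: T &, injective (fun u => (u, v))} by move=> a b _ _ [].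
rewrite -(card_in_imset inj); apply: subset_leq_card; apply/subsetP => f /imsetP[u].
rewrite in_setI in_dn => /andP[uv uT] ->.
by rewrite inE inE /= uv uT vX vS eqxx.
Qed.

(** A vertex of [T] that is not bad has at least [kap * nu] upper neighbours in [X]; outside [F]
    fewer than half that number are in [S], and the others give boundary edges. *)
Lemma T_minus_F : kap / 2 * nu * #|[set u in T | ~~ badu p X eps u && (u \notin F)]|%:R <= #|E|%:R.
Proof.
rewrite -[leRHS]mul1r; apply: (double_count (r := fun u f => f.1 == u)) => [u|f _]; last first.
  rewrite (ler_nat _ _ 1) -(cards1 f.1); apply: subset_leq_card; apply/subsetP => v.
  by rewrite inE => /andP[_ /eqP ->]; rewrite set11.
rewrite inE => /and3P[uT nb uF]; have ui := shadow_card SX uT.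
have h1 := nonbad_up ui nb.
move: uF; rewrite inE inE ui eqxx /= -ltNge => h2.
have inj : {in [set v in up u | (v \in X) && (v \notin S)] &, injective (fun v => (u, v))} by move=> a b _ _ [].
have : (uX X u <= #|up u :&: S| + #|[set v in up u | (v \in X) && (v \notin S)]|)%N.
  rewrite -cardsUI; apply: leq_trans (leq_addr _ _); apply: subset_leq_card.
  apply/subsetP => w; rewrite in_setI => /andP[wd wX].
  by rewrite in_setU in_setI [X in _ || X]inE wd wX /=; case: (w \in S).
rewrite -(card_in_imset inj) -(ler_nat R) natrD => h3.
apply: (@le_trans _ _ #|[set (u, v) | v in [set v in up u | (v \in X) && (v \notin S)]]|%:R); first by lra.
rewrite ler_nat; apply: subset_leq_card; apply/subsetP => f /imsetP[v].
rewrite inE => /and3P[uv vX vS] ->.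
by rewrite inE inE /= uT vX vS eqxx !andbT; move: uv; rewrite inE.
Qed.

(** [h] is [g] on [X] with the bad vertices erased. A sphere of two swaps lies in a ball of radius
    4, so at most [M] terms are erased, each of size at most [nu]. *)
Lemma sum_quiet (b : pred V) (g h : V -> R) k c w :
    (forall u, #|u| = k -> h u = (if (u \in X) && ~~ b u then g u else 0)) ->
    (forall u, `|g u| <= nu) -> sparse b k M -> #|w| = k ->
    `|\sum_(u in X | sph 2 w u) g u| <= c ->
  `|\sum_(u | sph 2 w u) h u| <= c + nu * M%:R.
Proof.
move=> hh hg spb wk hc.
have sk u : sph 2 w u -> #|u| = k by case/andP=> /eqP <-.
have -> : \sum_(u | sph 2 w u) h u = \sum_(u in X | sph 2 w u) g u - \sum_(u | [&& u \in X, sph 2 w u & b u]) g u.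
  rewrite (eq_bigr (fun u => if (u \in X) && ~~ b u then g u else 0)); last by move=> u /sk; apply: hh.
  rewrite -big_mkcondr /= [in RHS](bigID b) /=.
  rewrite [X in _ = X + _ - _](eq_bigl (fun u => [&& u \in X, sph 2 w u & b u])); last by move=> u; rewrite andbA.
  rewrite addrAC subrr add0r; apply: eq_bigl => u.
  by case: (sph 2 w u); case: (u \in X); case: (b u).
apply: le_trans (ler_normB _ _) _; apply: lerD => //.
apply: le_trans (ler_norm_sum _ _ _) _.
apply: (@le_trans _ _ (\sum_(u | [&& u \in X, sph 2 w u & b u]) nu)).
  by apply: ler_sum => u _; apply: hg.
rewrite sumr_const -[leLHS]mulr_natr ler_wpM2l // ler_nat.
rewrite -cardsE; apply: (sparse_le (z := w) spb) => u; rewrite inE => /and3P[_ s bu].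
by rewrite bu (sk _ s) distC (dist_sph s).
Qed.

Lemma uX_le u : (uX X u)%:R <= nu.
Proof. by rewrite ler_nat; apply: leq_trans (card_up_le u); rewrite subset_leq_card ?subsetIl. Qed.

Lemma dX_le v : (dX X v)%:R <= nu.
Proof. by rewrite ler_nat; apply: leq_trans (card_dn_le v); rewrite subset_leq_card ?subsetIl. Qed.

Lemma p_nat_le m : (m <= n)%N -> 0 <= p * m%:R <= nu.
Proof.
move=> mn; have m0 : 0 <= (m%:R : R) by [].
have mnu : (m%:R : R) <= nu by rewrite ler_nat.
by rewrite (mulr_ge0 (ltW p0) m0) (le_trans (ler_piMl m0 p1) mnu).
Qed.

Lemma al_le u : `|al u| <= nu.
Proof.
have /andP[a b] := p_nat_le (leq_subr i n); have := uX_le u.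
by have : 0 <= ((uX X u)%:R : R) by []; rewrite /al ler_norml; lra.
Qed.

Lemma be_le v : `|be v| <= nu.
Proof.
have il : (i.+1 <= n)%N by clear -dim2 n16; lia.
have /andP[a b] := p_nat_le il; have := dX_le v.
by have : 0 <= ((dX X v)%:R : R) by []; rewrite /be ler_norml; lra.
Qed.

(** [T] splits into bad vertices, with the trivial error [nu] each; other vertices outside [F], few
    by [T_minus_F]; and those in [F], where the smoothed estimate applies because a member of
    [F :&: X] has a neighbour in [S] and so belongs to [T]. *)
Lemma sum_al : - (2 * eps / kap * #|E|%:R + 2 * eta * #|F|%:R + (128 * 128) * eps * #|El|%:R
    + nu * #|[set u in T | badu p X eps u]|%:R) <= \sum_(u in T) al u.
Proof.
pose h u := if (u \in X) && ~~ badu p X eps u then al u else 0.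
have nb_al u : #|u| = i -> ~~ badu p X eps u -> `|al u| <= eps * nu.
  by move=> ui; rewrite /badu -leNgt ui /al distrC.
have hh u : #|u| = i -> `|h u| <= eps * nu.
  move=> ui; rewrite /h; case: ifP => [/andP[_ nb]|_]; first exact: nb_al.
  by rewrite normr0 mulr_ge0 // ltW.
have d2 : (n <= 4 * (n - i))%N by clear -dim2; lia.
have hs w : #|w| = i -> `|\sum_(u | sph 2 w u) h u| <= eta * (sph2_size n i)%:R + nu * M%:R.
  move=> wi; apply: (sum_quiet (g := al) _ al_le spBu wi) => //.
  have := qup; rewrite /quiet_up => /forallP/(_ w); rewrite wi eqxx /= => hq.
  rewrite -normrN -sumrN; move: hq; congr (`| _ | <= _); apply: eq_bigr => u _.
  by rewrite /al opprB.
have := smooth_bound dim1 d2 F_layer (cut1_up R G F_layer) hh hs.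
rewrite ler_norml => /andP[hF _].
rewrite (bigID (badu p X eps)) /= [X in _ <= _ + X](bigID (mem F)) /=.
have b1 : - (nu * #|[set u in T | badu p X eps u]|%:R) <= \sum_(u in T | badu p X eps u) al u.
  rewrite -mulNr [leLHS]mulr_natr -sumr_const big_mkcond [leRHS]big_mkcond; apply: ler_sum => u _.
  by rewrite inE; case: ifP => // _; have := al_le u; rewrite ler_norml => /andP[].
have b2 : \sum_(u in T | ~~ badu p X eps u && (u \in F)) al u = \sum_(u in F) h u.
  rewrite big_mkcond [RHS]big_mkcond; apply: eq_bigr => u _; rewrite /h.
  case uF: (u \in F); last by rewrite !andbF.
  have -> : (u \in T) = (u \in X).
    apply/idP/idP => [/shadow_X//|uX].
    move: uF; rewrite inE => /andP[_ hu].
    have : (0 < #|up u :&: S|)%N by rewrite -(ltr_nat R); move: hu; have := knu; lra.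
    by case/card_gt0P=> v; rewrite in_setI in_up => /andP[uv vS]; apply: shadowI vS uv uX.
  by rewrite andbT.
have b3 : - (eps * nu * #|[set u in T | ~~ badu p X eps u && (u \notin F)]|%:R) <=
    \sum_(u in T | ~~ badu p X eps u && (u \notin F)) al u.
  rewrite -mulNr [leLHS]mulr_natr -sumr_const big_mkcond [leRHS]big_mkcond; apply: ler_sum => u _.
  rewrite inE; case: ifP => // /and3P[uT nb _].
  by have := nb_al u (shadow_card SX uT) nb; rewrite ler_norml => /andP[].
have b4 : eps * nu * #|[set u in T | ~~ badu p X eps u && (u \notin F)]|%:R <= 2 * eps / kap * #|E|%:R.
  have c0 : 0 <= 2 * eps / kap by rewrite divr_ge0 ?mulr_ge0 // ltW.
  have := ler_wpM2l c0 T_minus_F; apply: le_trans.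
  by rewrite le_eqVlt; apply/orP; left; apply/eqP; field; rewrite !gt_eqF.
under [X in _ <= _ + (X + _)]eq_bigl do rewrite -andbA.
under [X in _ <= _ + (_ + X)]eq_bigl do rewrite -andbA.
rewrite b2; lra.
Qed.

Lemma sum_be : \sum_(v in S) be v <= 2 * eps / kap * #|E|%:R + 2 * eta * #|G|%:R + (128 * 128) * eps * #|El|%:R
    + nu * #|[set v in S | badd p X eps v]|%:R.
Proof.
pose h v := if (v \in X) && ~~ badd p X eps v then be v else 0.
have nb_be v : #|v| = i.+1 -> ~~ badd p X eps v -> `|be v| <= eps * nu.
  by move=> vi; rewrite /badd -leNgt vi /be distrC.
have hh v : #|v| = i.+1 -> `|h v| <= eps * nu.
  move=> vi; rewrite /h; case: ifP => [/andP[_ nb]|_]; first exact: nb_be.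
  by rewrite normr0 mulr_ge0 // ltW.
have d1 : (n <= 4 * i.+1)%N by clear -dim1; lia.
have hs w : #|w| = i.+1 -> `|\sum_(u | sph 2 w u) h u| <= eta * (sph2_size n i.+1)%:R + nu * M%:R.
  move=> wi; apply: (sum_quiet (g := be) _ be_le spB wi) => //.
  have := qdn; rewrite /quiet_dn => /forallP/(_ w); rewrite wi eqxx /= => hq.
  rewrite -normrN -sumrN; move: hq; congr (`| _ | <= _); apply: eq_bigr => u _.
  by rewrite /be opprB.
have := smooth_bound d1 dim2 G_layer (cut1_dn R F G_layer) hh hs.
rewrite ler_norml => /andP[_ hG].
have SG := S_sub_G.
have b0 : \sum_(v in G) h v = \sum_(v in S) h v + \sum_(v in G :\: S) h v.
  rewrite (bigID (mem S)) /=; congr (_ + _).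
    by apply: eq_bigl => v; case vS: (v \in S); rewrite ?andbF // (subsetP SG v vS).
  by apply: eq_bigl => v; rewrite in_setD andbC.
have b1 : \sum_(v in S) be v <= \sum_(v in S) h v + nu * #|[set v in S | badd p X eps v]|%:R.
  rewrite (bigID (badd p X eps)) /= addrC; apply: lerD.
    rewrite big_mkcond [leRHS]big_mkcond; apply: ler_sum => v _.
    by case vS: (v \in S) => //=; rewrite /h (S_X SX vS) /=; case: ifP.
  rewrite [leRHS]mulr_natr -sumr_const big_mkcond [leRHS]big_mkcond; apply: ler_sum => v _.
  by rewrite inE; case: ifP => // _; have := be_le v; rewrite ler_norml => /andP[].
have b3 : - (eps * nu * #|(G :&: X) :\: S|%:R) <= \sum_(v in G :\: S) h v.
  rewrite -mulNr [leLHS]mulr_natr -sumr_const big_mkcond [leRHS]big_mkcond; apply: ler_sum => v _.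
  rewrite !in_setD in_setI; case vS: (v \in S) => //=; case vG: (v \in G) => //=.
  have cv : #|v| = i.+1 by have := subsetP G_layer v vG; rewrite inE => /eqP.
  rewrite /h; case vX: (v \in X) => //=; case: ifP => [nb|_].
    by have := nb_be v cv nb; rewrite ler_norml => /andP[].
  by rewrite oppr_le0 mulr_ge0 // ltW.
have b4 : eps * nu * #|(G :&: X) :\: S|%:R <= 2 * eps / kap * #|E|%:R.
  have c0 : 0 <= 2 * eps / kap by rewrite divr_ge0 ?mulr_ge0 // ltW.
  have := ler_wpM2l c0 G_minus_S; apply: le_trans.
  by rewrite le_eqVlt; apply/orP; left; apply/eqP; field; rewrite !gt_eqF.
lra.
Qed.

Hypotheses (hA : eps * (4 / kap + (10 * (256 * 128)) / cJ) <= 1 / 4).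
Hypotheses (hB : (512 * 512) * eps * M%:R <= eta * nu).
Hypotheses (hC : 32 * M%:R <= kap ^+ 2 * nu) (hC' : 8 * M%:R <= eta * kap ^+ 2 * nu).

Lemma kap_le : kap <= 1 / 4. Proof. by have := hke; have := eps0; have := p1; lra. Qed.

Lemma M_small : 8 * M%:R <= nu.
Proof.
have : kap ^+ 2 * nu <= 1 * nu by rewrite ler_wpM2r // expr_le1 ?ltW //; have := kap_le; lra.
by have := hC; have : 0 <= (M%:R : R) by []; lra.
Qed.

Lemma lattice_cut_bound :
  #|El|%:R <= 10 / cJ * #|E|%:R + 8 * M%:R / nu * (#|F|%:R + #|G|%:R).
Proof.
have n0 : 0 < nu by rewrite ltr0n; apply: leq_trans n16.
have M0 : 0 <= (M%:R : R) by [].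
have c0 : 0 < cJ by rewrite divr_gt0 // mulr_gt0 // exprn_gt0.
have [d1 d2] := dims_real; have M8 := M_small.
have hup : nu / 8 + M%:R <= (n - i)%:R by rewrite subn_real; lra.
have hdn : nu / 8 + M%:R <= i.+1%:R by rewrite -[i.+1%:R]natr1; lra.
have := card_dis1 S kap0 knu mix; have := card_dis2 S kap0 knu mix.
have := card_left1 S sparse_low hup; have := card_left2 S sparse_ulow hdn.
have := card_lattice_cut i X S kap; rewrite -(ler_nat R) !natrD.
set l := #|El|%:R; set a := #|dis1 _ _ _ _|%:R; set b := #|dis2 _ _ _ _|%:R.
set c := #|left1 _ _ _ _|%:R; set d := #|left2 _ _ _ _|%:R; set e := #|E|%:R.
set f := #|F|%:R; set g := #|G|%:R => hl hd hc hb ha.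
have a' : a <= e / cJ by rewrite ler_pdivlMr // mulrC.
have b' : b <= 4 * e / cJ by rewrite ler_pdivlMr // mulrC.
have c' : c <= 8 * M%:R / nu * (g + a).
  rewrite -(ler_pM2l (_ : 0 < nu / 8)) ?divr_gt0 //; apply: (le_trans hc).
  by rewrite le_eqVlt; apply/orP; left; apply/eqP; field; rewrite !gt_eqF.
have d' : d <= 8 * M%:R / nu * (f + b).
  rewrite -(ler_pM2l (_ : 0 < nu / 8)) ?divr_gt0 //; apply: (le_trans hd).
  by rewrite le_eqVlt; apply/orP; left; apply/eqP; field; rewrite !gt_eqF.
have m1 : 8 * M%:R / nu <= 1 by rewrite ler_pdivrMr // mul1r.
have [a0 b0] : 0 <= a /\ 0 <= b by [].
move: c' d' m1; set m := 8 * M%:R / nu => c' d' m1.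
have ma : m * a <= a by rewrite ler_piMl.
have mb : m * b <= b by rewrite ler_piMl.
(* The edges of [left1] and [left2] add at most one more copy of [dis1] and [dis2], whose sizes are
   at most [e / cJ] and [4 * e / cJ]: hence [2 * (1 + 4)]. *)
have -> : 10 / cJ * e = 2 * (e / cJ) + 2 * (4 * e / cJ) by field; rewrite !gt_eqF.
lra.
Qed.

(** Bad vertices of [T] and [S] are near [S], hence fewer than [|E| + |S|] by a factor of order
    [n ^ 2]; even with the trivial error [nu] each they cost only a fraction of order [1 / n]. *)
Lemma card_bad : nu * (#|[set u in T | badu p X eps u]|%:R + #|[set v in S | badd p X eps v]|%:R) <=
  8 * M%:R / (kap ^+ 2 * nu) * (#|E|%:R + #|S|%:R).
Proof.
have n0 : 0 < nu by rewrite ltr0n; apply: leq_trans n16.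
have hM : M%:R <= kap / 2 * nu.
  have : kap ^+ 2 * nu <= kap * nu by rewrite ler_wpM2r // expr2 ler_piMr // ?ltW //; have := kap_le; lra.
  by have := hC; have : 0 <= (M%:R : R) by []; lra.
have z1 : kap ^+ 2 / 4 * nu ^+ 2 * #|[set u in T | badu p X eps u]|%:R <= M%:R * (#|E|%:R + #|S|%:R).
  apply: (card_near_centers SX Snl kap0 knu sparse_ulow _ _ hM) => [u|w].
    rewrite inE => /andP[uT _]; have [v vS uv] := shadow_ex uT; exists v => //.
    by rewrite (dist_adj uv).
  apply: (sparse_le (z := w) spBu) => u; rewrite inE => /andP[].
  by rewrite inE => /andP[uT b] d; rewrite b (shadow_card SX uT).
have z2 : kap ^+ 2 / 4 * nu ^+ 2 * #|[set v in S | badd p X eps v]|%:R <= M%:R * (#|E|%:R + #|S|%:R).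
  apply: (card_near_centers SX Snl kap0 knu sparse_ulow _ _ hM) => [v|w].
    by rewrite inE => /andP[vS _]; exists v; rewrite ?dist0.
  apply: (sparse_le (z := w) spB) => v; rewrite inE => /andP[].
  by rewrite inE => /andP[vS b] d; rewrite b (S_card SX vS).
set a := #|[set u in T | _]|%:R in z1 *; set b := #|[set v in S | _]|%:R in z2 *.
have k0 : 0 < kap ^+ 2 / 4 * nu by rewrite mulr_gt0 // divr_gt0 // exprn_gt0.
rewrite -(ler_pM2l k0).
have -> : kap ^+ 2 / 4 * nu * (nu * (a + b)) = kap ^+ 2 / 4 * nu ^+ 2 * a + kap ^+ 2 / 4 * nu ^+ 2 * b by ring.
have -> : kap ^+ 2 / 4 * nu * (8 * M%:R / (kap ^+ 2 * nu) * (#|E|%:R + #|S|%:R)) = 2 * (M%:R * (#|E|%:R + #|S|%:R)).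
  by field; rewrite !gt_eqF.
lra.
Qed.

(** In the exact edge identity the sums of [al] and [be] are the only errors. Their multiples of [e]
    take a quarter through [hA] and a quarter through the bad vertices, so half of [e] remains;
    everything else is a multiple of [eta], and [|F|], [|G|] are at most [2 / kap] times [|S|],
    [|T|]. *)
Lemma main_inequality :
  p * (2 * i%:R + 1 - nu) * #|T|%:R + #|E|%:R / 2 - 8 * eta / kap * (#|S|%:R + #|T|%:R)
  <= p * i.+1%:R * (#|T|%:R - #|S|%:R).
Proof.
have n0 : 0 < nu by rewrite ltr0n; apply: leq_trans n16.
have c0 : 0 < cJ by rewrite divr_gt0 // mulr_gt0 // exprn_gt0.
have hal := sum_al; have hbe := sum_be; have hEl := lattice_cut_bound; have hbd := card_bad.
have hF := card_Fset i S knu; have hG := card_Gset i X S knu.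
have id : p * i.+1%:R * (#|T|%:R - #|S|%:R) =
    p * (2 * i%:R + 1 - nu) * #|T|%:R + \sum_(u in T) al u - \sum_(v in S) be v + #|E|%:R.
  have := congr1 (fun m => m%:R : R) (sum_degrees SX); rewrite natrD !natr_sum => e.
  have -> : \sum_(u in T) al u = p * (n - i)%:R * #|T|%:R - \sum_(u in T) (uX X u)%:R.
    by rewrite /al sumrB sumr_const (mulr_natr (p * (n - i)%:R)).
  have -> : \sum_(v in S) be v = p * i.+1%:R * #|S|%:R - \sum_(v in S) (dX X v)%:R.
    by rewrite /be sumrB sumr_const (mulr_natr (p * i.+1%:R)).
  by rewrite -e subn_real -[i.+1%:R]natr1; ring.
rewrite id; move: hal hbe hEl hbd hF hG.
set Sa := \sum_(u in T) _; set Sb := \sum_(v in S) _; set e := #|E|%:R; set l := #|El|%:R.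
set f := #|F|%:R; set g := #|G|%:R; set s := #|S|%:R; set t := #|T|%:R.
set z1 := #|[set u in T | _]|%:R; set z2 := #|[set v in S | _]|%:R => hal hbe hEl hbd hF hG.
have [e0 s0 f0 g0] : [/\ 0 <= e, 0 <= s, 0 <= f & 0 <= g] by [].
have m1 : 8 * M%:R / (kap ^+ 2 * nu) <= 1 / 4.
  by rewrite ler_pdivrMr ?mulr_gt0 ?exprn_gt0 //; have := hC; lra.
have m2 : 8 * M%:R / (kap ^+ 2 * nu) <= eta.
  by rewrite ler_pdivrMr ?mulr_gt0 ?exprn_gt0 //; have := hC'; lra.
have m3 : (256 * 128) * eps * (8 * M%:R / nu) <= eta.
  by rewrite !mulrA ler_pdivrMr //; have := hB; lra.
have hbd' : nu * (z1 + z2) <= e / 4 + eta * s.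
  apply: (le_trans hbd); rewrite mulrDr; apply: lerD; first by have := ler_wpM2r e0 m1; lra.
  exact: ler_wpM2r.
have hEl' : (256 * 128) * eps * l <= (10 * (256 * 128)) * eps / cJ * e + eta * (f + g).
  have e1 : 0 <= (256 * 128) * eps by have := eps0; lra.
  have fg : 0 <= f + g by rewrite addr_ge0.
  have h2 := ler_wpM2r fg m3; have h1 := ler_wpM2l e1 hEl.
  apply: (le_trans h1); rewrite mulrDr !mulrA; apply: lerD; last by move: h2; rewrite !mulrA.
  by rewrite le_eqVlt; apply/orP; left; apply/eqP; field; rewrite !gt_eqF.
have hA' : 4 * eps / kap * e + (10 * (256 * 128)) * eps / cJ * e <= e / 4.
  have := ler_wpM2r e0 hA.
  have -> : eps * (4 / kap + (10 * (256 * 128)) / cJ) * e = 4 * eps / kap * e + (10 * (256 * 128)) * eps / cJ * e.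
    by field; rewrite !gt_eqF.
  lra.
have hf : f <= 2 / kap * s.
  by rewrite mulrAC ler_pdivlMr //; move: hF; lra.
have hg : g <= 2 / kap * t.
  by rewrite mulrAC ler_pdivlMr //; move: hG; lra.
have hf' := ler_wpM2l (ltW eta0) hf; have hg' := ler_wpM2l (ltW eta0) hg.
have hs : eta * s <= eta * (2 / kap * s).
  rewrite ler_pM2l // ler_peMl // ler_pdivlMr // mul1r; have := kap_le; lra.
have -> : 8 * eta / kap * (s + t) = 4 * (eta * (2 / kap * s)) + 4 * (eta * (2 / kap * t)) by field; rewrite !gt_eqF.
have hE2 : 4 * eps / kap * e = 2 * (2 * eps / kap * e) by field; rewrite !gt_eqF.
have t0 : 0 <= eta * (2 / kap * t) by apply: mulr_ge0; [exact: ltW | apply: mulr_ge0 => //; apply: divr_ge0 => //; exact: ltW].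
rewrite hE2 in hA'; rewrite mulrDr in hbd'.
move: hal hbe; rewrite -/z1 -/z2; lra.
Qed.

End MainInequality.

(** * Expansion *)

(* The constants are chosen in the order [kap], [eps], [eta], [M], [n]. *)
Record params (R : realType) (p kap eps eta : R) (M n : nat) : Prop := Params {
  pr_p0 : 1 / 2 < p; pr_p1 : p < 1; pr_kap0 : 0 < kap; pr_eps0 : 0 < eps; pr_eta0 : 0 < eta;
  pr_ke : kap + eps <= p / 4;
  pr_A : eps * (4 / kap + 10 * (256 * 128) / (p ^+ 2 * kap ^+ 2 / 32)) <= 1 / 4;
  pr_far : eps * (1 + 1 / kap) <= p / 16;
  pr_om : 8 * eta / kap <= p ^+ 2 * kap ^+ 2 / 32 / (160 * 100);
  pr_knu : 4 <= kap * n%:R; pr_n : (400 <= n)%N;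
  pr_B : 512 * 512 * eps * M%:R <= eta * n%:R;
  pr_C : 32 * M%:R <= kap ^+ 2 * n%:R;
  pr_C' : 8 * M%:R <= eta * kap ^+ 2 * n%:R;
  pr_D : 64 * 64 * M%:R <= eta * n%:R;
  pr_far2 : 2 * M%:R / kap + 1 <= p / 16 * n%:R;
  pr_iso : 400 * M%:R * (1 + 2 / kap) <= 1 / 2 * n%:R;
  pr_K : (M%:R + 3) * (4 * (2 * M%:R)) * (160 * 100) <=
         kap ^+ 2 * (p ^+ 2 * kap ^+ 2 / 32) * n%:R;
  pr_Kfar : (M%:R + 3) * (4 * (2 * M%:R)) <= kap * n%:R;
  pr_M1 : (0 < M)%N;
  pr_MM : M%:R * (M%:R + 2) <= kap * n%:R }.

(* The surplus pays for the low vertices that have to be discarded near [Z]. *)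
Definition hall (R : realType) n (X S : {set {set 'I_n}}) (M : nat) : Prop :=
  (S != set0 -> (#|S| < #|shadow X S|)%N) /\
  forall Z : {set {set 'I_n}},
    (forall z, z \in Z -> exists2 v, v \in S & (dist z v <= 4)%N) ->
    (forall w, #|[set z in Z | (dist z w <= 8)%N]| <= 2 * M)%N ->
    (M%:R + 3) * #|Z|%:R <= #|shadow X S|%:R - #|S|%:R :> R.

Section Hall.
Variables (R : realType) (p kap eps eta : R) (M n i : nat).
Notation V := {set 'I_n}.
Variables (X S : {set V}).
Notation nu := (n%:R : R).
Notation cJ := (p ^+ 2 * kap ^+ 2 / 32).
Hypothesis (P : params p kap eps eta M n).
Hypotheses (SX : S \subset X :&: layer n i.+1) (Snl : forall v, v \in S -> ~~ low X kap v).
Hypotheses (spB : sparse (badd p X eps) i.+1 M) (spBu : sparse (badu p X eps) i M).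
Notation T := (shadow X S).
Notation E := (boundary X S).

Lemma pr_pos : 0 < p. Proof. by have := pr_p0 P; lra. Qed.

Lemma nu_ge : 400 <= nu. Proof. by rewrite (ler_nat _ 400) (pr_n P). Qed.

Lemma cJ_bounds : 0 < cJ /\ cJ <= 1 / 512.
Proof.
have [[a b] c] := (pr_pos, pr_p1 P, pr_kap0 P); have d := pr_ke P; have e := pr_eps0 P.
split; first by rewrite divr_gt0 // mulr_gt0 // exprn_gt0.
have p2 : p ^+ 2 <= 1 by rewrite expr_le1 // ltW.
have k2 : kap ^+ 2 <= 1 / 16.
  by rewrite (_ : 1 / 16 = (1 / 4) ^+ 2); [rewrite ler_pXn2r // ?nnegrE; lra | field].
have p20 : 0 <= p ^+ 2 by apply: sqr_ge0.
have k20 : 0 <= kap ^+ 2 by apply: sqr_ge0.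
have := ler_pM p20 k20 p2 k2; lra.
Qed.

Lemma shadow_dn v : v \in S -> kap * nu <= #|dn v :&: T|%:R.
Proof.
move=> vS; have := Snl vS; rewrite /low -leNgt => h; apply: (le_trans h); rewrite ler_nat.
apply: subset_leq_card; apply/subsetP => u; rewrite !in_setI => /andP[uv uX]; rewrite uv /=.
by apply: shadowI vS _ uX; move: uv; rewrite inE.
Qed.

(** A surplus of order [(|E| + |S|) / n] dominates any [Z] as in [hall], whose size is at most of
    order [(|E| + |S|) / n ^ 2] by [card_near_centers]; [pr_K] makes [n] large enough for the
    constants. *)
Lemma hall_of_surplus :
    n%:R * (#|T|%:R - #|S|%:R) >= cJ / (160 * 100) * (#|E|%:R + #|S|%:R) :> R ->
    sparse (ulow X kap) i M -> hall R X S M.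
Proof.
move=> sur spU; have n0 : 0 < nu by have := nu_ge; lra.
have [c0 _] := cJ_bounds; have k0 := pr_kap0 P.
split.
  rewrite -card_gt0 -(ltr_nat R) => s0; rewrite -(ltr_nat R) -subr_gt0.
  have e0 : 0 <= (#|E|%:R : R) by [].
  have : 0 < cJ / (160 * 100) * (#|E|%:R + #|S|%:R) by rewrite mulr_gt0 ?divr_gt0 //; lra.
  by move=> /lt_le_trans/(_ sur); rewrite pmulr_rgt0.
move=> Z hZ hM.
have M0 : 0 <= (M%:R : R) by [].
have hM2 : M%:R <= kap / 2 * nu.
  have : kap ^+ 2 * nu <= kap * nu.
    rewrite ler_wpM2r // expr2 ler_piMr ?ltW //; have := pr_ke P; have := pr_p1 P; have := pr_eps0 P; lra.
  by have := pr_C P; lra.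
have := card_near_centers SX Snl k0 (pr_knu P) spU hZ hM hM2.
rewrite natrM; have K := pr_K P.
set z := #|Z|%:R; set D := #|T|%:R - #|S|%:R in sur *; set w := #|E|%:R + #|S|%:R in sur * => h.
have z0 : 0 <= z by [].
have q0 : 0 < kap ^+ 2 * cJ * nu ^+ 2 by apply: mulr_gt0; [apply: mulr_gt0 => //; apply: exprn_gt0 | apply: exprn_gt0].
rewrite -(ler_pM2l q0).
have M20 : 0 <= 4 * (2 * M%:R) * (160 * 100) :> R by rewrite !mulr_ge0.
have h1 := ler_wpM2l M20 sur.
have cc : 0 <= 4 * cJ by lra.
have h2 := ler_wpM2l cc h.
case: (ltrP D 0) => [Dn|D0].
  have : nu * D < 0 by rewrite pmulr_rlt0.
  have : 0 <= cJ / (160 * 100) * w by apply: mulr_ge0; [lra | exact: addr_ge0].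
  lra.
have nD : 0 <= nu * D by rewrite mulr_ge0 // ltW.
have h3 := ler_wpM2r nD K.
have Mc : 0 <= M%:R + 3 :> R by lra.
have h4 : (M%:R + 3) * (4 * cJ * (kap ^+ 2 / 4 * nu ^+ 2 * z)) <= (M%:R + 3) * (4 * cJ * (2 * M%:R * w)) by rewrite ler_wpM2l.
have h5 : (M%:R + 3) * (4 * (2 * M%:R) * (160 * 100) * (cJ / (160 * 100) * w)) <= (M%:R + 3) * (4 * (2 * M%:R) * (160 * 100) * (nu * D)) by rewrite ler_wpM2l.
have e1 : kap ^+ 2 * cJ * nu ^+ 2 * ((M%:R + 3) * z) = (M%:R + 3) * (4 * cJ * (kap ^+ 2 / 4 * nu ^+ 2 * z)) by field.
have e2 : (M%:R + 3) * (4 * cJ * (2 * M%:R * w)) = (M%:R + 3) * (4 * (2 * M%:R) * (160 * 100) * (cJ / (160 * 100) * w)) by field.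
have e3 : (M%:R + 3) * (4 * (2 * M%:R) * (160 * 100) * (nu * D)) = (M%:R + 3) * (4 * (2 * M%:R)) * (160 * 100) * (nu * D) by ring.
have e4 : kap ^+ 2 * cJ * nu * (nu * D) = kap ^+ 2 * cJ * nu ^+ 2 * D by ring.
rewrite e1; apply: (le_trans h4); rewrite e2; apply: (le_trans h5); rewrite e3 -e4; exact: h3.
Qed.

Section Near.
Hypotheses (dim1 : (n <= 4 * i)%N) (dim2 : (n <= 4 * (n - i.+1))%N).
Hypotheses (mix : mixing p X cJ i).
Hypotheses (qup : quiet_up p X eta i) (qdn : quiet_dn p X eta i.+1).

Lemma pr_D3 : 64 * 64 * M%:R <= eta * nu ^+ 3.
Proof.
apply: (le_trans (pr_D P)); rewrite ler_pM2l ?(pr_eta0 P) // -{1}(expr1 nu).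
by rewrite ler_weXn2l //; have := nu_ge; lra.
Qed.

Lemma n16 : (16 <= n)%N. Proof. by apply: leq_trans (pr_n P). Qed.

Lemma main_ineq :
  p * (2 * i%:R + 1 - nu) * #|T|%:R + #|E|%:R / 2 - 8 * eta / kap * (#|S|%:R + #|T|%:R)
  <= p * i.+1%:R * (#|T|%:R - #|S|%:R).
Proof.
apply: (@main_inequality _ p n i X S kap eps eta M); rewrite ?(pr_kap0 P) ?(pr_eps0 P) ?(pr_eta0 P)
  ?(pr_ke P) ?(pr_knu P) ?(pr_A P) ?(pr_B P) ?(pr_C P) ?(pr_C' P) ?pr_pos ?pr_D3 ?n16 //.
by rewrite ltW // (pr_p1 P).
Qed.

Lemma near_sparse_ulow : sparse (ulow X kap) i M.
Proof.
apply: (@sparse_ulow _ p n i X kap eps M) => //; rewrite ?(pr_ke P) ?pr_pos ?n16 //.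
Qed.

Lemma i_lt_n : (i < n)%N.
Proof. by have := n16; clear -dim2; lia. Qed.

(** Here [2 * i + 1 - n] is at least 1, so the drift is at least [p * |T|] and outweighs the error
    [8 * eta / kap] per element. *)
Lemma hall_slack : (n <= 2 * i)%N -> hall R X S M.
Proof.
move=> ni; apply: hall_of_surplus near_sparse_ulow.
have := main_ineq; have om := pr_om P; have [c0 c1] := cJ_bounds.
have [[p0 p1] ph] := (pr_pos, pr_p1 P, pr_p0 P).
have n0 : 0 < nu by have := nu_ge; lra.
set o := 8 * eta / kap in om *.
have o0 : 0 <= o by rewrite divr_ge0 ?mulr_ge0 ?ltW ?(pr_eta0 P) ?(pr_kap0 P).
set s := #|S|%:R; set t := #|T|%:R; set e := #|E|%:R => h.
have [s0 t0 e0] : [/\ 0 <= s, 0 <= t & 0 <= e] by [].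
have sl : p * t <= p * (2 * i%:R + 1 - nu) * t.
  rewrite ler_wpM2r // ler_peMr ?(ltW p0) //.
  have : nu <= 2 * i%:R by rewrite -natrM ler_nat.
  by lra.
have di : p * i.+1%:R <= nu.
  have i1 : (i.+1%:R : R) <= nu by rewrite ler_nat i_lt_n.
  by have := ler_pM (ltW p0) (ler0n _ _) (ltW p1) i1; rewrite mul1r.
have d1 : p <= p * i.+1%:R by rewrite ler_peMr ?(ltW p0) // ler1n.
set D := p * i.+1%:R in h di d1.
have h' : (p - 2 * o) * t + e / 2 <= (D - o) * (t - s) by lra.
have po : 0 <= p - 2 * o by lra.
have pt : 0 <= (p - 2 * o) * t by rewrite mulr_ge0.
have Do : 0 < D - o by lra.
have ts : 0 <= t - s by rewrite -(pmulr_rge0 _ Do); lra.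
have h2 : (D - o) * (t - s) <= nu * (t - s) by rewrite ler_wpM2r //; lra.
have h3 : (p - 2 * o) * s <= (p - 2 * o) * t by rewrite ler_wpM2l //; lra.
have h4 : cJ / (160 * 100) * (e + s) <= 1 / 4 * (e + s) by rewrite ler_wpM2r ?addr_ge0 //; lra.
have h5 : 1 / 4 * s <= (p - 2 * o) * s by rewrite ler_wpM2r //; lra.
lra.
Qed.

Hypothesis (nodd : n = (2 * i).+1).

Lemma nuE : nu = 2 * i%:R + 1.
Proof. by rewrite nodd -[(2 * i).+1]addn1 natrD natrM. Qed.

(** Without drift and without a lower bound on the boundary, the error terms alone still forbid the
    shadow from being noticeably smaller than [S]. This decides which of the two middle levels to
    empty. *)
Lemma mid_weak : 99 / 100 * #|S|%:R <= #|T|%:R :> R.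
Proof.
have := main_ineq; have om := pr_om P; have [c0 c1] := cJ_bounds.
have [[p0 p1] ph] := (pr_pos, pr_p1 P, pr_p0 P); have n400 := nu_ge.
set o := 8 * eta / kap in om *.
have o0 : 0 <= o by rewrite divr_ge0 ?mulr_ge0 ?ltW ?(pr_eta0 P) ?(pr_kap0 P).
set s := #|S|%:R; set t := #|T|%:R; set e := #|E|%:R => h.
have [s0 t0 e0] : [/\ 0 <= s, 0 <= t & 0 <= e] by [].
have z : 2 * i%:R + 1 - nu = 0 by rewrite nuE subrr.
rewrite z mulr0 mul0r add0r in h.
have d1 : 100 <= p * i.+1%:R.
  have i2 : 200 <= (i.+1%:R : R) by have := nuE; rewrite -[i.+1%:R]natr1; lra.
  by apply: (@le_trans _ _ (1 / 2 * 200)); [lra | apply: ler_pM => //; lra].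
set D := p * i.+1%:R in h d1.
have h' : - (2 * o) * s <= (D + o) * (t - s) by lra.
have os : 2 * o * s <= 1 / (10 * 100) * s by rewrite ler_wpM2r //; lra.
rewrite leNgt; apply/negP => lt.
have Dt : 100 * (1 / 100 * s) <= (D + o) * (s - t) by apply: ler_pM => //; lra.
have : 1 / (10 * 100) * s < s by rewrite gtr_pMl; lra.
lra.
Qed.

Hypotheses (Sup : #|S|%:R <= 55 / 100 * (p * #|layer n i.+1|%:R))
  (Xlo : 99 / 100 * (p * #|layer n i.+1|%:R) <= #|X :&: layer n i.+1|%:R).

(** If [G] misses a tenth of its level, isoperimetry makes its cut, hence [El], at least a constant
    times [|G|], and [lattice_cut_bound] transfers this to [E]. If [G] fills more, then [X] has at
    least [(99 - 55) / 100 * p * N - N / 10], hence at least [12 / 100 * N], members in [G] outside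
    [S], and each carries linearly many boundary edges. *)
Lemma mid_boundary : cJ / (10 * 100) * #|S|%:R <= #|E|%:R.
Proof.
have [c0 c1] := cJ_bounds; have [[p0 p1] ph] := (pr_pos, pr_p1 P, pr_p0 P); have n400 := nu_ge.
have n0 : 0 < nu by lra.
have k0 := pr_kap0 P; have knu := pr_knu P.
have Sup' := Sup; have Xlo' := Xlo.
set G := Gset i X S kap; set N := #|layer n i.+1|%:R in Sup' Xlo'.
have GL : G \subset layer n i.+1 by apply: G_layer.
have SG : S \subset G by apply: (@S_sub_G _ n i X S kap).
have sG : (#|S|%:R : R) <= #|G|%:R by rewrite ler_nat subset_leq_card.
have GN : (#|G|%:R : R) <= N by rewrite ler_nat subset_leq_card.
have GLc : (#|layer n i.+1 :\: G|%:R : R) = N - #|G|%:R.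
  by rewrite cardsD (setIidPr GL) natrB ?subset_leq_card.
have GS : kap / 2 * nu * #|(G :&: X) :\: S|%:R <= #|E|%:R by apply: G_minus_S.
have [Gb|Gs] := ltrP (9 / 10 * N) (#|G|%:R : R).
  have c2 : (#|X :&: layer n i.+1|%:R : R) <= #|(G :&: X) :\: S|%:R + #|S|%:R + (N - #|G|%:R).
    rewrite -GLc -!natrD ler_nat.
    apply: leq_trans (_ : _ <= #|((G :&: X) :\: S) :|: S :|: (layer n i.+1 :\: G)|)%N _.
      apply: subset_leq_card; apply/subsetP => v; rewrite in_setI => /andP[vX vL].
      by rewrite !in_setU !in_setD in_setI vX vL; case: (v \in S); case: (v \in G).
    by apply: leq_trans (leq_card_setU _ _) _; rewrite leq_add2r leq_card_setU.
  set g := #|(G :&: X) :\: S|%:R in GS c2.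
  have N0 : 0 <= N by [].
  have pN : 1 / 2 * N <= p * N by rewrite ler_wpM2r // ltW.
  have g1 : 12 / 100 * N <= g by lra.
  have h1 : 2 * (12 / 100 * N) <= kap / 2 * nu * g by apply: ler_pM => //; lra.
  have h2 : cJ / (10 * 100) * #|S|%:R <= 1 / (10 * 100) * N by apply: ler_pM => //; lra.
  lra.
have [f0 fS] : 0 <= (#|Fset i S kap|%:R : R) /\ kap / 2 * #|Fset i S kap|%:R <= #|S|%:R.
  by split => //; apply: card_Fset.
have El : #|lattice_cut i X S kap|%:R <=
    10 / cJ * #|E|%:R + 8 * M%:R / nu * (#|Fset i S kap|%:R + #|G|%:R).
  apply: (@lattice_cut_bound _ p n i X S kap eps M) => //; rewrite ?(pr_eps0 P) ?(pr_ke P) ?(pr_C P) ?n16 //.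
  exact: ltW.
have cut : (#|cut_pairs 1 G|%:R : R) <= 2 * nu * #|lattice_cut i X S kap|%:R.
  by rewrite -!natrM ler_nat; apply: (cut1_dn R).
have i0 : (0 < i.+1 < n)%N by rewrite nodd /= ltnS; have := pr_n P; rewrite nodd; clear; lia.
have := isoperimetry i0 GL; rewrite -(ler_nat R) !natrM GLc -/N.
have e1 : (n - i.+1)%:R = (nu - 1) / 2 :> R.
  have -> : (n - i.+1 = i)%N by rewrite {1}nodd; clear; lia.
  by rewrite nuE; field.
have e2 : i.+1%:R = (nu + 1) / 2 :> R by rewrite nuE -[i.+1%:R]natr1; field.
rewrite e1 e2 => iso.
set g := #|G|%:R in sG GN Gs iso El *; set l := #|lattice_cut _ _ _ _|%:R in El cut.
set f := #|Fset _ _ _|%:R in f0 fS El; set c := #|cut_pairs 1 G|%:R in cut iso.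
have [g0 s0] : 0 <= g /\ 0 <= (#|S|%:R : R) by [].
have [N0|N0] := ltrP 0 N; last first.
  have -> : (#|S|%:R : R) = 0 by apply/eqP; rewrite eq_le s0 andbT; apply: le_trans sG (le_trans GN N0).
  by rewrite mulr0.
have i1 : g * N * (nu ^+ 2 - 1) / 20 <= N * nu * c.
  apply: le_trans iso.
  have : 2 * (g * (1 / 10 * N)) * ((nu + 1) / 2 * ((nu - 1) / 2)) <= 2 * (g * (N - g)) * ((nu + 1) / 2 * ((nu - 1) / 2)).
    apply: ler_wpM2r; first by apply: mulr_ge0; lra.
    by rewrite ler_pM2l // ler_wpM2l //; lra.
  by apply: le_trans; rewrite le_eqVlt; apply/orP; left; apply/eqP; field.
have i2 : g * (nu ^+ 2 - 1) / 20 <= nu * c.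
  rewrite -(ler_pM2l N0) [leRHS]mulrA; apply: le_trans i1.
  by rewrite le_eqVlt; apply/orP; left; apply/eqP; field.
have i3 : g * nu ^+ 2 / 25 <= nu * c.
  apply: le_trans i2.
  have : g * (nu ^+ 2 / 25) <= g * ((nu ^+ 2 - 1) / 20).
    rewrite ler_wpM2l //; have : 400 * 400 <= nu ^+ 2 by rewrite expr2; apply: ler_pM.
    lra.
  by rewrite !mulrA.
have i4 : g * nu ^+ 2 / 25 <= nu * (2 * nu * l) by apply: (le_trans i3); rewrite ler_pM2l.
have i5 : g <= 50 * l.
  have n2 : 0 < nu ^+ 2 / 25 by rewrite divr_gt0 // exprn_gt0.
  rewrite -(ler_pM2r n2) mulrA; apply: (le_trans i4).
  by rewrite le_eqVlt; apply/orP; left; apply/eqP; field.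
have fs : f <= 2 / kap * g.
  by rewrite mulrAC ler_pdivlMr //; move: fS; lra.
have m0 : 0 <= 8 * M%:R / nu by rewrite divr_ge0 ?mulr_ge0 // ltW.
have i6 : 8 * M%:R / nu * (f + g) <= 8 * M%:R / nu * ((1 + 2 / kap) * g).
  by rewrite ler_wpM2l //; lra.
have i7 : 50 * (8 * M%:R / nu * ((1 + 2 / kap) * g)) <= 1 / 2 * g.
  have -> : 50 * (8 * M%:R / nu * ((1 + 2 / kap) * g)) = (400 * M%:R * (1 + 2 / kap)) / nu * g by ring.
  by rewrite ler_wpM2r // ler_pdivrMr // (pr_iso P).
have i8 : g <= 10 * 100 / cJ * #|E|%:R.
  have -> : 10 * 100 / cJ * #|E|%:R = 2 * (50 * (10 / cJ * #|E|%:R)) by field; rewrite !gt_eqF.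
  lra.
have i9 : cJ * g <= 10 * 100 * #|E|%:R.
  have -> : 10 * 100 * #|E|%:R = cJ * (10 * 100 / cJ * #|E|%:R) by field; rewrite !gt_eqF.
  by rewrite ler_pM2l.
have i10 : cJ * #|S|%:R <= cJ * g by rewrite ler_pM2l.
lra.
Qed.

(** The boundary takes over the part of the drift: it is at least [cJ / (10 * 100)] per element of
    [S], while [pr_om] keeps the error [8 * eta / kap] sixteen times smaller. *)
Lemma hall_mid : hall R X S M.
Proof.
apply: hall_of_surplus near_sparse_ulow.
have bd := mid_boundary.
have := main_ineq; have om := pr_om P; have [c0 c1] := cJ_bounds.
have [[p0 p1] ph] := (pr_pos, pr_p1 P, pr_p0 P); have n400 := nu_ge.
set o := 8 * eta / kap in om *.
have o0 : 0 <= o by rewrite divr_ge0 ?mulr_ge0 ?ltW ?(pr_eta0 P) ?(pr_kap0 P).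
set s := #|S|%:R in bd *; set t := #|T|%:R; set e := #|E|%:R in bd * => h.
have [s0 t0 e0] : [/\ 0 <= s, 0 <= t & 0 <= e] by [].
have z : 2 * i%:R + 1 - nu = 0 by rewrite nuE subrr.
rewrite z mulr0 mul0r add0r in h.
have di : p * i.+1%:R <= nu.
  have i1 : (i.+1%:R : R) <= nu by rewrite ler_nat i_lt_n.
  by have := ler_pM (ltW p0) (ler0n _ _) (ltW p1) i1; rewrite mul1r.
have D0 : 0 <= p * i.+1%:R by rewrite mulr_ge0 // ltW.
set D := p * i.+1%:R in h di D0.
have h' : e / 2 - 2 * o * s <= (D + o) * (t - s) by lra.
have os : 2 * o * s <= 2 * (cJ / (160 * 100)) * s by rewrite ler_wpM2r //; lra.
have h1 : cJ / (10 * 100) * s / 8 + e / 4 <= (D + o) * (t - s) by lra.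
have cs : 0 <= cJ / (10 * 100) * s by apply: mulr_ge0 => //; lra.
have ts : 0 <= t - s.
  rewrite leNgt; apply/negP => lt0.
  have D1 : 0 <= D + o by apply: addr_ge0.
  have H : (D + o) * (t - s) <= 0 by apply: mulr_ge0_le0 => //; apply: ltW.
  have s00 : s <= 0 by rewrite -(pmulr_rle0 _ c0); lra.
  lra.
have h2 : (D + o) * (t - s) <= 2 * nu * (t - s) by rewrite ler_wpM2r //; lra.
have h3 : cJ / (160 * 100) * e <= 1 / 8 * e by rewrite ler_wpM2r //; lra.
lra.
Qed.

End Near.

End Hall.

(** * Pushing a largest antichain towards the middle *)

Section HallFar.
Variables (R : realType) (p kap eps eta : R) (M n i : nat).
Notation V := {set 'I_n}.
Variables (X S : {set V}).
Notation nu := (n%:R : R).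
Hypothesis (P : params p kap eps eta M n).
Hypotheses (SX : S \subset X :&: layer n i.+1) (Snl : forall v, v \in S -> ~~ low X kap v).
Hypotheses (spB : sparse (badd p X eps) i.+1 M) (spBu : sparse (badu p X eps) i M).
Hypothesis (far : (4 * (n - i.+1) < n)%N).
Notation T := (shadow X S).

Lemma far_numeric (a s t e z1 z2 : R) :
  0 <= s -> 0 <= t -> 0 <= e -> 3 * nu <= 4 * (a + 1) ->
  kap * s <= t -> kap * (nu * z1) <= M%:R * t -> kap * (nu * z2) <= M%:R * t ->
  (p * (a + 1) - eps * nu) * s - nu * z2 + e <= (p * (nu - a) + eps * nu) * t + nu * z1 ->
  s <= t / 2.
Proof.
move=> s0 t0 e0 ha hs h1 h2 h.
have k0 := pr_kap0 P; have p0 := pr_pos P; have p1 := pr_p1 P; have ep := pr_eps0 P.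
have n400 := nu_ge P.
have m0 : 0 <= (M%:R : R) by [].
have z1' : nu * z1 <= M%:R / kap * t by rewrite mulrAC ler_pdivlMr // mulrC.
have z2' : nu * z2 <= M%:R / kap * t by rewrite mulrAC ler_pdivlMr // mulrC.
have s' : s <= 1 / kap * t by rewrite mulrAC mul1r ler_pdivlMr // mulrC.
have en : 0 <= eps * nu by apply: mulr_ge0; lra.
have es := ler_wpM2l en s'.
have f1 : eps * (1 + 1 / kap) * (nu * t) <= p / 16 * (nu * t).
  by apply: ler_wpM2r (pr_far P); apply: mulr_ge0; lra.
have f2 : (2 * M%:R / kap + 1) * t <= p / 16 * nu * t by apply: ler_wpM2r (pr_far2 P).
have pa : p * (3 * nu) * s <= p * (4 * (a + 1)) * s.
  by apply: ler_wpM2r => //; rewrite ler_pM2l.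
have pb : p * (4 * (nu - a)) * t <= p * (nu + 4) * t.
  by apply: ler_wpM2r => //; rewrite ler_pM2l //; lra.
have pt : p * t <= t by rewrite ler_piMl // ltW.
have key : p * nu * s <= p * nu * (t / 2).
  have e1 : 2 * M%:R / kap * t = M%:R / kap * t + M%:R / kap * t by ring.
  have e2 : eps * (1 + 1 / kap) * (nu * t) = eps * nu * t + eps * nu * (1 / kap * t) by ring.
  rewrite mulrDl e1 in f2; rewrite e2 in f1.
  move: z1' z2' es f1 f2; set x := M%:R / kap * t; set y := 1 / kap * t; lra.
by move: key; rewrite ler_pM2l // mulr_gt0 //; lra.
Qed.

(** Above three quarters of the cube lower degrees are about three times the upper ones, so counting
    edges with the degree bound [eps * nu] already gives a shadow twice as large as [S]; no
    smoothing is involved. *)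
Lemma hall_far : hall R X S M.
Proof.
have k0 := pr_kap0 P; have n400 := nu_ge P; have n0 : 0 < nu by lra.
have [S0|S0] := eqVneq S set0.
  split; first by rewrite S0 eqxx.
  move=> Z hZ _; have -> : Z = set0.
    apply/setP => z; rewrite inE; apply/negP => /hZ[v]; by rewrite S0 inE.
  have -> : T = set0.
    apply/setP => u; rewrite !inE; apply/negP => /andP[_ /existsP[v]]; by rewrite S0 inE.
  by rewrite S0 !cards0 mulr0 subrr.
have [v0 v0S] := set0Pn _ S0.
have il : (i.+1 <= n)%N by rewrite -(S_card SX v0S) card_leqn.
have ks : kap * #|S|%:R <= #|T|%:R.
  have : kap * nu * #|S|%:R <= nu * #|T|%:R.
    apply: (double_count (r := fun v u => adj u v)) => [v vS|u _].
      apply: (le_trans (shadow_dn Snl vS)); rewrite ler_nat; apply: subset_leq_card.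
      by apply/subsetP => u; rewrite in_setI in_dn inE => /andP[-> ->].
    rewrite ler_nat; apply: leq_trans (card_up_le u); apply: subset_leq_card.
    by apply/subsetP => v; rewrite in_up inE => /andP[].
  by rewrite (mulrC kap) -mulrA ler_pM2l.
have t0 : 0 < (#|T|%:R : R).
  apply: lt_le_trans ks; rewrite mulr_gt0 // ltr0n card_gt0 //.
have z1 : kap * (nu * #|[set u in T | badu p X eps u]|%:R) <= M%:R * #|T|%:R.
  rewrite mulrA; apply: (card_near_centers_far Snl) => [u|w].
    rewrite inE => /andP[uT _]; have [v vS uv] := shadow_ex uT; exists v => //.
    by rewrite (dist_adj uv).
  apply: (sparse_le (z := w) spBu) => u; rewrite inE => /andP[].
  by rewrite inE => /andP[uT b] d; rewrite b (shadow_card SX uT).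
have z2 : kap * (nu * #|[set v in S | badd p X eps v]|%:R) <= M%:R * #|T|%:R.
  rewrite mulrA; apply: (card_near_centers_far Snl) => [v|w].
    by rewrite inE => /andP[vS _]; exists v; rewrite ?dist0.
  apply: (sparse_le (z := w) spB) => v; rewrite inE => /andP[].
  by rewrite inE => /andP[vS b] d; rewrite b (S_card SX vS).
have sU : \sum_(u in T) (uX X u)%:R <= (p * (nu - i%:R) + eps * nu) * #|T|%:R + nu * #|[set u in T | badu p X eps u]|%:R.
  rewrite !(mulr_natr _ #|_|) -!sumr_const.
  rewrite [X in _ <= _ + X](_ : _ = \sum_(u in T) (if badu p X eps u then nu else 0)); last first.
    by rewrite -big_mkcondr; apply: eq_bigl => u; rewrite inE.
  rewrite -big_split /=; apply: ler_sum => u uT; have ui := shadow_card SX uT.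
  have e0 : 0 <= p * (nu - i%:R) + eps * nu.
    have : (i%:R : R) <= nu by rewrite ler_nat ltnW.
    have := pr_pos P; have := pr_eps0 P => ? ? ?.
    by apply: addr_ge0; apply: mulr_ge0; lra.
  case: ifP => [_|/negbT nb].
    have : ((uX X u)%:R : R) <= nu by apply: uX_le.
    by lra.
  move: nb; rewrite /badu -leNgt ui natrB ?(ltnW il) // ler_distl => /andP[_ h].
  by rewrite addr0.
have sD : (p * (i%:R + 1) - eps * nu) * #|S|%:R - nu * #|[set v in S | badd p X eps v]|%:R <= \sum_(v in S) (dX X v)%:R.
  rewrite lerBlDr !(mulr_natr _ #|_|) -!sumr_const.
  rewrite [X in _ <= _ + X](_ : _ = \sum_(u in S) (if badd p X eps u then nu else 0)); last first.
    by rewrite -big_mkcondr; apply: eq_bigl => u; rewrite inE.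
  rewrite -big_split /=; apply: ler_sum => v vS; have vi := S_card SX vS.
  have d0 : 0 <= ((dX X v)%:R : R) by [].
  case: ifP => [_|/negbT nb].
    have /andP[_ h] : 0 <= p * i.+1%:R <= nu by apply: (p_nat_le (pr_pos P) (ltW (pr_p1 P))).
    have : 0 <= eps * nu by rewrite mulr_ge0 // ltW // (pr_eps0 P).
    by move: h; rewrite -[i.+1%:R]natr1; lra.
  move: nb; rewrite /badd -leNgt vi ler_distl => /andP[h _].
  by move: h; rewrite -[i.+1%:R]natr1 addr0.
have id := congr1 (fun m => m%:R : R) (sum_degrees SX); rewrite natrD !natr_sum in id.
have st : #|S|%:R <= #|T|%:R / 2 :> R.
  apply: (far_numeric (a := i%:R) (e := #|boundary X S|%:R)) ks z1 z2 _ => //.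
    rewrite natr1 -!natrM ler_nat; move: far il; clear; lia.
  by move: sU sD id; set x := \sum_(u in T) _; set y := \sum_(v in S) _; lra.
split=> [_|Z hZ hM].
  by rewrite -(ltr_nat R); lra.
have := card_near_centers_far Snl hZ hM; rewrite natrM => h.
have K := pr_Kfar P; have kn : 0 < kap * nu by rewrite mulr_gt0.
have M3 : 0 <= (M%:R : R) + 3 by have : 0 <= (M%:R : R) by []; lra.
rewrite -(ler_pM2l kn).
have h1 := ler_wpM2l M3 h; have h2 := ler_wpM2r (ltW t0) K.
have kt : kap * nu * (#|T|%:R / 2) <= kap * nu * (#|T|%:R - #|S|%:R) by rewrite ler_pM2l //; lra.
apply: le_trans kt; move: h1 h2; set z := #|Z|%:R; set t := #|T|%:R; set w := kap * nu.
set m := (M%:R : R) => h1 h2.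
have mt : 0 <= (m + 3) * m * t by rewrite !mulr_ge0 //; exact: ltW.
lra.
Qed.

End HallFar.

(** * Exchange arguments in a largest antichain *)

Section Antichains.
Variable n : nat.
Notation V := {set 'I_n}.
Implicit Types (A B X Z D : {set V}) (u v w z : V).

Lemma antichainP A : reflect (forall u v, u \in A -> v \in A -> u \subset v -> u = v) (antichain A).
Proof.
apply: (iffP idP) => [h u v uA vA uv|h].
  by move/forall_inP: h => /(_ u uA)/forall_inP/(_ v vA)/implyP/(_ uv)/eqP.
apply/forall_inP => u uA; apply/forall_inP => v vA; apply/implyP => uv.
by apply/eqP; apply: h.
Qed.

Lemma largestP X A : largest_antichain X A ->
  [/\ A \subset X, antichain A & forall B, B \subset X -> antichain B -> (#|B| <= #|A|)%N].
Proof.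
case/and3P=> AX aA /forallP h; split=> // B BX aB.
by have := h B; rewrite BX aB.
Qed.

(* Elements of [Z] lie strictly below a removed element, so they are not in [A]
   and can only be comparable to a kept element from below. *)
Lemma replace_le X A D Z : largest_antichain X A -> D \subset A -> Z \subset X ->
    (forall z, z \in Z -> exists2 d, d \in D & (z \subset d) && (#|z| < #|d|)%N) ->
    (forall z z', z \in Z -> z' \in Z -> #|z| = #|z'|) ->
    (forall z a, z \in Z -> a \in A -> z \subset a -> a \in D) ->
  (#|Z| <= #|D|)%N.
Proof.
move=> /largestP[AX /antichainP aA maxA] DA ZX hZ cZ hD.
have notA z a : z \in Z -> a \in A -> a \subset z -> False.
  move=> /hZ[d dD /andP[zd lt]] aA' az.
  have e : a = d by apply: aA => //; [apply: (subsetP DA) | apply: subset_trans az zd].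
  by have := subset_leq_card az; rewrite e leqNgt lt.
have disj : (A :\: D) :&: Z = set0.
  apply/setP => z; rewrite !inE; apply/negP => /andP[/andP[_ zA] zZ].
  exact: notA zZ zA (subxx _).
have sX : (A :\: D) :|: Z \subset X.
  by rewrite subUset ZX andbT; apply: subset_trans AX; apply: subsetDl.
have aB : antichain ((A :\: D) :|: Z).
  apply/antichainP => u v; rewrite !inE => /orP[/andP[uD uA]|uZ] /orP[/andP[vD vA]|vZ] uv.
  - exact: aA.
  - by case: (notA _ _ vZ uA uv).
  - by have := hD _ _ uZ vA uv; rewrite (negPf vD).
  - by apply/eqP; rewrite eqEcard uv (cZ _ _ uZ vZ) leqnn.
have := maxA _ sX aB; rewrite cardsU disj cards0 subn0 -(cardsID D A) (setIidPr DA).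
by rewrite addnC leq_add2r.
Qed.

End Antichains.

Section Push.
Variables (R : realType) (kap : R) (M n i : nat).
Notation V := {set 'I_n}.
Variables (X A : {set V}).
Notation nu := (n%:R : R).
Hypotheses (lgA : largest_antichain X A) (M1 : (0 < M)%N).
Hypotheses (hMM : M%:R * (M%:R + 2) <= kap * nu).
Hypotheses (Aup : forall a, a \in A -> (#|a| <= i.+2)%N).
Hypotheses (Alow : forall a, a \in A -> #|a| = i.+2 -> low X kap a).
Hypotheses (spL1 : sparse (low X kap) i.+1 M) (spL2 : sparse (low X kap) i.+2 M).
Hypotheses (Mi : (M < i.+2)%N).
Implicit Types (u v w l : V).

Definition heavy : {set V} := [set v in A | (#|v| == i.+1) && ~~ low X kap v].
Hypothesis hallS : hall R X heavy M.
Notation S0 := heavy.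
Notation T0 := (shadow X S0).

(** A low set on level [i + 2] may have too few neighbours just below to be exchanged for them, so
    the exchange goes two levels down at once. [Z] is inserted; [L], [heavy] and the low sets [Lr]
    lying above the inserted ones are removed. *)
Let L : {set V} := [set a in A | #|a| == i.+2].
Let below l u := (#|u| == i) && (u \subset l).
Let Z : {set V} := T0 :|: [set u in X | [exists l in L, below l u]].
Let Lr : {set V} := [set v in A | [&& #|v| == i.+1, low X kap v & [exists u in Z, adj u v]]].

Lemma heavy_sub : S0 \subset X :&: layer n i.+1.
Proof.
have [AX _ _] := largestP lgA.
by apply/subsetP => v; rewrite !inE => /and3P[/(subsetP AX) -> ->].
Qed.

Lemma L_card l : l \in L -> #|l| = i.+2 /\ l \in A.
Proof. by rewrite inE => /andP[-> /eqP]. Qed.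

Lemma below_dist l u : l \in L -> below l u -> dist u l = 2%N.
Proof.
move=> /L_card[cl _] /andP[/eqP cu ul]; rewrite /dist !cardsD (setIidPl ul) (setIidPr ul).
by rewrite cl cu subnn; clear; lia.
Qed.

Lemma Z_card u : u \in Z -> #|u| = i.
Proof.
rewrite in_setU => /orP[/(shadow_card heavy_sub)//|].
by rewrite inE => /andP[_ /existsP[l /andP[_ /andP[/eqP]]]].
Qed.

Lemma card_Z_le : (#|Z| <= #|L| + #|S0| + #|Lr|)%N.
Proof.
have [AX aA _] := largestP lgA.
apply: leq_trans (_ : #|L :|: S0 :|: Lr| <= _)%N; last first.
  by apply: leq_trans (leq_card_setU _ _) _; rewrite leq_add2r leq_card_setU.
apply: (replace_le lgA).
- rewrite !subUset; apply/andP; split; first (apply/andP; split);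
  by apply/subsetP => v; rewrite inE => /andP[].
- by apply/subsetP => u; rewrite in_setU => /orP[/shadow_X//|]; rewrite inE => /andP[].
- move=> u uZ; have cu := Z_card uZ; move: uZ; rewrite in_setU => /orP[/shadow_ex[v vS uv]|].
    exists v; first by rewrite !in_setU vS orbT.
    by have /andP[-> _] := uv; rewrite (adj_card uv) leqnn.
  rewrite inE => /andP[_ /existsP[l /andP[lL /andP[_ ul]]]].
  exists l; first by rewrite !in_setU lL.
  by rewrite ul cu (proj1 (L_card lL)) ltnW.
- by move=> u v /Z_card -> /Z_card ->.
move=> u a uZ aA' ua; have cu := Z_card uZ.
have ia := subset_leq_card ua; have ai := Aup aA'; rewrite cu in ia.
have : [|| #|a| == i, #|a| == i.+1 | #|a| == i.+2].
  by move: ia ai; clear; move: #|a| => m; lia.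
case/or3P=> [/eqP ca|ca|ca].
- have e : u = a by apply/eqP; rewrite eqEcard ua cu ca leqnn.
  move: uZ; rewrite in_setU => /orP[/shadow_ex[v vS uv]|].
    have vA : v \in A by move: vS; rewrite inE => /andP[].
    have ev : a = v by apply: (elimT (antichainP A) aA) => //; have /andP[] := uv; rewrite e.
    by have := adj_card uv; rewrite -ev e => /eqP; rewrite -{1}[#|a|]addn0 -addn1 eqn_add2l.
  rewrite inE => /andP[_ /existsP[l /andP[lL /andP[_ ul]]]].
  have [cl lA] := L_card lL.
  have el : a = l by apply: (elimT (antichainP A) aA) => //; rewrite -e.
  by move: cl; rewrite -el ca => /eqP; rewrite -{1}[i]addn0 -addn2 eqn_add2l.
- case la: (low X kap a); last by rewrite !in_setU [a \in S0]inE aA' ca la orbT.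
  rewrite !in_setU; apply/orP; right; rewrite inE aA' ca la /=.
  by apply/existsP; exists u; rewrite uZ /adj ua cu ca.
- by rewrite !in_setU inE aA' ca.
Qed.

(** [L1] and [Lr1] are the removed low sets with nothing of [T0] below them. The remaining ones,
    [Cn], lie near [heavy] and are paid for by the surplus in [hall]. *)
Let L1 : {set V} := [set l in L | [forall u in T0, ~~ (u \subset l)]].
Let Ext : {set V} := [set u in X | [exists l in L1, below l u]].
Let Lr1 : {set V} := [set v in Lr | [forall u in T0, ~~ adj u v]].
Let Cn : {set V} := (L :\: L1) :|: (Lr :\: Lr1).

Lemma L_low l : l \in L -> low X kap l.
Proof. by case/L_card=> cl lA; apply: Alow. Qed.

Lemma Lr_low v : v \in Lr -> low X kap v /\ #|v| = i.+1.
Proof. by rewrite inE => /and4P[_ /eqP -> -> _]. Qed.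

(** Each [l] in [L1] has more than [M] lower neighbours, so one of them, in [X] or not, is not low
    and has [kap * nu] members of [X] below it. Such a member is under at most [M] low sets of level
    [i + 2]. *)
Lemma card_Ext : (M%:R + 2) * #|L1|%:R <= #|Ext|%:R :> R.
Proof.
have h : kap * nu * #|L1|%:R <= M%:R * #|Ext|%:R.
  apply: (double_count (r := below)) => [l lL1|u _].
    have /setIdP[lL _] := lL1; have [cl lA] := L_card lL.
    have [v vl nv] : exists2 v, adj v l & ~~ low X kap v.
      apply/exists_inP; apply: contraLR Mi; rewrite negb_exists => /forallP h.
      rewrite -leqNgt -cl -card_dn; apply: (sparse_le (z := l) spL1) => v; rewrite in_dn => vl.
      have := h v; rewrite vl /= negbK => ->; split=> //; last by rewrite (dist_adj vl).
      by have := adj_card vl; rewrite cl => -[].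
    have cv : #|v| = i.+1 by have := adj_card vl; rewrite cl => -[].
    move: nv; rewrite /low -leNgt => nv; apply: (le_trans nv); rewrite ler_nat.
    apply: subset_leq_card; apply/subsetP => u; rewrite in_setI in_dn => /andP[uv uX].
    have b : below l u.
      have := adj_card uv; rewrite cv => -[cu]; rewrite /below -cu eqxx /=.
      by have /andP[s1 _] := uv; have /andP[s2 _] := vl; apply: subset_trans s1 s2.
    rewrite inE b andbT inE uX /=; apply/existsP; exists l; rewrite b andbT.
    exact: lL1.
  rewrite ler_nat; apply: (sparse_le (z := u) spL2) => l; rewrite inE => /andP[].
  rewrite inE => /andP[lL _] b; rewrite (L_low lL) (proj1 (L_card lL)).
  by rewrite distC (below_dist lL b).
have M0 : 0 < (M%:R : R) by rewrite ltr0n.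
rewrite -(ler_pM2l M0) mulrA; apply: le_trans h; exact: ler_wpM2r.
Qed.

(** An element of [Lr1] is above an inserted set which is not in [T0], hence lies below some [l] in
    [L]; only [M] low sets are that close to [l]. *)
Lemma card_Lr1 : (#|Lr1| <= M * #|L|)%N.
Proof.
suff : 1 * (#|Lr1|%:R : R) <= M%:R * #|L|%:R by rewrite mul1r -natrM ler_nat.
apply: (double_count (r := fun v l => (dist v l <= 8)%N)) => [v|l lL].
  rewrite inE => /andP[vLr /forall_inP nT]; rewrite (ler_nat _ 1) card_gt0.
  move: vLr; rewrite inE => /and4P[_ _ _ /existsP[u /andP[uZ uv]]].
  move: uZ; rewrite in_setU => /orP[uT|]; first by have := nT u uT; rewrite uv.
  rewrite inE => /andP[_ /existsP[l /andP[lL b]]]; apply/set0Pn; exists l; rewrite inE lL /=.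
  by apply: leq_trans (dist_tri u _ _) _; rewrite (distC v) (dist_adj uv) (below_dist lL b).
rewrite ler_nat; apply: (sparse_le (z := l) spL1) => v; rewrite inE => /andP[].
by rewrite inE => /andP[/Lr_low[-> ->] _].
Qed.

Lemma Cn_near z : z \in Cn -> exists2 v, v \in S0 & (dist z v <= 4)%N.
Proof.
rewrite in_setU !in_setD => /orP[/andP[zL1 zL]|/andP[zL1 zL]].
  move: zL1; rewrite inE zL negb_forall => /existsP[u]; rewrite negb_imply negbK => /andP[uT uz].
  have [v vS uv] := shadow_ex uT; exists v => //.
  have b : below z u by rewrite /below (shadow_card heavy_sub uT) eqxx.
  by apply: leq_trans (dist_tri u _ _) _; rewrite (distC z) (below_dist zL b) (dist_adj uv).
move: zL1; rewrite inE zL negb_forall => /existsP[u]; rewrite negb_imply negbK => /andP[uT uz].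
have [v vS uv] := shadow_ex uT; exists v => //.
by apply: leq_trans (dist_tri u _ _) _; rewrite (distC z) (dist_adj uz) (dist_adj uv).
Qed.

Lemma Cn_mult w : (#|[set z in Cn | (dist z w <= 8)%N]| <= 2 * M)%N.
Proof.
rewrite mul2n -addnn.
apply: leq_trans (_ : _ <= #|[set z in L | (dist z w <= 8)%N]| + #|[set z in Lr | (dist z w <= 8)%N]|)%N _.
  apply: leq_trans (leq_card_setU _ _); apply: subset_leq_card; apply/subsetP => z /setIdP[zC dz].
  have /orP[/setDP[zL _]|/setDP[zL _]] : (z \in L :\: L1) || (z \in Lr :\: Lr1) by rewrite -in_setU.
    by rewrite in_setU; apply/orP; left; apply/setIdP.
  by rewrite in_setU; apply/orP; right; apply/setIdP.
apply: leq_add.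
  apply: (sparse_le (z := w) spL2) => z /setIdP[zL dz].
  by rewrite (L_low zL) (proj1 (L_card zL)).
by apply: (sparse_le (z := w) spL1) => z /setIdP[/Lr_low[-> ->] dz].
Qed.

(** Maximality gives [|T0| + |Ext| <= |L| + |S0| + |Lr|], hence
    [|L1| + |T0| <= |S0| + (M + 2) * |Cn|] by the two preceding counts. Since [hall] yields
    [|T0| >= |S0| + (M + 3) * |Cn|], strictly above [|S0|] unless [S0] is empty, all of [S0], [Cn]
    and [L1] are empty. *)
Lemma push_down a : a \in A -> (#|a| <= i.+1)%N /\ (#|a| = i.+1 -> low X kap a).
Proof.
have [hS hC] := hallS.
have hCn := hC Cn Cn_near Cn_mult.
have TE : (#|T0| + #|Ext| <= #|Z|)%N.
  have dj : T0 :&: Ext = set0.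
    apply/setP => u; rewrite in_set0 in_setI; apply/negP => /andP[uT].
    rewrite inE => /andP[_ /existsP[l /andP[lL1 /andP[_ ul]]]].
    by move: lL1; rewrite inE => /andP[_ /forall_inP/(_ u uT)]; rewrite ul.
  rewrite -cardsUI dj cards0 addn0; apply: subset_leq_card; apply: setUS.
  apply/subsetP => u; rewrite !inE => /andP[-> /existsP[l /andP[lL1 b]]] /=.
  by apply/existsP; exists l; rewrite b andbT; move: lL1; rewrite inE => /andP[].
have cL : (#|L| <= #|L1| + #|Cn|)%N.
  apply: leq_trans (leq_card_setU _ _); apply: subset_leq_card; apply/subsetP => l lL.
  by rewrite !in_setU in_setD lL; case: (l \in L1).
have cLr : (#|Lr| <= #|Lr1| + #|Cn|)%N.
  apply: leq_trans (leq_card_setU _ _); apply: subset_leq_card; apply/subsetP => l lL.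
  by rewrite !in_setU !in_setD lL; case: (l \in Lr1) => //=; rewrite orbT.
have h1 := card_Z_le; have h2 := card_Lr1; have h3 := card_Ext.
have tot : (#|T0| + #|Ext| <= (1 + M) * (#|L1| + #|Cn|) + #|S0| + #|Cn|)%N.
  have h4 : (M * #|L| <= M * (#|L1| + #|Cn|))%N by rewrite leq_mul2l cL orbT.
  move: TE h1 h2 cL cLr h4; clear; move: #|T0| #|Ext| #|Z| #|L| #|S0| #|Lr| #|L1| #|Cn| #|Lr1|; lia.
have [S00 Cn0 L10] : [/\ #|S0| = 0%N, #|Cn| = 0%N & #|L1| = 0%N].
  have key : (#|L1| + #|T0| <= #|S0| + (M + 2) * #|Cn|)%N.
    rewrite -(ler_nat R) !natrD !natrM !natrD.
    by move: tot h3; rewrite -(ler_nat R) !natrD !natrM !natrD; lra.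
  have hCn' : ((M + 3) * #|Cn| + #|S0| <= #|T0|)%N.
    by rewrite -(ler_nat R) !natrD !natrM !natrD; lra.
  have S0e : #|S0| = 0%N.
    apply/eqP; rewrite cards_eq0; apply: contraT => /hS lt.
    by move: key hCn' lt; clear; move: #|T0| #|S0| #|Cn| #|L1|; nia.
  have Cne : #|Cn| = 0%N.
    apply/eqP; rewrite cards_eq0; apply: contraT => /set0Pn[z /Cn_near[v]].
    by move/eqP: S0e; rewrite cards_eq0 => /eqP ->; rewrite inE.
  have T0e : #|T0| = 0%N.
    apply/eqP; rewrite cards_eq0; apply: contraT => /set0Pn[z /shadow_ex[v]].
    by move/eqP: S0e; rewrite cards_eq0 => /eqP ->; rewrite inE.
  split=> //; move: key; rewrite S0e Cne T0e; clear; lia.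
move=> aA.
have aL : #|a| != i.+2.
  apply/negP => ca; have : a \in L by rewrite inE aA.
  move: cL; rewrite Cn0 L10 leqn0 cards_eq0 => /eqP ->; by rewrite inE.
have ale : (#|a| <= i.+1)%N by rewrite -ltnS ltn_neqAle aL; apply: Aup.
split=> // ca; apply: contraT => nl.
have : a \in S0 by rewrite inE aA ca eqxx.
by move/eqP: S00; rewrite cards_eq0 => /eqP ->; rewrite inE.
Qed.

End Push.

(** Exchange [v] for its lower neighbours in [X]. A member of [A] above one of these is either on
    the top level, thus low and sharing a neighbour with [v], or equal to that neighbour and
    contained in [v]; both are impossible unless it is [v]. Two neighbours would make the antichain
    larger. *)
Lemma top_low_deg (R : realType) (kap : R) n k (X A : {set {set 'I_n}}) :
    largest_antichain X A -> (forall a, a \in A -> (#|a| <= k)%N) ->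
    (forall a, a \in A -> #|a| = k -> low X kap a) ->
    (forall u v w : {set 'I_n}, #|v| = k -> adj u v -> adj u w -> v != w -> ~~ (low X kap v && low X kap w)) ->
  forall v, v \in A -> #|v| = k -> (dX X v <= 1)%N.
Proof.
move=> lgA Ak Alow pair v vA cv; have [AX aA _] := largestP lgA.
rewrite -(cards1 v); apply: (replace_le lgA).
- by rewrite sub1set.
- exact: subsetIr.
- move=> u; rewrite in_setI in_dn => /andP[uv _]; exists v; rewrite ?set11 //.
  by have /andP[-> _] := uv; rewrite (adj_card uv) leqnn.
- move=> u u'; rewrite !in_setI !in_dn => /andP[/adj_card h _] /andP[/adj_card h' _].
  by apply: succn_inj; rewrite -h -h'.
move=> u a; rewrite in_setI in_dn => /andP[uv _] aA' ua; rewrite in_set1.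
have cu := adj_card uv; rewrite cv in cu.
have [ca|nca] := eqVneq #|a| k.
  apply: contraT => av; rewrite eq_sym in av.
  have ua' : adj u a by rewrite /adj ua ca cu eqxx.
  by have := pair u v a cv uv ua' av; rewrite !Alow.
have ea : u = a.
  apply/eqP; rewrite eqEcard ua /=; have := Ak a aA'.
  by rewrite leq_eqVlt (negPf nca) /= cu ltnS.
have : a = v by apply: (elimT (antichainP A) aA) => //; have /andP[] := uv; rewrite ea.
by move=> e; move: nca; rewrite e cv eqxx.
Qed.

(** * Duality and the deterministic theorem *)

Section Dual.
Variable n : nat.
Notation V := {set 'I_n}.
Implicit Types (X A : {set V}) (u v w : V).

Definition dual X : {set V} := [set v | ~: v \in X].

Lemma in_dual X v : (v \in dual X) = (~: v \in X). Proof. by rewrite inE. Qed.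

Lemma dualK X : dual (dual X) = X.
Proof. by apply/setP => v; rewrite !in_dual setCK. Qed.

Lemma dualE X : dual X = [set ~: v | v in X].
Proof.
apply/setP => v; rewrite in_dual; apply/idP/imsetP => [vX|[w wX ->]]; last by rewrite setCK.
by exists (~: v); rewrite ?setCK.
Qed.

Lemma card_dual X : #|dual X| = #|X|.
Proof. by rewrite dualE card_imset //; apply: (can_inj (@setCK _)). Qed.

Lemma card_setC v : #|~: v| = (n - #|v|)%N.
Proof. by rewrite cardsCs setCK card_ord. Qed.

Lemma antichain_dual A : antichain (dual A) = antichain A.
Proof.
suff h B : antichain B -> antichain (dual B).
  by apply/idP/idP => [/h|]; rewrite ?dualK //; apply: h.
move=> /antichainP hB; apply/antichainP => u v; rewrite !in_dual => uA vA uv.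
by apply: (can_inj (@setCK _)); apply/esym; apply: hB => //; rewrite setCS.
Qed.

Lemma dual_sub A X : (dual A \subset dual X) = (A \subset X).
Proof.
apply/subsetP/subsetP => h v; last by rewrite !in_dual; apply: h.
by move=> vA; have := h (~: v); rewrite !in_dual setCK; apply.
Qed.

Lemma largest_dual X A : largest_antichain X A -> largest_antichain (dual X) (dual A).
Proof.
move=> /largestP[AX aA maxA]; apply/and3P; split; rewrite ?dual_sub ?antichain_dual //.
apply/forallP => B; apply/implyP => /andP[BX aB]; rewrite card_dual -(card_dual B).
by apply: maxA; rewrite ?antichain_dual // -dual_sub dualK.
Qed.

Lemma dX_dual X v : dX (dual X) v = uX X (~: v).
Proof.
rewrite /dX /uX -(card_dual (up _ :&: _)); apply: eq_card => u.
by rewrite in_dual !in_setI in_dual in_up in_dn adjC.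
Qed.

Lemma uX_dual X v : uX (dual X) v = dX X (~: v).
Proof. by rewrite -{2}(dualK X) dX_dual setCK. Qed.

Lemma card_layer k : #|layer n k| = 'C(n, k).
Proof.
rewrite -[in RHS](card_ord n) -cardsT -cards_draws; apply: eq_card => v.
by rewrite !inE subsetT.
Qed.

Lemma card_dual_layer X k : (k <= n)%N -> #|dual X :&: layer n k| = #|X :&: layer n (n - k)|.
Proof.
move=> kn; rewrite -card_dual; apply: eq_card => v.
rewrite in_dual !in_setI in_dual setCK !inE card_setC; congr (_ && _).
by have := card_leqn v; move: kn; clear; move: #|v| => m kn le; apply/idP/idP; lia.
Qed.

End Dual.

Section Good.
Variables (R : realType) (p kap eps eta : R) (M n : nat).
Notation V := {set 'I_n}.
Notation nu := (n%:R : R).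

Definition good (X : {set V}) : Prop :=
  [/\ forall k, sparse (badd p X eps) k M, forall k, sparse (badu p X eps) k M,
      forall i, (n <= 4 * i)%N -> (n <= 4 * (n - i.+1))%N ->
        [/\ mixing p X (p ^+ 2 * kap ^+ 2 / 32) i, quiet_up p X eta i & quiet_dn p X eta i.+1]
    & forall u v w : V, (n < 2 * #|v|)%N -> adj u v -> adj u w -> v != w ->
        ~~ (low X kap v && low X kap w)].

Hypothesis P : params p kap eps eta M n.
Variables (X A : {set V}).
Hypotheses (gX : good X) (lgA : largest_antichain X A).

(** The invariant of the descent: low sets may survive on the top level [i + 1], and are dealt with
    one step later or by [top_low_deg] at the end. *)
Definition levels i := forall a, a \in A -> (#|a| <= i.+1)%N /\ (#|a| = i.+1 -> low X kap a).

Lemma sparse_low_level k : (n <= 4 * k)%N -> sparse (low X kap) k M.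
Proof.
move=> nk; have [h _ _ _] := gX; apply: sparse_sub (h k) => v cv; rewrite /low /badd cv => lv.
have p0 := pr_pos P; have ke := pr_ke P; have n0 := nu_ge P.
have nk' : nu <= 4 * k%:R by rewrite -natrM ler_nat.
have h1 : p * nu <= p * (4 * k%:R) by rewrite ler_pM2l.
have h2 : (kap + eps) * nu <= p / 4 * nu by apply: ler_wpM2r.
rewrite distrC; apply: lt_le_trans (ler_norm _); lra.
Qed.

Lemma M_lt i : (n <= 2 * i.+1)%N -> (M < i.+2)%N.
Proof.
move=> ni; have c := pr_C P; have k0 := pr_kap0 P; have ke := pr_ke P.
have e0 := pr_eps0 P; have p1 := pr_p1 P; have n0 := nu_ge P.
have : kap ^+ 2 * nu <= 1 * nu.
  by apply: ler_wpM2r => //; rewrite expr_le1 // ltW //; lra.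
move=> h; have : 4 * M%:R <= nu by have : 0 <= (M%:R : R) by []; lra.
by rewrite -natrM ler_nat; move: ni; clear; lia.
Qed.

Lemma levels_step i : (n <= 2 * i.+1)%N -> levels i.+1 -> hall R X (heavy kap i X A) M -> levels i.
Proof.
move=> ni hl hh.
have n1 : (n <= 4 * i.+1)%N by move: ni; clear; lia.
have n2 : (n <= 4 * i.+2)%N by move: ni; clear; lia.
exact: (push_down lgA (pr_M1 P) (pr_MM P) (fun b bA => proj1 (hl b bA)) (fun b bA => proj2 (hl b bA))
  (sparse_low_level n1) (sparse_low_level n2) (M_lt ni) hh).
Qed.

Lemma heavy_nl i v : v \in heavy kap i X A -> ~~ low X kap v.
Proof. by rewrite inE => /and3P[]. Qed.

(** Descent from level [n], where the claim is vacuous, with [m] bounding the number of levels still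
    above. [hall] comes from the drift on central levels and from plain counting on the far ones. *)
Lemma levels_upper i : (n <= 2 * i)%N -> levels i.
Proof.
have base k : (n <= k)%N -> levels k.
  move=> nk a _; have := card_leqn a => an.
  have lt : (#|a| <= k)%N by apply: leq_trans nk.
  by split; [apply: leqW | move=> e; move: lt; rewrite e ltnn].
move=> ni; have [m hm] : exists m, (n <= i + m)%N by exists n; apply: leq_addl.
elim: m i ni hm => [|m IHm] i ni hm; first by apply: base; rewrite addn0 in hm.
apply: levels_step; first by move: ni; clear; lia.
  by apply: IHm; [move: ni; clear; lia | rewrite addSnnS].
have [sb su hn _] := gX.
have [dim2|far] := leqP n (4 * (n - i.+1)).
  have dim1 : (n <= 4 * i)%N by move: ni; clear; lia.
  have [mix qu qd] := hn i dim1 dim2.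
  exact: (hall_slack P (heavy_sub kap i lgA) (@heavy_nl i) (sb _) (su _)).
exact: (hall_far P (heavy_sub kap i lgA) (@heavy_nl i) (sb _) (su _)).
Qed.

Lemma levels_deg i : (n < 2 * i.+1)%N -> levels i ->
  forall a, a \in A -> (#|a| <= i.+1)%N /\ (#|a| = i.+1 -> (dX X a <= 1)%N).
Proof.
move=> ni hl a aA; have [h1 h2] := hl a aA; split=> // ca.
have [_ _ _ hp] := gX.
have pair (u v w : V) : #|v| = i.+1 -> adj u v -> adj u w -> v != w -> ~~ (low X kap v && low X kap w).
  by move=> cv; apply: hp; rewrite cv.
exact: (top_low_deg lgA (fun b bA => proj1 (hl b bA)) (fun b bA => proj2 (hl b bA)) pair aA ca).
Qed.

End Good.

(** * Sizes of antichains near one layer *)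

Section NearLayer.
Variable n : nat.
Notation V := {set 'I_n}.
Implicit Types (X A : {set V}) (u v w : V).

Lemma card_lower_nbrs X v : #|lower_nbrs X v| = dX X v.
Proof. by apply: eq_card => u; rewrite !inE andbC eq_sym. Qed.

Lemma card_upper_nbrs X v : #|upper_nbrs X v| = uX X v.
Proof. by apply: eq_card => u; rewrite !inE andbC. Qed.

Definition isoD X k : {set V} := [set v in X | (#|v| == k.+1) && (dX X v == 0%N)].
Definition isoU X k : {set V} := [set v in X | (#|v|.+1 == k) && (uX X v == 0%N)].
Definition near_value X k : nat := (#|X :&: layer n k| + #|isoD X k| + #|isoU X k|)%N.

Lemma near_layerI X A k : A \subset X -> (k == n./2) || (k == uphalf n) ->
    (forall a, a \in A -> (#|a| <= k.+1)%N /\ (#|a| = k.+1 -> (dX X a <= 1)%N)) ->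
    (forall a, a \in A -> (k <= #|a|.+1)%N /\ (#|a|.+1 = k -> (uX X a <= 1)%N)) ->
  near_layer X k A.
Proof.
move=> AX hk hu hd; apply/forall_inP => v vA; have vX := subsetP AX v vA.
have [u1 u2] := hu v vA; have [d1 d2] := hd v vA.
rewrite in_setI vX inE /=.
have hh : (n./2 <= uphalf n)%N by rewrite uphalf_half leq_addl.
have hh' : (uphalf n <= n./2.+1)%N by rewrite uphalf_half; case: (odd n).
have kb : (n./2 <= k <= uphalf n)%N by case/orP: hk => /eqP ->; rewrite ?leqnn ?hh.
have : [|| #|v| == k, #|v| == k.+1 | #|v|.+1 == k].
  by move: u1 d1; clear; move: #|v| => m; lia.
case/or3P=> [->//|/eqP e|/eqP e]; apply/orP; right.
  rewrite e eqxx orbT andbT /nearly_isolated vX /= card_lower_nbrs u2 // e andbT.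
  by apply/orP; left; move: kb hh hh'; clear; lia.
rewrite e eqxx andbT /nearly_isolated vX /= card_upper_nbrs d2 // andbT.
by apply/orP; right; move: kb hh hh' e; clear; move: #|v| => m; lia.
Qed.

(* Nearly isolated sets with exactly one neighbour trade one for one with it, so
   only the isolated ones contribute to the size. *)
Lemma near_layer_size X A k : odd n -> (k == n./2) || (k == uphalf n) ->
    largest_antichain X A -> near_layer X k A ->
    (forall u v w, #|v| = k.+1 -> adj u v -> adj u w -> v != w -> ~~ ((dX X v <= 1) && (dX X w <= 1))%N) ->
    (forall u v w, #|u| = k -> adj v u -> adj w u -> v != w -> ~~ ((uX X v <= 1) && (uX X w <= 1))%N) ->
    (forall v w, #|w|.+1 = k -> #|v| = k.+1 -> w \subset v -> ~~ ((dX X v == 0%N) && (uX X w == 0%N))) ->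
  #|A| = near_value X k.
Proof.
move=> on hk lgA nA pD pU pC; have [AX /antichainP aA maxA] := largestP lgA.
have uh : uphalf n = n./2.+1 by rewrite uphalf_half on.
have kb : (n./2 <= k <= n./2.+1)%N by case/orP: hk => /eqP ->; rewrite ?uh ?leqnn ?leqnSn.
have nAP v : v \in A -> [\/ #|v| = k, #|v| = k.+1 /\ (dX X v <= 1)%N | #|v|.+1 = k /\ (uX X v <= 1)%N].
  move=> vA; move/forall_inP: nA => /(_ v vA); rewrite in_setI inE => /orP[/andP[_ /eqP]|]; first by constructor 1.
  rewrite /nearly_isolated card_lower_nbrs card_upper_nbrs uh => /andP[/andP[_ h] /orP[/eqP e|/eqP e]].
    constructor 3; split=> //; case/orP: h => /andP[h1 h2] //.
    by move: kb h1 e; clear; move: #|v| => m; lia.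
  constructor 2; split=> //; case/orP: h => /andP[h1 h2] //.
  by move: kb h1; rewrite e; clear; lia.
apply/eqP; rewrite eqn_leq; apply/andP; split.
  pose C0 := [set v in A | (#|v| != k) && ((v \in isoD X k) || (v \in isoU X k))].
  pose C1 := [set v in A | (#|v| != k) && ~~ ((v \in isoD X k) || (v \in isoU X k))].
  have cA : (#|A| <= #|A :&: layer n k| + #|C0| + #|C1|)%N.
    apply: leq_trans (_ : #|A :&: layer n k :|: C0 :|: C1| <= _)%N.
      apply: subset_leq_card; apply/subsetP => v vA; rewrite !in_setU in_setI vA [v \in layer _ _]inE /=.
      case ck: (#|v| == k) => //=; case iso: ((v \in isoD X k) || (v \in isoU X k)).
        by apply/orP; left; apply/setIdP; rewrite ck iso.
      by apply/orP; right; apply/setIdP; rewrite ck iso.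
    by apply: leq_trans (leq_card_setU _ _) _; rewrite leq_add2r leq_card_setU.
  have c0 : (#|C0| <= #|isoD X k| + #|isoU X k|)%N.
    apply: leq_trans (leq_card_setU _ _); apply: subset_leq_card; apply/subsetP => v.
    by case/setIdP=> _ /andP[_]; rewrite in_setU.
  (* Each set of [C1] goes to its only neighbour in layer [k] of [X]; the default [v] never occurs
     there. The images are new elements of the layer because they are comparable to members of
     [A]. *)
  pose f v := if #|v| == k.+1 then odflt v [pick u in dn v :&: X] else odflt v [pick u in up v :&: X].
  have C1P v : v \in C1 -> v \in A /\ ((#|v| = k.+1 /\ dX X v = 1%N) \/ (#|v|.+1 = k /\ uX X v = 1%N)).
    case/setIdP=> vA /andP[nk]; rewrite negb_or !inE (subsetP AX v vA) /= => /andP[n1 n2]; split=> //.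
    have [e|[e le]|[e le]] := nAP v vA; first by rewrite e eqxx in nk.
      by left; split=> //; move: n1 le; rewrite e eqxx /=; case: (dX X v) => [|[]].
    by right; split=> //; move: n2 le; rewrite e eqxx /=; case: (uX X v) => [|[]].
  have fP v : v \in C1 -> f v \in X /\ ((#|v| = k.+1 /\ adj (f v) v) \/ (#|v|.+1 = k /\ adj v (f v))).
    move=> /C1P[vA [[e d1]|[e d1]]]; rewrite /f.
      rewrite e eqxx; case: pickP => [u|h0]; first by rewrite in_setI in_dn => /andP[uv uX] /=; split=> //; left.
      by move: d1; rewrite /dX (eq_card h0) card0.
    have -> : (#|v| == k.+1) = false by rewrite -e; clear; move: #|v| => m; lia.
    case: pickP => [u|h0]; first by rewrite in_setI in_up => /andP[uv uX] /=; split=> //; right.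
    by move: d1; rewrite /uX (eq_card h0) card0.
  have c1 : (#|A :&: layer n k| + #|C1| <= #|X :&: layer n k|)%N.
    have finj : {in C1 &, injective f}.
      move=> v w vC wC fvw; have [vA vd] := C1P v vC; have [wA wd] := C1P w wC.
      have [_ vf] := fP v vC; have [_ wf] := fP w wC; apply/eqP; apply: contraT => vw.
      case: vf wf vd wd; rewrite fvw => -[cv av] [] [cw aw].
      - move=> [[_ dv]|[e _]]; last by move: e; rewrite cv; clear; lia.
        move=> [[_ dw]|[e _]]; last by move: e; rewrite cw; clear; lia.
        by have := pD _ _ _ cv av aw vw; rewrite dv dw.
      - move=> _ _; have s : w \subset v by have /andP[s1 _] := aw; have /andP[s2 _] := av; apply: subset_trans s1 s2.
        by have e := aA _ _ wA vA s; rewrite e eqxx in vw.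
      - move=> _ _; have s : v \subset w by have /andP[s1 _] := av; have /andP[s2 _] := aw; apply: subset_trans s1 s2.
        by have e := aA _ _ vA wA s; rewrite e eqxx in vw.
      move=> [[e _]|[_ dv]]; first by move: cv; rewrite e; clear; lia.
      move=> [[e _]|[_ dw]]; first by move: cw; rewrite e; clear; lia.
      have cf : #|f w| = k by rewrite (adj_card aw).
      by have := pU _ _ _ cf av aw vw; rewrite dv dw.
    rewrite -(card_in_imset finj).
    have dj : (A :&: layer n k) :&: [set f v | v in C1] = set0.
      apply/setP => u; rewrite in_set0 in_setI; apply/negP => /andP[]; rewrite in_setI => /andP[uA _] /imsetP[v vC e].
      have [vA _] := C1P v vC; have [_ [[cv av]|[cv av]]] := fP v vC; rewrite -e in av.
        have /andP[s c] := av; have ee := aA _ _ uA vA s.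
        by move: c; rewrite ee; clear; move: #|v| => m; lia.
      have /andP[s c] := av; have ee := aA _ _ vA uA s.
      by move: c; rewrite -ee; clear; move: #|v| => m; lia.
    rewrite -cardsUI dj cards0 addn0; apply: subset_leq_card; apply/subsetP => u; rewrite in_setU => /orP[].
      by rewrite !in_setI => /andP[/(subsetP AX) -> ->].
    case/imsetP=> v vC ->; have [fX [[cv av]|[cv av]]] := fP v vC; rewrite in_setI fX inE /=.
      by have := adj_card av; rewrite cv => -[<-].
    by rewrite (adj_card av) cv.
  move: cA c0 c1; rewrite /near_value; clear; move: #|A| #|A :&: _| #|C0| #|C1| #|isoD _ _| #|isoU _ _| #|X :&: _|; lia.
pose B := (X :&: layer n k) :|: isoD X k :|: isoU X k.
have BP v : v \in B -> v \in X /\ [\/ #|v| = k, #|v| = k.+1 /\ dX X v = 0%N | #|v|.+1 = k /\ uX X v = 0%N].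
  rewrite !in_setU => /orP[/orP[|]|].
  - by rewrite in_setI inE => /andP[-> /eqP]; split=> //; constructor 1.
  - by rewrite inE => /and3P[-> /eqP ? /eqP ?]; split=> //; constructor 2.
  - by rewrite inE => /and3P[-> /eqP ? /eqP ?]; split=> //; constructor 3.
have cB : near_value X k = #|B|.
  have d1 : (X :&: layer n k) :&: isoD X k = set0.
    apply/setP => v; rewrite !inE; apply/negP => /andP[/andP[_ /eqP e]] /and3P[_ /eqP e' _].
    by move: e'; rewrite e; clear; lia.
  have d2 : ((X :&: layer n k) :|: isoD X k) :&: isoU X k = set0.
    apply/setP => v; rewrite !inE; apply/negP => /andP[/orP[/andP[_ /eqP e]|/and3P[_ /eqP e _]]] /and3P[_ /eqP e' _];
    by move: e'; rewrite e; clear; lia.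
  by rewrite /near_value /B [in RHS]cardsU d2 cards0 subn0 cardsU d1 cards0 subn0.
rewrite cB; apply: maxA; first by apply/subsetP => v /BP[].
have noD u v : u \in X -> adj u v -> dX X v = 0%N -> False.
  by move=> uX uv /eqP; rewrite cards_eq0 => /eqP/setP/(_ u); rewrite in_setI in_dn uv uX inE.
have noU u v : v \in X -> adj u v -> uX X u = 0%N -> False.
  by move=> vX uv /eqP; rewrite cards_eq0 => /eqP/setP/(_ v); rewrite in_setI in_up uv vX inE.
apply/antichainP => u v /BP[uX uB] /BP[vX vB] uv; have le := subset_leq_card uv.
have eqc : #|u| = #|v| -> u = v by move=> e; apply/eqP; rewrite eqEcard uv e leqnn.
case: uB vB => [cu|[cu du]|[cu du]] [cv|[cv dv]|[cv dv]].
- by apply: eqc; rewrite cu.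
- by case: (noD u v) => //; rewrite /adj uv cu cv eqxx.
- by move: le cu cv; clear; move: #|u| #|v|; lia.
- by move: le; rewrite cu cv; clear; lia.
- by apply: eqc; rewrite cu.
- by move: le cv; rewrite cu; clear; move: #|v|; lia.
- by case: (noU u v) => //; rewrite /adj uv cu cv eqxx.
- by have := pC v u cu cv uv; rewrite dv du.
by apply: eqc; move: cu cv; clear; move: #|u| #|v|; lia.
Qed.

End NearLayer.

(** * The conclusion for a regular family *)

Section Deterministic.
Variables (R : realType) (p kap eps eta : R) (M n : nat).
Notation V := {set 'I_n}.
Notation nu := (n%:R : R).
Notation good := (good p kap eps eta M (n := n)).
Hypothesis P : params p kap eps eta M n.
Variable X : {set V}.
Hypotheses (gX : good X) (gX' : good (dual X)).

Lemma good_dn A i : largest_antichain X A -> levels kap (dual X) (dual A) i -> (n < 2 * i.+1)%N ->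
  forall a, a \in A -> (n <= #|a| + i.+1)%N /\ ((#|a| + i.+1)%N = n -> (uX X a <= 1)%N).
Proof.
move=> /largest_dual lgA' hl ni a aA.
have aA' : ~: a \in dual A by rewrite in_dual setCK.
have [h1 h2] := levels_deg gX' lgA' ni hl aA'; move: h1 h2; rewrite dX_dual setCK card_setC.
have := card_leqn a; move: (uX X a <= 1)%N #|a|; clear => b c mn h1 h2.
by split; [lia | move=> e; apply: h2; lia].
Qed.

Lemma near_even k : n = (2 * k)%N -> largest_antichains_near_middle X.
Proof.
move=> nk; apply/hasP; exists n./2; first by rewrite mem_head.
have hk : n./2 = k by rewrite nk mul2n doubleK.
rewrite hk; apply/forallP => A; apply/implyP => lgA.
have [AX _ _] := largestP lgA.
have n1 : (n <= 2 * k)%N by rewrite nk.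
have n2 : (n < 2 * k.+1)%N by rewrite nk; clear; lia.
have lX := levels_upper P gX lgA n1.
have lX' := levels_upper P gX' (largest_dual lgA) n1.
apply: near_layerI => //; first by rewrite hk eqxx.
- exact: (levels_deg gX lgA n2 lX).
- move=> a aA; have [h1 h2] := good_dn lgA lX' n2 aA.
  move: nk h1 h2; move: (uX X a <= 1)%N #|a|; clear => b c nk h1 h2.
  by split; [lia | move=> e; apply: h2; lia].
Qed.

Section Odd.
Variable m : nat.
Hypothesis nm : n = (2 * m).+1.
Notation N := (#|layer n m.+1|%:R : R).
Hypotheses (lo0 : 99 / 100 * (p * N) <= #|X :&: layer n m|%:R)
  (lo1 : 99 / 100 * (p * N) <= #|X :&: layer n m.+1|%:R)
  (hi0 : #|X :&: layer n m|%:R <= 101 / 100 * (p * N)).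
Hypothesis cpair : forall v w : V, (n < 2 * #|v|)%N -> (2 * #|w| < n)%N -> #|v| = #|w|.+2 ->
  w \subset v -> ~~ ((dX X v == 0%N) && (uX X w == 0%N)).

Lemma half_n : n./2 = m. Proof. by rewrite nm mul2n -[_.+1]add1n halfD /= odd_double add0n doubleK. Qed.

Lemma uphalf_n : uphalf n = m.+1. Proof. by rewrite uphalf_half half_n nm /= mul2n odd_double. Qed.

Lemma odd_dims : [/\ (n <= 4 * m)%N, (n <= 4 * (n - m.+1))%N & (n < 2 * m.+1)%N].
Proof. by have := pr_n P; move: nm; clear => nm h; split; lia. Qed.

(** If [A] has more than [55 / 100 * p * N] heavy sets on level [m + 1], their shadow takes at least
    [99 / 100] as many sets of layer [m]. Of the at most [101 / 100 * p * N] members of [X] there,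
    fewer than [55 / 100 * p * N] are left for the heavy sets of the dual side, which can then be
    pushed up instead. *)
Lemma near_odd_or A : largest_antichain X A -> near_layer X m A \/ near_layer X m.+1 A.
Proof.
move=> lgA; have [AX aA _] := largestP lgA; have lgA' := largest_dual lgA.
have [dim1 dim2 n2] := odd_dims.
have n1 : (n <= 2 * m.+1)%N by apply: ltnW.
have n3 : (n < 2 * m.+2)%N by move: nm; clear; lia.
have lX := levels_upper P gX lgA n1.
have lX' := levels_upper P gX' lgA' n1.
have [sb su hn _] := gX; have [mix qu qd] := hn m dim1 dim2.
have [sb' su' hn' _] := gX'; have [mix' qu' qd'] := hn' m dim1 dim2.
pose S0 := heavy kap m X A; pose U0 := heavy kap m (dual X) (dual A).
have p0 := pr_pos P.
have [small|big] := lerP (#|S0|%:R : R) (55 / 100 * (p * N)).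
  left; have hh := hall_mid P (heavy_sub kap m lgA) (@heavy_nl _ _ _ _ _ _) (sb _) (su _) dim1 dim2 mix qu qd nm small lo1.
  have l0 := levels_step P gX lgA n1 lX hh.
  apply: near_layerI => //; first by rewrite half_n eqxx.
    exact: (levels_deg gX lgA n2 l0).
  move=> a aA'; have [h1 h2] := good_dn lgA lX' n3 aA'.
  move: nm h1 h2; move: (uX X a <= 1)%N #|a|; clear => b c nm h1 h2.
  by split; [lia | move=> e; apply: h2; lia].
right.
have w := mid_weak P (heavy_sub kap m lgA) (@heavy_nl _ _ _ _ _ _) (sb _) (su _) dim1 dim2 mix qu qd nm.
have TU : #|shadow X S0|%:R + #|U0|%:R <= (#|X :&: layer n m|%:R : R).
  rewrite -natrD ler_nat -(card_dual U0).
  have dj : shadow X S0 :&: dual U0 = set0.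
    apply/setP => u; rewrite in_set0 in_setI in_dual; apply/negP => /andP[/shadow_ex[v vS uv]].
    rewrite inE in_dual setCK => /andP[uA _].
    have vA : v \in A by move: vS; rewrite inE => /andP[].
    have /andP[s c] := uv; have e := elimT (antichainP A) aA _ _ uA vA s.
    by move: c; rewrite e; clear; move: #|v|; lia.
  rewrite -cardsUI dj cards0 addn0; apply: subset_leq_card; apply/subsetP => u.
  rewrite in_setU in_setI => /orP[uT|].
    by rewrite (shadow_X uT) inE (shadow_card (heavy_sub kap m lgA) uT) /=.
  rewrite in_dual inE in_dual setCK => /and3P[uA /eqP cu _]; rewrite (subsetP AX _ uA) inE /=.
  by move: cu; rewrite card_setC; have := card_leqn u; move: nm #|u|; clear => nm c; lia.
have small' : (#|U0|%:R : R) <= 55 / 100 * (p * N).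
  have pN : 0 <= p * N by apply: mulr_ge0 => //; apply: ltW.
  move: w TU hi0 big; rewrite -/S0; set t := #|shadow X S0|%:R; set s := #|S0|%:R; lra.
have lo' : 99 / 100 * (p * N) <= #|dual X :&: layer n m.+1|%:R.
  rewrite card_dual_layer; last by move: nm; clear; lia.
  by have -> : (n - m.+1 = m)%N by move: nm; clear; lia.
have hh := hall_mid P (heavy_sub kap m lgA') (@heavy_nl _ _ _ _ _ _) (sb' _) (su' _) dim1 dim2 mix' qu' qd' nm small' lo'.
have l0 := levels_step P gX' lgA' n1 lX' hh.
apply: near_layerI => //; first by rewrite uphalf_n eqxx orbT.
  exact: (levels_deg gX lgA n3 lX).
move=> a aA'; have [h1 h2] := good_dn lgA l0 n2 aA'.
move: nm h1 h2; move: (uX X a <= 1)%N #|a|; clear => b c nm h1 h2.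
by split; [lia | move=> e; apply: h2; lia].
Qed.

Lemma low_of_deg1 (Y : {set V}) v : (dX Y v <= 1)%N -> low Y kap v.
Proof.
move=> h; rewrite /low; have := pr_knu P; have : ((dX Y v)%:R : R) <= 1 by rewrite (ler_nat _ _ 1).
by lra.
Qed.

Lemma near_size_odd A k : (k == m) || (k == m.+1) -> largest_antichain X A -> near_layer X k A ->
  #|A| = near_value X k.
Proof.
move=> hk lgA nA; apply: near_layer_size => //.
- by rewrite nm /= mul2n odd_double.
- by rewrite half_n uphalf_n.
- move=> u v w cv uv uw vw; have [_ _ _ hp] := gX.
  have nv : (n < 2 * #|v|)%N by rewrite cv; move: hk nm; clear; lia.
  apply: contra (hp u v w nv uv uw vw) => /andP[h1 h2].
  by rewrite !low_of_deg1.
- move=> u v w cu vu wu vw; have [_ _ _ hp] := gX'.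
  have cv := adj_card vu; have vn := card_leqn v.
  have nv : (n < 2 * #|~: v|)%N.
    by rewrite card_setC; move: hk cu cv nm; move: #|u| #|v|; clear; lia.
  have vw' : ~: v != ~: w by rewrite (inj_eq (can_inj (@setCK _))).
  have := hp (~: u) (~: v) (~: w) nv; rewrite !adjC => /(_ vu wu vw').
  by apply: contra => /andP[h1 h2]; rewrite !low_of_deg1 // dX_dual setCK.
move=> v w cw cv wv; apply: cpair => //.
- by rewrite cv; move: hk nm; clear; lia.
- by move: hk cw nm; move: #|w|; clear; lia.
- by rewrite cv -cw.
Qed.

(** If no single layer served all largest antichains, one of them would be near [m + 1] and another
    near [m]. Having equal size, they would force the two near values to coincide. *)
Lemma near_odd : near_value X m != near_value X m.+1 -> largest_antichains_near_middle X.
Proof.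
move=> tie; rewrite /largest_antichains_near_middle half_n uphalf_n /= orbF.
apply: contraR tie; rewrite negb_or => /andP[/forallPn[A]] + /forallPn[B].
rewrite !negb_imply => /andP[lA nA] /andP[lB nB].
have [_ _ mA] := largestP lA; have [AX aA _] := largestP lA.
have [_ _ mB] := largestP lB; have [BX aB _] := largestP lB.
have nA' : near_layer X m.+1 A by case: (near_odd_or lA) => // h; rewrite h in nA.
have nB' : near_layer X m B by case: (near_odd_or lB) => // h; rewrite h in nB.
rewrite -(near_size_odd _ lB nB') ?eqxx // -(near_size_odd _ lA nA') ?eqxx ?orbT //.
by rewrite eqn_leq mA ?mB.
Qed.

End Odd.

End Deterministic.

(** * Probability of the exceptional events *)

Section Events.
Variables (R : realType) (p : R) (n : nat).
Hypotheses (p_ge0 : 0 <= p) (p_le1 : p <= 1).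
Notation V := {set 'I_n}.
Notation nu := (n%:R : R).
Implicit Types (X : {set V}) (u v w z : V).

Lemma Pr_dual (E : pred {set V}) : Pr p (fun X => E (dual X)) = Pr p E.
Proof.
rewrite /Pr (reindex_inj (can_inj (@dualK n))) /=; apply: eq_big => X; first by rewrite dualK.
move=> _; rewrite /mass card_dual; congr (_ * _ ^+ _).
rewrite -[in RHS]card_dual; apply: eq_card => v.
by rewrite in_dual !inE.
Qed.

Lemma card_V : #|{: V}| = (2 ^ n)%N.
Proof. by rewrite -cardsT -powersetT card_powerset cardsT card_ord. Qed.

Lemma sum_adj_centered X v :
  \sum_u (adj u v)%:R * ((u \in X)%:R - p) = (dX X v)%:R - p * #|v|%:R.
Proof.
have -> : (dX X v)%:R = \sum_(u in dn v) (u \in X)%:R :> R.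
  rewrite -natr_sum; congr (_%:R); rewrite /dX -sum1_card big_mkcond [RHS]big_mkcond.
  by apply: eq_bigr => u _; rewrite in_setI; case: (u \in dn v); case: (u \in X).
have -> : p * #|v|%:R = \sum_(u in dn v) p by rewrite sumr_const card_dn mulr_natr.
rewrite -sumrB [RHS]big_mkcond; apply: eq_bigr => u _; rewrite in_dn.
by case: (adj u v); rewrite ?mul1r ?mul0r.
Qed.

(** Two distinct vertices share at most one lower neighbour, so the squared coefficients add up to
    at most [|Q| * (n + |Q|)], hence to [2 * |Q| * n]: the deviations behave as if independent. *)
Lemma linear_deviation (Q Ps : {set V}) (eps : R) : (0 < n)%N -> (0 < #|Q|)%N -> (#|Q| <= n)%N -> 0 <= eps ->
  Pr p (fun X => #|Q|%:R * (eps * nu) <=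
     \sum_(v in Q) (if v \in Ps then 1 else -1) * ((dX X v)%:R - p * #|v|%:R))
  <= expR (- (#|Q|%:R * eps ^+ 2 / 16 * nu)).
Proof.
move=> n0 q0 qn e0; set r := #|Q|%:R.
pose s v : R := if v \in Ps then 1 else -1.
pose c (X : {set V}) u : R := \sum_(v in Q) s v * (adj u v)%:R.
have sumE X : \sum_(v in Q) s v * ((dX X v)%:R - p * #|v|%:R) = \sum_(u in setT) c X u * ((u \in X)%:R - p).
  under eq_bigr do rewrite -sum_adj_centered mulr_sumr.
  rewrite exchange_big /= [RHS]big_mkcond; apply: eq_bigr => u _; rewrite in_setT /c mulr_suml.
  by apply: eq_bigr => v _; rewrite mulrA.
have common v w : v != w -> \sum_u ((adj u v)%:R * (adj u w)%:R : R) <= 1.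
  move=> vw; rewrite (bigD1 (v :&: w)) //= big1 ?addr0.
    by rewrite -natrM (ler_nat _ _ 1); case: (adj _ v); case: (adj _ w).
  move=> u uvw; case uv: (adj u v); rewrite ?mul0r //; case uw: (adj u w); rewrite ?mulr0 //.
  by rewrite (adj_meet uv uw vw) eqxx in uvw.
have cB X : \sum_(u in setT) c X u ^+ 2 <= 2 * r * nu.
  have le1 u : c X u ^+ 2 <= \sum_(v in Q) \sum_(w in Q) (adj u v)%:R * (adj u w)%:R.
    rewrite expr2 /c mulr_suml; apply: ler_sum => v _; rewrite mulr_sumr; apply: ler_sum => w _.
    by rewrite /s; case: ifP => _; case: ifP => _; case: (adj u v); case: (adj u w); rewrite ?mulr0 ?mul0r ?mulr1 ?mulrN1 ?opprK //; lra.
  apply: (@le_trans _ _ (\sum_(v in Q) \sum_(w in Q) \sum_u (adj u v)%:R * (adj u w)%:R)).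
    rewrite big_mkcond /=; under [leRHS]eq_bigr => v _ do rewrite exchange_big /=.
    rewrite [leRHS]exchange_big /=; apply: ler_sum => u _; rewrite in_setT; exact: le1.
  have h v : v \in Q -> \sum_(w in Q) \sum_u ((adj u v)%:R * (adj u w)%:R : R) <= nu + r.
    move=> vQ; rewrite (bigD1 v) //=; apply: lerD.
      apply: (@le_trans _ _ (\sum_u (adj u v)%:R)).
        by apply: ler_sum => u _; case: (adj u v); rewrite ?mulr1 ?mulr0.
      have -> : \sum_u ((adj u v)%:R : R) = #|dn v|%:R.
        by rewrite -sum1_card natr_sum [RHS]big_mkcond; apply: eq_bigr => u _; rewrite in_dn; case: (adj u v).
      by rewrite ler_nat card_dn_le.
    apply: (@le_trans _ _ (\sum_(w in Q | w != v) 1)).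
      by apply: ler_sum => w /andP[_ wv]; apply: common; rewrite eq_sym.
    rewrite sumr_const ler_nat; apply: subset_leq_card.
    by apply/subsetP => w; rewrite unfold_in => /andP[].
  apply: le_trans (ler_sum _ h) _; rewrite sumr_const -mulr_natl -/r.
  have : r <= nu by rewrite ler_nat.
  have : 0 <= r by []. nra.
have r0 : 0 < r by rewrite ltr0n.
have nu0 : 0 < nu by rewrite ltr0n.
have B0 : 0 < 2 * r * nu by rewrite !mulr_gt0.
have t0 : 0 <= r * (eps * nu) by rewrite !mulr_ge0 // ltW.
apply: le_trans (_ : Pr p (fun X => r * (eps * nu) <= \sum_(u in setT) c X u * ((u \in X)%:R - p)) <= _).
  by apply: le_Pr => // X; rewrite -sumE.
have := hoeffding p_ge0 p_le1 (fun X Y (_ : X :\: setT = Y :\: setT) => fun u => erefl (c X u)) cB B0 t0.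
move/le_trans; apply; rewrite ler_expR le_eqVlt; apply/orP; left; apply/eqP.
by field; rewrite !gt_eqF.
Qed.

Lemma ffact_le_expn m k : (m ^_ k <= m ^ k)%N.
Proof. by elim: k => // k IH; rewrite ffactnSr expnSr leq_mul // leq_subr. Qed.

(** Union bound over the level, the centre, the [M + 1] bad vertices, and the signs of their
    deviations; fixing the signs turns simultaneous large deviations into one linear form. *)
Lemma Pr_not_sparse (eps : R) (M : nat) : (M < n)%N -> 0 <= eps ->
  Pr p (fun X => ~~ [forall k : 'I_n.+1, sparse (badd p X eps) k M]) <=
  (n.+1 * 2 ^ n)%:R * ((n.+1 ^ (8 * M.+1))%:R * ((2 ^ M.+1)%:R * expR (- (M.+1%:R * eps ^+ 2 / 16 * nu)))).
Proof.
move=> Mn e0; have n0 : (0 < n)%N by apply: leq_ltn_trans Mn.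
set c3 := expR _; have c30 : 0 <= c3 by apply: expR_ge0.
pose E1 (kz : 'I_n.+1 * V) X := (M < #|[set v in ball kz.2 8 | (#|v| == kz.1) && badd p X eps v]|)%N.
have -> : (n.+1 * 2 ^ n)%N = #|{: 'I_n.+1 * V}| by rewrite card_prod card_ord card_V.
apply: (Pr_union p_ge0 p_le1 (E := E1)) => [X|[k z] _].
  by rewrite negb_forall => /existsP[k]; rewrite negb_forall => /existsP[z]; rewrite -ltnNge => h; exists (k, z).
pose AQ := [pred Q : {set V} | (Q \subset ball z 8) && (#|Q| == M.+1)].
pose E2 (Q : {set V}) X := [forall v in Q, badd p X eps v].
apply: (@le_trans _ _ (#|AQ|%:R * ((2 ^ M.+1)%:R * c3))).
  apply: (Pr_union p_ge0 p_le1 (E := E2)) => [X|Q /andP[_ /eqP cQ]].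
    rewrite /E1 /= => h; set B := [set v in _ | _] in h.
    have [Q QB cQ] : exists2 Q : {set V}, Q \subset B & #|Q| == M.+1.
      have : (0 < #|[set Q : {set V} | Q \subset B & #|Q| == M.+1]|)%N by rewrite cards_draws bin_gt0.
      by case/card_gt0P=> Q; rewrite inE => /andP[]; exists Q.
    exists Q.
      rewrite /= cQ andbT; apply: subset_trans QB _; apply/subsetP => v; by rewrite inE => /andP[].
    by apply/forall_inP => v /(subsetP QB); rewrite inE => /and3P[].
  pose E3 (Ps : {set V}) X := #|Q|%:R * (eps * nu) <=
     \sum_(v in Q) (if v \in Ps then 1 else -1) * ((dX X v)%:R - p * #|v|%:R).
  have -> : (2 ^ M.+1)%N = #|[pred Ps : {set V} | Ps \subset Q]|.
    rewrite -cQ -card_powerset; by apply: eq_card => Ps; rewrite !inE.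
  apply: (Pr_union p_ge0 p_le1 (E := E3)) => [X /forall_inP hQ|Ps _].
    exists [set v in Q | 0 <= (dX X v)%:R - p * #|v|%:R :> R].
      by apply/subsetP => v; rewrite inE => /andP[].
    rewrite /E3 mulr_natl -sumr_const; apply: ler_sum => v vQ; rewrite inE vQ /=.
    have := hQ v vQ; rewrite /badd => /ltW h; apply: (le_trans h).
    case: ifP => h0; first by rewrite mul1r ger0_norm.
    by rewrite mulN1r ltr0_norm // ltNge h0.
  rewrite /E3; apply: le_trans (linear_deviation Ps n0 _ _ e0) _; rewrite ?cQ //.
apply: ler_wpM2r; first by rewrite mulr_ge0.
rewrite ler_nat; have -> : #|AQ| = 'C(#|ball z 8|, M.+1).
  by rewrite -cards_draws; apply: eq_card => Q; rewrite !inE.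
apply: leq_trans (_ : #|ball z 8| ^ M.+1 <= _)%N; last by rewrite expnM leq_exp2r // card_ball.
by rewrite -(leq_pmul2r (fact_gt0 M.+1)) bin_ffact; apply: leq_trans (leq_pmulr _ (fact_gt0 _)); apply: ffact_le_expn.
Qed.

Lemma hoeffding_family (J : finType) (D : {pred J}) (f : J -> V) (W : {set V}) (d : {set V} -> J -> R) (t : R) :
    {in D &, injective f} -> (forall j, j \in D -> f j \in W) ->
    (forall X Y, X :\: W = Y :\: W -> d X =1 d Y) -> (forall X j, `|d X j| <= 1) ->
    (0 < #|D|)%N -> 0 <= t ->
  Pr p (fun X => t <= \sum_(j in D) d X j * ((f j \in X)%:R - p)) <= expR (- (t ^+ 2 / (8 * #|D|%:R))).
Proof.
move=> finj fW dW d1 D0 t0.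
pose c X w : R := \sum_(j in D | f j == w) d X j.
have sumE X : \sum_(j in D) d X j * ((f j \in X)%:R - p) = \sum_(w in W) c X w * ((w \in X)%:R - p).
  rewrite (partition_big f (mem W)) //=; apply: eq_bigr => w wW; rewrite /c mulr_suml.
  by apply: eq_bigr => j /andP[_ /eqP ->].
have cB X : \sum_(w in W) c X w ^+ 2 <= #|D|%:R.
  rewrite -sum1_card natr_sum (partition_big f (mem W)) //=; apply: ler_sum => w wW.
  have [/existsP[j /andP[jD /eqP fj]]|] := boolP [exists j, (j \in D) && (f j == w)]; last first.
    rewrite negb_exists => /forallP h; rewrite /c !big_pred0 ?expr0n // => j; exact: negbTE (h j).
  have uj j' : (j' \in D) && (f j' == w) = (j' == j).
    apply/andP/eqP => [[j'D /eqP fj']|->]; last by rewrite jD fj.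
    by apply: finj => //; rewrite fj fj'.
  rewrite /c (eq_bigl _ _ uj) [leRHS](eq_bigl _ _ uj) !big_pred1_eq.
  by rewrite -real_normK ?num_real // expr_le1.
have D0' : 0 < (#|D|%:R : R) by rewrite ltr0n.
have hc X Y : X :\: W = Y :\: W -> c X =1 c Y.
  by move=> h w; rewrite /c; apply: eq_bigr => j _; rewrite (dW _ _ h).
have := hoeffding p_ge0 p_le1 hc cB D0' t0; apply: le_trans.
by apply: le_Pr => // X; rewrite sumE.
Qed.

(** A product of two indicators is centred in two stages, each allowed a loss of [g / 2 * nu ^+ 2]:
    [Ea] exposes the upper level with the lower one frozen, [Eb] treats the lower ends. The exponent
    of order [n ^ 2] beats all choices of [u], [y], [A], [B]. *)
Lemma Pr_not_mixing (g : R) : (0 < n)%N -> 0 < g ->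
  Pr p (fun X => ~~ [forall i : 'I_n.+1, mixing p X g i]) <=
  (2 ^ n * n * 2 ^ n * 2 ^ n)%:R * (2 * expR (- ((g / 2) ^+ 2 / 8 * nu ^+ 2))).
Proof.
move=> n0 g0; have nu0 : 0 < nu by rewrite ltr0n.
pose ok (a : V * 'I_n * V * V) := [&& a.1.1.2 \notin a.1.1.1, a.1.2 \subset ~: (a.1.1.2 |: a.1.1.1) & a.2 \subset a.1.1.1].
pose bp (a : V * 'I_n * V * V) (zx : 'I_n * 'I_n) := (zx.1 |: a.1.1.1) :\ zx.2.
pose ap (a : V * 'I_n * V * V) (zx : 'I_n * 'I_n) := a.1.1.2 |: bp a zx.
pose D (a : V * 'I_n * V * V) := [pred zx : 'I_n * 'I_n | (zx.1 \in a.1.2) && (zx.2 \in a.2)].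
pose t := g / 2 * nu ^+ 2.
pose Ea a X := ok a && (t <= \sum_(j in D a) - (bp a j \in X)%:R * ((ap a j \in X)%:R - p)).
pose Eb a X := ok a && (t <= \sum_(j in D a) - 1 * ((bp a j \in X)%:R - p)).
have cI : (2 ^ n * n * 2 ^ n * 2 ^ n)%N = #|{: V * 'I_n * V * V}| by rewrite !card_prod card_ord card_V.
have t0 : 0 < t by rewrite mulr_gt0 ?divr_gt0 ?exprn_gt0.
have cD a : #|D a| = (#|a.1.2| * #|a.2|)%N.
  by rewrite -cardsX; apply: eq_card => -[z x]; rewrite !inE.
have binj a : ok a -> {in D a &, injective (bp a)}.
  case: a => [[[u y] A] B] /and3P[/= yu /subsetP sA /subsetP sB] [z x] [z' x']; rewrite !inE /bp /= => /andP[zA xB] /andP[zA' xB'] e.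
  have zu a : a \in A -> a \notin u by move/sA; rewrite !inE negb_or => /andP[].
  have xz : z != x by apply: contraTneq (sB _ xB) => <-; apply: zu.
  have xz' : z' != x' by apply: contraTneq (sB _ xB') => <-; apply: zu.
  have ez : z = z'.
    have := congr1 (fun s : V => z \in s) e; rewrite !inE eqxx (negPf (zu _ zA)) !orbF xz /=.
    by move/esym/andP=> [_ /eqP].
  have := congr1 (fun s : V => x \in s) e; rewrite !inE eqxx (sB _ xB) !orbT !andbT /=.
  by rewrite ez; case: (x =P x') => [->|].
have bcard a j : ok a -> j \in D a -> #|bp a j| = #|a.1.1.1| /\ #|ap a j| = #|a.1.1.1|.+1.
  case: a j => [[[u y] A] B] [z x] /and3P[/= yu /subsetP sA /subsetP sB]; rewrite !inE /ap /bp /= => /andP[zA xB].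
  have := sA z zA; rewrite !inE negb_or => /andP[zy zu]; have xu := sB x xB.
  have cb : #|(z |: u) :\ x| = #|u|.
    by have := cardsD1 x (z |: u); rewrite cardsU1 zu !inE xu orbT !add1n => -[].
  rewrite cb; split=> //; rewrite cardsU1 cb !inE (negPf yu) orbF (eq_sym y z) (negPf zy) andbF //.
have ainj a : ok a -> {in D a &, injective (ap a)}.
  move=> oka j j' jD j'D e; apply: (binj a oka j j' jD j'D).
  have ynb k : k \in D a -> a.1.1.2 \notin bp a k.
    move=> kD; have [c1 c2] := bcard a k oka kD; move: c2; rewrite /ap cardsU1 c1.
    by case: (_ \in bp a k) => //= h; exfalso; move: h; clear; lia.
  by rewrite -(setU1K (ynb j jD)) -(setU1K (ynb j' j'D)); congr (_ :\ _).
have cDle a : (#|D a|%:R : R) <= nu ^+ 2.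
  by rewrite cD -natrX ler_nat -mulnn leq_mul ?card_leqn.
have ebound a : (0 < #|D a|)%N -> expR (- (t ^+ 2 / (8 * #|D a|%:R))) <= expR (- ((g / 2) ^+ 2 / 8 * nu ^+ 2)).
  move=> D0; rewrite ler_expR lerN2 /t ler_pdivlMr ?mulr_gt0 ?ltr0n //.
  have := cDle a; have : 0 <= (g / 2) ^+ 2 * nu ^+ 2 by rewrite mulr_ge0 ?sqr_ge0.
  set d := #|D a|%:R; set x := (g / 2) ^+ 2 => h1 h2.
  have := ler_wpM2l h1 h2.
  have -> : x / 8 * nu ^+ 2 * (8 * d) = x * nu ^+ 2 * d by field.
  by have -> : (g / 2 * nu ^+ 2) ^+ 2 = x * nu ^+ 2 * nu ^+ 2 by rewrite /x; ring.
have Pa a : Pr p (Ea a) <= expR (- ((g / 2) ^+ 2 / 8 * nu ^+ 2)).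
  have [oka|noka] := boolP (ok a); last first.
    by rewrite /Pr big_pred0 ?expR_ge0 // => X; rewrite /Ea (negPf noka).
  have [D0|D0] := posnP #|D a|.
    rewrite /Pr big_pred0 ?expR_ge0 // => X; rewrite /Ea oka /= (eq_bigl _ _ (card0_eq D0)) big_pred0_eq.
    by apply/negbTE; rewrite -ltNge.
  apply: le_trans (ebound a D0).
  pose W := [set w : V | #|w| == #|a.1.1.1|.+1].
  pose d (X : {set V}) j : R := if j \in D a then - (bp a j \in X)%:R else 0.
  have le : Pr p (Ea a) <= Pr p (fun X => t <= \sum_(j in D a) d X j * ((ap a j \in X)%:R - p)).
    apply: le_Pr => // X /andP[_ h]; apply: (le_trans h); rewrite le_eqVlt; apply/orP; left; apply/eqP.
    by apply: eq_bigr => j jD; rewrite /d jD.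
  apply: (le_trans le); apply: (@hoeffding_family _ _ _ W) => // [|j jD|X Y XY j|X j|].
  - exact: ainj.
  - by rewrite inE (bcard a j oka jD).2.
  - rewrite /d; case: ifP => // jD; congr (- (nat_of_bool _)%:R).
    have [c1 _] := bcard a j oka jD.
    have nW : bp a j \notin W by rewrite inE c1 neq_ltn ltnSn.
    by have := congr1 (fun s : {set V} => bp a j \in s) XY; rewrite !in_setD nW.
  - by rewrite /d; case: ifP => _; rewrite ?normr0 // normrN; case: (_ \in X); rewrite ?normr0 ?normr1.
  - exact: ltW.
have Pb a : Pr p (Eb a) <= expR (- ((g / 2) ^+ 2 / 8 * nu ^+ 2)).
  have [oka|noka] := boolP (ok a); last first.
    by rewrite /Pr big_pred0 ?expR_ge0 // => X; rewrite /Eb (negPf noka).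
  have [D0|D0] := posnP #|D a|.
    rewrite /Pr big_pred0 ?expR_ge0 // => X; rewrite /Eb oka /= (eq_bigl _ _ (card0_eq D0)) big_pred0_eq.
    by apply/negbTE; rewrite -ltNge.
  apply: le_trans (ebound a D0).
  have le : Pr p (Eb a) <= Pr p (fun X => t <= \sum_(j in D a) - 1 * ((bp a j \in X)%:R - p)).
    by apply: le_Pr => // X /andP[].
  apply: (le_trans le); apply: (@hoeffding_family _ _ _ setT (fun _ _ => - 1)) => // [|j jD|X j|].
  - exact: binj.
  - by rewrite in_setT.
  - by rewrite normrN normr1.
  - exact: ltW.
rewrite cI; apply: (Pr_union p_ge0 p_le1 (E := fun a => predU (Ea a) (Eb a))) => [X|a _]; last first.
  by apply: le_trans (PrU p_ge0 p_le1 _ _) _; rewrite mulr2n mulrDl !mul1r lerD.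
rewrite negb_forall => /existsP[i]; rewrite negb_forall => /existsP[u]; rewrite negb_forall => /existsP[y].
rewrite negb_forall => /existsP[A]; rewrite negb_forall => /existsP[B].
rewrite negb_imply -ltNge => /andP[/and4P[_ yu sA sB]].
set a : V * 'I_n * V * V := (u, y, A, B); set C := #|_| => lt.
have oka : ok a by rewrite /ok /= yu sA sB.
exists a => //; rewrite /= /Ea /Eb oka /=; apply: contraTT lt; rewrite negb_or -!ltNge => /andP[ha hb].
have cC : (C%:R : R) = \sum_(j in D a) (bp a j \in X)%:R * (ap a j \in X)%:R.
  rewrite /C -sum1_card natr_sum big_mkcond [RHS]big_mkcond; apply: eq_bigr => -[z x] _.
  rewrite !inE /= /ap /bp /=; case: (z \in A); case: (x \in B) => //=.
  by case: (_ \in X); case: (_ \in X); rewrite ?mulr1 ?mulr0 ?mul0r.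
have sa : \sum_(j in D a) - (bp a j \in X)%:R * ((ap a j \in X)%:R - p) = p * (\sum_(j in D a) (bp a j \in X)%:R) - C%:R.
  by rewrite cC mulr_sumr -sumrB; apply: eq_bigr => j _; ring.
have sb : \sum_(j in D a) - 1 * ((bp a j \in X)%:R - p) = p * #|D a|%:R - \sum_(j in D a) (bp a j \in X)%:R.
  rewrite mulr_natr -sumr_const -sumrB; apply: eq_bigr => j _; ring.
move: ha hb; rewrite sa sb cD natrM /t /=; set x := \sum_(j in D a) _; set y0 := #|A|%:R; set z0 := #|B|%:R => ha hb.
rewrite -leNgt; have hp := ler_wpM2l p_ge0 (ltW hb).
have g2 : p * (g / 2 * nu ^+ 2) <= g / 2 * nu ^+ 2 by rewrite ler_piMl // mulr_ge0 ?sqr_ge0 // divr_ge0 // ltW.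
rewrite expr2; lra.
Qed.

End Events.

Section MoreEvents.
Variables (R : realType) (p : R) (n : nat).
Hypotheses (p_ge0 : 0 <= p) (p_le1 : p <= 1).
Notation V := {set 'I_n}.
Notation nu := (n%:R : R).
Implicit Types (X : {set V}) (u v w z : V).

Lemma sum_up_centered X u :
  \sum_v (adj u v)%:R * ((v \in X)%:R - p) = (uX X u)%:R - p * (n - #|u|)%:R.
Proof.
have := sum_adj_centered p (dual X) (~: u); rewrite dX_dual setCK card_setC => <-.
rewrite [RHS](reindex_inj (can_inj (@setCK 'I_n))) /=; apply: eq_bigr => v _.
by rewrite in_dual setCK adjC.
Qed.

(** With level [i] frozen the sum is a linear form on level [i + 1]. A coefficient counts lower
    neighbours, so it is at most [n] in absolute value; their total is at most [n * N2], whence the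
    bound [nu ^+ 2 * N2] for the squares and an exponent of order [n ^ 2]. *)
Lemma Pr_not_quiet_up (h : R) (i : nat) : (0 < n)%N -> 0 < h -> (n ^ 4 <= 64 * 64 * sph2_size n i)%N ->
  Pr p (fun X => ~~ quiet_up p X h i) <= (2 ^ n * 2)%:R * expR (- (h ^+ 2 / (8 * (64 * 64)) * nu ^+ 2)).
Proof.
move=> n0 h0 hN; set N2 := sph2_size n i in hN *.
have nu0 : 0 < nu by rewrite ltr0n.
have N20 : (0 < N2)%N.
  by rewrite lt0n; apply: contraTneq hN => ->; rewrite muln0 leqn0 expn_eq0 negb_and -lt0n n0.
have N20' : 0 < (N2%:R : R) by rewrite ltr0n.
pose sg (b : bool) : R := if b then 1 else -1.
pose W := [set v : V | #|v| == i.+1].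
pose c (ub : V * bool) X v : R := sg ub.2 * \sum_(w in X | sph 2 ub.1 w) (adj w v)%:R.
pose E (ub : V * bool) X := (#|ub.1| == i) && (h * N2%:R <= \sum_(v in W) c ub X v * ((v \in X)%:R - p)).
have sumE u b X : #|u| = i -> \sum_(v in W) c (u, b) X v * ((v \in X)%:R - p) =
    sg b * \sum_(w in X | sph 2 u w) ((uX X w)%:R - p * (n - i)%:R).
  move=> cu; rewrite big_mkcond mulr_sumr.
  have -> : \sum_(w in X | sph 2 u w) sg b * ((uX X w)%:R - p * (n - i)%:R) =
      \sum_(w in X | sph 2 u w) \sum_v sg b * (adj w v)%:R * ((v \in X)%:R - p).
    apply: eq_bigr => w /andP[_ /andP[/eqP cw _]]; rewrite -cu cw -sum_up_centered mulr_sumr.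
    by apply: eq_bigr => v _; rewrite mulrA.
  rewrite exchange_big /=; apply: eq_bigr => v _; case: ifP => [_|vW].
    by rewrite /c /= mulr_sumr mulr_suml.
  rewrite big1 // => w /andP[_ /andP[/eqP cw _]]; case wv: (adj w v); last by rewrite mulr0 mul0r.
  by move: vW; rewrite inE (adj_card wv) -cw cu eqxx.
have cI : (2 ^ n * 2)%N = #|{: V * bool}| by rewrite card_prod card_bool card_V.
rewrite cI; apply: (Pr_union p_ge0 p_le1 (E := E)) => [X|[u b] _].
  rewrite negb_forall => /existsP[u]; rewrite negb_imply -ltNge => /andP[/eqP cu lt].
  set s := \sum_(w in X | _) _ in lt.
  exists (u, 0 <= s) => //; rewrite /E /= cu eqxx /= sumE // -/s /sg; apply: ltW.
  case: ifP => h1; first by rewrite mul1r -(ger0_norm h1).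
  by rewrite mulN1r -ltr0_norm // ltNge h1.
have [cu|ncu] := eqVneq #|u| i; last first.
  by rewrite /Pr big_pred0 ?expR_ge0 // => X; rewrite /E /= (negPf ncu).
have B0 : 0 < nu ^+ 2 * N2%:R by rewrite mulr_gt0 ?exprn_gt0.
have t0 : 0 <= h * N2%:R by rewrite mulr_ge0 // ltW.
have hc X Y : X :\: W = Y :\: W -> c (u, b) X =1 c (u, b) Y.
  move=> XY v; rewrite /c; congr (_ * _); apply: eq_bigl => w /=; case sw: (sph 2 u w); rewrite ?andbF // !andbT.
  have nW : w \notin W by rewrite inE; case/andP: sw => /eqP <- _; rewrite cu neq_ltn ltnSn.
  by have := congr1 (fun s : {set V} => w \in s) XY; rewrite !in_setD nW.
have cB X : \sum_(v in W) c (u, b) X v ^+ 2 <= nu ^+ 2 * N2%:R.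
  have c1 v : c (u, b) X v ^+ 2 <= nu * \sum_(w | sph 2 u w) (adj w v)%:R.
    rewrite /c exprMn /= (_ : sg b ^+ 2 = 1) ?mul1r; last by rewrite /sg; case: (b); rewrite ?sqrrN expr1n.
    set y := \sum_(w in X | _) _; set z := \sum_(w | _) _.
    have y0 : 0 <= y by apply: sumr_ge0 => w _; apply: ler0n.
    have yz : y <= z.
      rewrite /y /z [leLHS]big_mkcondl /=; apply: ler_sum => w _; by case: ifP => // _; apply: ler0n.
    have zn : z <= nu.
      apply: (@le_trans _ _ (\sum_w (adj w v)%:R)).
        rewrite /z [leLHS]big_mkcond; apply: ler_sum => w _; by case: ifP => // _; apply: ler0n.
      have -> : \sum_w ((adj w v)%:R : R) = #|dn v|%:R.
        by rewrite -sum1_card natr_sum [RHS]big_mkcond; apply: eq_bigr => w _; rewrite in_dn; case: (adj w v).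
      by rewrite ler_nat card_dn_le.
    by rewrite expr2; apply: ler_pM => //; apply: le_trans yz zn.
  apply: (@le_trans _ _ (\sum_v nu * \sum_(w | sph 2 u w) (adj w v)%:R)).
    rewrite [leLHS]big_mkcond; apply: ler_sum => v _; case: ifP => // _.
    by apply: mulr_ge0; [apply: ltW | apply: sumr_ge0 => w _; apply: ler0n].
  rewrite -mulr_sumr exchange_big /= expr2 -mulrA ler_pM2l //.
  have -> : (N2%:R : R) = \sum_(w | sph 2 u w) 1.
    by rewrite sumr_const; congr (_%:R); rewrite /N2 /sph2_size -cu -card_sph cardsE.
  rewrite mulr_sumr; apply: ler_sum => w _; rewrite mulr1.
  have -> : \sum_v ((adj w v)%:R : R) = #|up w|%:R.
    by rewrite -sum1_card natr_sum [RHS]big_mkcond; apply: eq_bigr => v _; rewrite in_up; case: (adj w v).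
  by rewrite ler_nat card_up_le.
apply: le_trans (_ : Pr p (fun X => h * N2%:R <= \sum_(v in W) c (u, b) X v * ((v \in X)%:R - p)) <= _).
  by apply: le_Pr => // X /andP[].
apply: le_trans (hoeffding p_ge0 p_le1 hc cB B0 t0) _.
rewrite ler_expR lerN2.
have -> : (h * N2%:R) ^+ 2 / (8 * (nu ^+ 2 * N2%:R)) = h ^+ 2 / (8 * (64 * 64)) * (64 * 64 * N2%:R / nu ^+ 2).
  by field; rewrite !gt_eqF.
apply: ler_wpM2l; first by apply: divr_ge0; [apply: sqr_ge0 | lra].
rewrite ler_pdivlMr ?exprn_gt0 // -exprD -natrX -natrM -natrM ler_nat.
exact: hN.
Qed.

Definition low_twins (kap : R) X := [exists u : V, exists x, exists y,
  [&& x \notin u, y \notin u, x != y, (n < 2 * #|u|.+1)%N, low X kap (x |: u) & low X kap (y |: u)]].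

(** The lower neighbourhoods of the two sets overlap only in [u], so their union has at least [n]
    elements, of which at most [t] are in [X]. *)
Lemma Pr_low_twins (kap x0 : R) (t : nat) : 0 < x0 <= 1 -> 2 * (kap * nu) <= t.+1%:R ->
  Pr p (low_twins kap) <= (2 ^ n * n * n)%:R * (x0 ^- t * (1 - p + p * x0) ^+ n).
Proof.
move=> x01 tk; have /andP[x00 x0l] := x01.
pose E (a : V * 'I_n * 'I_n) X := [&& a.1.2 \notin a.1.1, a.2 \notin a.1.1, a.1.2 != a.2, (n < 2 * #|a.1.1|.+1)%N,
   low X kap (a.1.2 |: a.1.1) & low X kap (a.2 |: a.1.1)].
have cI : (2 ^ n * n * n)%N = #|{: V * 'I_n * 'I_n}| by rewrite !card_prod card_ord card_V.
rewrite cI; apply: (Pr_union p_ge0 p_le1 (E := E)) => [X /existsP[u /existsP[x /existsP[y h]]]|[[u x] y] _].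
  by exists (u, x, y).
have y0 : 0 <= 1 - p + p * x0 by rewrite addr_ge0 ?subr_ge0 // mulr_ge0 // ltW.
have y1 : 1 - p + p * x0 <= 1 by have := ler_wpM2l p_ge0 x0l; lra.
have [/and4P[xu yu xy nu2]|no] := boolP [&& x \notin u, y \notin u, x != y & (n < 2 * #|u|.+1)%N]; last first.
  rewrite /Pr big_pred0 => [|X]; first by rewrite mulr_ge0 ?invr_ge0 ?exprn_ge0 // ltW.
  by apply: contraNF no => /and5P[/= -> -> -> -> _].
set v := x |: u; set w := y |: u; pose W := dn v :|: dn w.
have uv : adj u v by apply: adj_add. have uw : adj u w by apply: adj_add.
have vw : v != w.
  apply/eqP => e; have := congr1 (fun s : V => x \in s) e; by rewrite !inE eqxx (negPf xy) (negPf xu).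
have cW : (n <= #|W|)%N.
  have cI1 : (#|dn v :&: dn w| <= 1)%N.
    rewrite -(cards1 u); apply: subset_leq_card; apply/subsetP => z; rewrite in_setI !in_dn inE => /andP[zv zw].
    by rewrite (adj_meet zv zw vw) -(adj_meet uv uw vw).
  rewrite /W cardsU !card_dn (adj_card uv) (adj_card uw).
  by move: cI1 nu2; clear; move: #|u| #|_ :&: _| => a b; lia.
apply: le_trans (_ : Pr p (fun X => #|X :&: W| <= t)%N <= _).
  apply: le_Pr => // X /and5P[_ _ _ _ /andP[/=]]; rewrite -/v -/w /low => lv lw.
  have le : (#|X :&: W| <= dX X v + dX X w)%N.
    by rewrite /W setIUr /dX ![_ :&: X]setIC leq_card_setU.
  have : (dX X v + dX X w)%:R < t.+1%:R :> R by apply: lt_le_trans tk; rewrite natrD; lra.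
  by rewrite ltr_nat ltnS; apply: leq_trans.
apply: le_trans (low_count_bound p_ge0 p_le1 W t x01) _.
apply: ler_wpM2l; first by rewrite invr_ge0 exprn_ge0 // ltW.
by apply: ler_wiXn2l.
Qed.

Definition iso_nested X := [exists w : V, exists x, exists y,
  [&& x \notin w, y \notin w, x != y, dX X (x |: (y |: w)) == 0%N & uX X w == 0%N]].

(** The lower neighbours of the upper set and the upper neighbours of [w] number [n + 2] with at
    most two in common; all of them would have to be absent from [X]. *)
Lemma Pr_iso_nested (x0 : R) : 0 < x0 <= 1 ->
  Pr p iso_nested <= (2 ^ n * n * n)%:R * (1 - p + p * x0) ^+ n.
Proof.
move=> x01; have /andP[x00 x0l] := x01.
pose E (a : V * 'I_n * 'I_n) X := [&& a.1.2 \notin a.1.1, a.2 \notin a.1.1, a.1.2 != a.2,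
   dX X (a.1.2 |: (a.2 |: a.1.1)) == 0%N & uX X a.1.1 == 0%N].
have cI : (2 ^ n * n * n)%N = #|{: V * 'I_n * 'I_n}| by rewrite !card_prod card_ord card_V.
rewrite cI; apply: (Pr_union p_ge0 p_le1 (E := E)) => [X /existsP[u /existsP[x /existsP[y h]]]|[[w x] y] _].
  by exists (u, x, y).
have y0 : 0 <= 1 - p + p * x0 by rewrite addr_ge0 ?subr_ge0 // mulr_ge0 // ltW.
have y1 : 1 - p + p * x0 <= 1 by have := ler_wpM2l p_ge0 x0l; lra.
have [/and3P[xu yu xy]|no] := boolP [&& x \notin w, y \notin w & x != y]; last first.
  rewrite /Pr big_pred0 => [|X]; first by rewrite exprn_ge0.
  by apply: contraNF no => /and4P[/= -> -> -> _].
set v := x |: (y |: w); pose W := dn v :|: up w.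
have cv : #|v| = #|w|.+2 by rewrite /v !cardsU1 !inE (negPf xy) (negPf xu) yu.
have cW : (n <= #|W|)%N.
  have cI1 : (#|dn v :&: up w| <= 2)%N.
    apply: leq_trans (_ : #|[set x |: w; y |: w]| <= 2)%N; last by rewrite cards2; case: (_ != _).
    apply: subset_leq_card; apply/subsetP => z; rewrite in_setI in_dn in_up => /andP[/andP[/subsetP zv _] /adj_addP[a aw ez]].
    have := zv a; rewrite ez setU11 => /(_ isT); rewrite !inE (negPf aw) orbF => /orP[] /eqP ->; by rewrite eqxx ?orbT.
  rewrite /W cardsU card_dn card_up cv.
  by have := card_leqn w; move: cI1; clear; move: #|w| #|_ :&: _| => a b; lia.
apply: le_trans (_ : Pr p (fun X => #|X :&: W| <= 0)%N <= _).
  apply: le_Pr => // X /and5P[_ _ _ /= /eqP hd /eqP hu].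
  rewrite /W setIUr; apply: leq_trans (leq_card_setU _ _) _.
  by rewrite ![X :&: _]setIC -/(dX X v) -/(uX X w) hd hu.
apply: le_trans (low_count_bound p_ge0 p_le1 W 0 x01) _.
rewrite expr0 invr1 mul1r; by apply: ler_wiXn2l.
Qed.

Lemma Pr_layer_size (k : nat) : (k <= n)%N ->
  Pr p (fun X => p / 100 * 'C(n, k)%:R <= `|#|X :&: layer n k|%:R - p * 'C(n, k)%:R|) <=
  2%:R * expR (- ((p / 100) ^+ 2 / 8 * 'C(n, k)%:R)).
Proof.
move=> kn; set N := 'C(n, k)%:R; set t := p / 100 * N.
have N0 : 0 < N :> R by rewrite ltr0n bin_gt0.
have t0 : 0 <= t by rewrite mulr_ge0 ?divr_ge0 // ltW.
pose E (b : bool) X := t <= \sum_(v in layer n k) (if b then 1 else -1) * ((v \in X)%:R - p).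
have sumE X (a : R) : \sum_(v in layer n k) a * ((v \in X)%:R - p) = a * (#|X :&: layer n k|%:R - p * N).
  rewrite -mulr_sumr; congr (_ * _); rewrite sumrB sumr_const card_layer mulr_natr; congr (_ - _).
  rewrite -natr_sum -sum1_card big_mkcond [in RHS]big_mkcond; congr (_%:R); apply: eq_bigr => v _.
  by rewrite in_setI; case: (v \in X); case: (v \in layer _ _).
have -> : (2%:R : R) = #|{: bool}|%:R by rewrite card_bool.
apply: (Pr_union p_ge0 p_le1 (E := E)) => [X|b _].
  set s := _ - _ => h; exists (0 <= s) => //; rewrite /E sumE -/s; apply: (le_trans h).
  case: ifP => h1; first by rewrite mul1r ger0_norm.
  by rewrite mulN1r ltr0_norm // ltNge h1.
have cB (X : {set V}) : \sum_(v in layer n k) (if b then 1 else -1) ^+ 2 <= N.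
  rewrite (eq_bigr (fun=> 1)) => [|v _]; last by case: (b); rewrite ?sqrrN expr1n.
  by rewrite sumr_const card_layer.
have := hoeffding p_ge0 p_le1 (W := layer n k) (c := fun _ _ => if b then 1 else -1) (fun _ _ _ _ => erefl _) cB N0 t0.
move/le_trans; apply; rewrite ler_expR lerN2 /t le_eqVlt; apply/orP; left; apply/eqP.
by field; rewrite !gt_eqF.
Qed.

Lemma sparse_badu_dual (eps : R) M X k : (forall j, (j <= n)%N -> sparse (badd p (dual X) eps) j M) ->
  sparse (badu p X eps) k M.
Proof.
move=> h; apply/forallP => z; have [kn|nk] := leqP k n; last first.
  rewrite (_ : [set v in _ | _] = set0) ?cards0 //; apply/setP => v; rewrite in_set0; apply/negbTE/negP.
  rewrite inE => /and3P[_ /eqP cv _]; by have := card_leqn v; rewrite cv leqNgt nk.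
have /forallP/(_ (~: z)) := h (n - k)%N (leq_subr _ _); apply: leq_trans.
rewrite -(card_imset _ (can_inj (@setCK 'I_n))); apply: subset_leq_card; apply/subsetP => _ /imsetP[v + ->].
rewrite inE => /and3P[bv /eqP cv hb]; rewrite !inE dist_setC; move: bv; rewrite inE => -> /=.
by rewrite card_setC cv eqxx /= /badd dX_dual setCK card_setC cv -cv.
Qed.

Lemma quiet_dn_dual (h : R) X i : (i <= n)%N -> quiet_up p (dual X) h (n - i) -> quiet_dn p X h i.
Proof.
move=> ile /forallP hq; apply/forallP => u; apply/implyP => /eqP cu.
have := implyP (hq (~: u)); rewrite card_setC cu eqxx => /(_ isT).
rewrite /sph2_size subKn // mulnC; congr (`|_| <= _).
rewrite (reindex_inj (can_inj (@setCK 'I_n))) /=; apply: eq_big => w; rewrite in_dual setCK.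
  have eS : ~: u :\: ~: w = w :\: u by rewrite !setDE setCK setIC.
  congr (_ && _); rewrite /sph !card_setC eS.
  have := card_leqn u; have := card_leqn w => h1 h2; apply/andP/andP => -[/eqP c1 c2].
    have c3 : #|u| = #|w| by move: c1 h1 h2; clear; lia.
    by split; [apply/eqP | rewrite card_setD_eq].
  by rewrite c1 eqxx (card_setD_eq (esym c1)).
by move=> _; rewrite uX_dual setCK.
Qed.

End MoreEvents.

(** * Ties between the two middle layers *)

Section Anticoncentration.
Variables (R : realType) (T : finType) (p : R).
Hypotheses (p_ge0 : 0 <= p) (p_le1 : p <= 1).
Variables (U : {set T}).

Lemma variance_le : Ex p (fun X => (\sum_(w in U) ((w \in X)%:R - p)) ^+ 2) <= #|U|%:R.
Proof.
have -> : Ex p (fun X => (\sum_(w in U) ((w \in X)%:R - p)) ^+ 2) =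
    \sum_(w in U) \sum_(v in U) Ex p (fun X => ((w \in X)%:R - p) * ((v \in X)%:R - p)).
  rewrite /Ex; under [RHS]eq_bigr => w _ do rewrite exchange_big /=.
  rewrite exchange_big /=; apply: eq_bigr => X _; rewrite expr2 mulr_suml mulr_sumr.
  by apply: eq_bigr => w _; rewrite mulr_sumr mulr_sumr.
rewrite -sum1_card natr_sum; apply: ler_sum => w wU; rewrite (bigD1 w) //= big1 ?addr0.
  rewrite [leRHS](_ : _ = \sum_(X : {set T}) mass p X) ; last by rewrite sum_mass.
  apply: ler_sum => X _.
  rewrite -[leRHS]mulr1; apply: ler_wpM2l; first exact: mass_ge0.
  have pq : 0 <= p * (1 - p) by rewrite mulr_ge0 ?subr_ge0.
  by case: (w \in X); rewrite ?mulr1n ?mulr0n; have p1 := p_le1; nra.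
move=> v /andP[_ vw]; rewrite (Ex_flip p w) /Ex big1 // => X _.
by rewrite !inE eqxx (negPf vw) /= ; ring.
Qed.

(* Raising [D] by one at each point of [U] makes [1(D >= 0) + 1(D >= 1)]
   correlate with every indicator of [U] by at least [(1 - p) P(D = 0)]. *)
Lemma anticoncentration (D : {set T} -> int) (L : R) : 1 - p <= p -> 0 < L ->
    (forall w X, w \in U -> D (w |: X) = D (X :\ w) + 1) ->
  #|U|%:R * ((1 - p) * Pr p (fun X => D X == 0)) <= #|U|%:R / L + L.
Proof.
move=> qp L0 hD; pose h X : R := (0 <= D X)%R%:R + (1 <= D X)%R%:R.
have q0 : 0 <= 1 - p by rewrite subr_ge0.
have corr w : w \in U -> (1 - p) * Pr p (fun X => D X == 0) <= Ex p (fun X => ((w \in X)%:R - p) * h X).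
  move=> wU; rewrite PrE (Ex_flip p w) [leRHS](Ex_flip p w) /Ex mulr_sumr; apply: ler_sum => X _.
  rewrite mulrCA; apply: ler_wpM2l; first exact: mass_ge0.
  rewrite !inE eqxx /= /h (hD w X wU); set d := D (X :\ w).
  (* Only [d = -1] and [d = 0] matter: [h] then rises by one, so the right side is [p * (1 - p)],
     while the left side is [(1 - p) * p] or [(1 - p) * (1 - p)]. The latter comparison uses
     [1 - p <= p]. *)
  have [[d1|d1]|d1] : (d <= -2 \/ d >= 1) \/ (d = -1 \/ d = 0) by lia.
  - have [-> ->] : (d + 1 == 0 = false) /\ (d == 0 = false) by lia.
    have [[-> ->] ->] : ((0 <= d + 1) = false /\ (1 <= d + 1) = false) /\ (0 <= d) = false by lia.
    have -> : (1 <= d) = false by lia.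
    by rewrite /=; lra.
  - have [-> ->] : (d + 1 == 0 = false) /\ (d == 0 = false) by lia.
    have [[-> ->] ->] : ((0 <= d + 1) /\ (1 <= d + 1)) /\ (0 <= d) by lia.
    rewrite d1 /=; lra.
  - by case: d1 => -> /=; nra.
have sumS : #|U|%:R * ((1 - p) * Pr p (fun X => D X == 0)) <= Ex p (fun X => (\sum_(w in U) ((w \in X)%:R - p)) * h X).
  rewrite mulr_natl -sumr_const; apply: le_trans (ler_sum _ corr) _.
  rewrite /Ex exchange_big /=; apply: ler_sum => X _; by rewrite -mulr_sumr mulr_suml.
apply: (le_trans sumS).
apply: (@le_trans _ _ (Ex p (fun X => (\sum_(w in U) ((w \in X)%:R - p)) ^+ 2) / L + L)); last first.
  by rewrite lerD2r ler_pM2r ?invr_gt0 // variance_le.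
rewrite -[X in _ + X]mulr1 -(sum_mass T p) mulr_sumr /Ex mulr_suml -big_split /=; apply: ler_sum => X _.
rewrite -mulrA [L * _]mulrC -mulrDr; apply: ler_wpM2l; first exact: mass_ge0.
set s := \sum_(w in U) _.
have h02 : 0 <= h X <= 2 by rewrite /h; case: (0 <= D X)%R; case: (1 <= D X)%R => /=; lra.
(* Since [h] is at most 2, the product [s * h X] is at most [2 * |s|]; this inequality trades it for
   the variance with the free parameter [L]. *)
have am : 2 * `|s| <= s ^+ 2 / L + L.
  rewrite -real_normK ?num_real //; have := normr_ge0 s; move: (`|s|) => a a0.
  have -> : a ^+ 2 / L + L = (a ^+ 2 + L ^+ 2) / L by field; rewrite gt_eqF.
  rewrite ler_pdivlMr //; have := sqr_ge0 (a - L); nra.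
apply: le_trans am; have := ler_norm s; have := normr_ge0 s; case/andP: h02; nra.
Qed.

End Anticoncentration.

Section Tie.
Variables (n m : nat).
Notation V := {set 'I_n}.
Implicit Types (X Y U : {set V}) (u v w z : V).

(* Changing the membership of a free set [u] of size [m] affects [near_value]
   only through the count of the layer [m]. *)
Definition free X u :=
  [&& [forall v in up u, X :&: (dn v :\ u) != set0], [forall w in dn u, X :&: (up w :\ u) != set0]
    & X :&: up u != set0].

Definition gap X : int := (near_value X m)%:Z - (near_value X m.+1)%:Z.

Lemma dX_del X u v : ~~ adj u v -> dX (X :\ u) v = dX X v.
Proof.
move=> uv; apply: eq_card => w; rewrite !in_setI in_dn in_setD1.
by case: eqP => // ->; rewrite (negPf uv).
Qed.

Lemma uX_del X u v : ~~ adj v u -> uX (X :\ u) v = uX X v.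
Proof.
move=> uv; apply: eq_card => w; rewrite !in_setI in_up in_setD1.
by case: eqP => // ->; rewrite (negPf uv).
Qed.

(** Every neighbour of [u] keeps another witness in [X], so its isolation status does not change,
    and [u] itself is not isolated from above. Only the count of layer [m] moves, and it enters
    [gap] through [near_value X m]. *)
Lemma gap_free X u : #|u| = m -> u \in X -> free X u -> gap X = gap (X :\ u) + 1.
Proof.
move=> cu uX0 /and3P[/forall_inP f1 /forall_inP f2 f3].
have inX v : v != u -> (v \in X :\ u) = (v \in X) by rewrite in_setD1 => ->.
have nu1 v : #|v| != m -> v != u by apply: contraNneq => ->; rewrite cu.
have e1 : #|X :&: layer n m| = #|(X :\ u) :&: layer n m|.+1.
  rewrite (cardsD1 u) in_setI uX0 inE cu eqxx /= add1n; congr (_.+1); apply: eq_card => v.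
  by rewrite !inE; case: (v == u).
have e2 : isoD X m = isoD (X :\ u) m.
  apply/setP => v; rewrite /isoD [LHS]inE [RHS]inE; have [cv|] := eqVneq #|v| m.+1; last by rewrite andbF andbF.
  have vu : v != u by apply: nu1; rewrite cv neq_ltn ltnSn orbT.
  rewrite (inX v vu) /=; congr (_ && _); have [uv|uv] := boolP (adj u v); last by rewrite dX_del.
  have /set0Pn[w] : X :&: (dn v :\ u) != set0 by apply: f1; rewrite in_up.
  rewrite in_setI in_setD1 => /and3P[wX wu wv].
  apply/idP/idP; rewrite cards_eq0 => /eqP e0; have := in_set0 w; rewrite -e0 in_setI wv.
    by rewrite wX.
  by rewrite in_setD1 wu wX.
have e3 : isoU X m = isoU (X :\ u) m.
  apply/setP => v; rewrite /isoU [LHS]inE [RHS]inE; have [cv|] := eqVneq #|v|.+1 m; last by rewrite andbF andbF.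
  have vu : v != u by apply: nu1; rewrite -cv neq_ltn ltnSn.
  rewrite (inX v vu) /=; congr (_ && _); have [uv|uv] := boolP (adj v u); last by rewrite uX_del.
  have /set0Pn[w] : X :&: (up v :\ u) != set0 by apply: f2; rewrite in_dn.
  rewrite in_setI in_setD1 => /and3P[wX wu wv].
  apply/idP/idP; rewrite cards_eq0 => /eqP e0; have := in_set0 w; rewrite -e0 in_setI wv.
    by rewrite wX.
  by rewrite in_setD1 wu wX.
have e4 : X :&: layer n m.+1 = (X :\ u) :&: layer n m.+1.
  apply/setP => v; rewrite !in_setI in_setD1; case: eqP => // ->; by rewrite inE cu eqn_leq ltnn !andbF.
have e5 : isoD X m.+1 = isoD (X :\ u) m.+1.
  apply/setP => v; rewrite /isoD [LHS]inE [RHS]inE; have [cv|] := eqVneq #|v| m.+2; last by rewrite andbF andbF.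
  have vu : v != u by apply: nu1; rewrite cv; clear; lia.
  rewrite (inX v vu) dX_del //; apply/negP => /adj_card; rewrite cv cu; clear; lia.
have e6 : isoU X m.+1 = isoU (X :\ u) m.+1.
  apply/setP => v; rewrite /isoU [LHS]inE [RHS]inE eqSS; have [cv|] := eqVneq #|v| m; last by rewrite andbF andbF.
  have nadj : ~~ adj v u by apply/negP => /adj_card; rewrite cv cu; clear; lia.
  rewrite uX_del //; have [->|vu] := eqVneq v u; last by rewrite inX.
  by rewrite setD11 uX0 /= /uX setIC; apply/negbTE; rewrite cards_eq0.
rewrite /gap /near_value e1 e2 e3 e4 e5 e6; clear; lia.
Qed.

Definition separated U := forall u v, u \in U -> v \in U -> u != v -> (1 < #|u :\: v|)%N.

Lemma sep_up U u v w : separated U -> u \in U -> v \in U -> u != v -> adj u w -> ~~ adj v w.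
Proof.
move=> sU uU vU uv uw; apply/negP => vw; have := sU u v uU vU uv; apply/negP; rewrite -leqNgt.
have /andP[/subsetP suw _] := uw; have /andP[svw _] := vw.
apply: leq_trans (_ : #|w :\: v| <= 1)%N; first by apply: subset_leq_card; apply: setSD; apply/subsetP.
by rewrite cardsD (setIidPr svw) (adj_card vw) subSnn.
Qed.

Lemma sep_dn U u v w : separated U -> u \in U -> v \in U -> u != v -> adj w u -> ~~ adj w v.
Proof.
move=> sU uU vU uv uw; apply/negP => vw; have := sU u v uU vU uv; apply/negP; rewrite -leqNgt.
have /andP[swu _] := uw; have /andP[swv _] := vw.
apply: leq_trans (_ : #|u :\: w| <= 1)%N; first by apply: subset_leq_card; apply: setDS.
by rewrite cardsD (setIidPr swu) (adj_card uw) subSnn.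
Qed.

(** The witnesses for [u] are either further neighbours of the neighbours of [u] or sets of level
    [m + 1]. A different [v] of a separated family has no neighbour in common with [u], so deleting
    it destroys none of them. *)
Lemma free_del U X u v : separated U -> U \subset layer n m -> u \in U -> v \in U ->
  free X u -> free (X :\ v) u.
Proof.
move=> sU /subsetP UL uU vU /and3P[/forall_inP f1 /forall_inP f2 f3].
have cU w : w \in U -> #|w| = m by move/UL; rewrite inE => /eqP.
apply/and3P; split.
- apply/forall_inP => a ua; have /set0Pn[w] := f1 a ua; rewrite in_setI in_setD1 => /and3P[wX wu wa].
  apply/set0Pn; exists w; rewrite in_setI !in_setD1 wX wu wa andbT /= andbT; apply: contraNneq wu => wv.
  rewrite wv; apply/eqP; apply/eqP; apply: contraTT wa => vu; rewrite wv in_dn.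
  by apply: (sep_up sU uU vU) => //; [rewrite eq_sym | rewrite -in_up].
- apply/forall_inP => a ua; have /set0Pn[w] := f2 a ua; rewrite in_setI in_setD1 => /and3P[wX wu wa].
  apply/set0Pn; exists w; rewrite in_setI !in_setD1 wX wu wa andbT /= andbT; apply: contraNneq wu => wv.
  rewrite wv; apply/eqP; apply/eqP; apply: contraTT wa => vu; rewrite wv in_up.
  by apply: (sep_dn sU uU vU) => //; [rewrite eq_sym | rewrite -in_dn].
- have /set0Pn[w] := f3; rewrite in_setI => /andP[wX wu]; apply/set0Pn; exists w.
  rewrite in_setI in_setD1 wX wu !andbT; apply: contraTneq wu => ->; rewrite in_up; apply/negP => /adj_card.
  by rewrite !cU //; clear; lia.
Qed.

Lemma gap_all_free U X : separated U -> U \subset layer n m -> {in U, forall u, free X u} ->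
  gap X = gap (X :\: U) + #|X :&: U|%:Z.
Proof.
move=> sU UL; move e: #|X :&: U| => k; elim: k X e => [|k IH] X e fX.
  move/eqP: e; rewrite cards_eq0 setI_eq0 => /setDidPl ->; by rewrite addr0.
have [u] : exists u, u \in X :&: U by apply/card_gt0P; rewrite e.
rewrite in_setI => /andP[uX0 uU].
have cu : #|u| = m by have := subsetP UL u uU; rewrite inE => /eqP.
rewrite (gap_free cu uX0 (fX u uU)) IH.
- rewrite (_ : (X :\ u) :\: U = X :\: U); first by clear; lia.
  by apply/setP => v; rewrite !in_setD in_set1; case: eqP => // ->; rewrite uU.
- move: e; rewrite (cardsD1 u) in_setI uX0 uU add1n => -[<-]; apply: eq_card => v.
  by rewrite in_setI !in_setD1 in_setI andbA.
- by move=> v vU; apply: (free_del sU) => //; apply: fX.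
Qed.

Section TieProbability.
Variables (R : realType) (p : R).
Hypotheses (p_ge0 : 0 <= p) (p_le1 : p <= 1) (qp : 1 - p <= p).

(** There are [(m + 1) + m + 1 = n + 1] ways to fail, each requiring some [m] fixed sets to be
    absent from [X]. *)
Lemma Pr_not_free u (x0 : R) : n = (2 * m).+1 -> #|u| = m -> 0 < x0 <= 1 ->
  Pr p (fun X => ~~ free X u) <= n.+1%:R * (1 - p + p * x0) ^+ m.
Proof.
move=> nm cu x01; have /andP[x00 x0l] := x01; set y := 1 - p + p * x0.
have y0 : 0 <= y by rewrite /y addr_ge0 ?subr_ge0 // mulr_ge0 // ltW.
have y1 : y <= 1 by rewrite /y; have := ler_wpM2l p_ge0 x0l; lra.
have bnd (W : {set V}) : (m <= #|W|)%N -> Pr p (fun X => ~~ (X :&: W != set0)) <= y ^+ m.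
  move=> mW; apply: le_trans (_ : Pr p (fun X => #|X :&: W| <= 0)%N <= _).
    by apply: le_Pr => // X; rewrite negbK => /eqP ->; rewrite cards0.
  apply: le_trans (low_count_bound p_ge0 p_le1 W 0 x01) _; rewrite expr0 invr1 mul1r; exact: ler_wiXn2l.
pose E1 X := ~~ [forall v in up u, X :&: (dn v :\ u) != set0].
pose E2 X := ~~ [forall w in dn u, X :&: (up w :\ u) != set0].
pose E3 X := ~~ (X :&: up u != set0).
have P1 : Pr p E1 <= #|up u|%:R * y ^+ m.
  apply: (Pr_union p_ge0 p_le1 (A := mem (up u)) (E := fun v X => ~~ (X :&: (dn v :\ u) != set0))) => [X|v vu].
    by rewrite /E1 negb_forall => /existsP[v]; rewrite negb_imply => /andP[]; exists v.
  apply: bnd; have uv : adj u v by rewrite -in_up.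
  have := cardsD1 u (dn v); rewrite card_dn (adj_card uv) cu in_dn uv add1n => -[<-] //.
have P2 : Pr p E2 <= #|dn u|%:R * y ^+ m.
  apply: (Pr_union p_ge0 p_le1 (A := mem (dn u)) (E := fun v X => ~~ (X :&: (up v :\ u) != set0))) => [X|v vu].
    by rewrite /E2 negb_forall => /existsP[v]; rewrite negb_imply => /andP[]; exists v.
  apply: bnd; have uv : adj v u by rewrite -in_dn.
  have := cardsD1 u (up v); rewrite card_up in_up uv; have := adj_card uv; rewrite cu.
  by move: nm; clear; move: #|v| #|_ :\ _| => a b; lia.
have P3 : Pr p E3 <= y ^+ m by apply: bnd; rewrite card_up cu; move: nm; clear; lia.
have -> : n.+1 = (#|up u| + #|dn u| + 1)%N by rewrite card_up card_dn cu; move: nm; clear; lia.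
apply: (@le_trans _ _ (Pr p (predU E1 (predU E2 E3)))).
  by apply: le_Pr => // X; rewrite !negb_and.
apply: le_trans (PrU p_ge0 p_le1 _ _) _; have := PrU p_ge0 p_le1 E2 E3; rewrite !natrD !mulrDl mul1r; lra.
Qed.

Lemma Pr_tie U (x0 L : R) : n = (2 * m).+1 -> U \subset layer n m -> separated U -> 0 < x0 <= 1 -> 0 < L ->
  #|U|%:R * ((1 - p) * Pr p (fun X => near_value X m == near_value X m.+1)) <=
  #|U|%:R * (#|U|%:R * (n.+1%:R * (1 - p + p * x0) ^+ m)) + (#|U|%:R / L + L).
Proof.
move=> nm UL sU x01 L0; have q0 : 0 <= 1 - p by rewrite subr_ge0.
pose E1 X := ~~ [forall u in U, free X u].
(* [D] coincides with [gap] when all of [U] is free, but it steps by exactly one at the points of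
   [U] for every [X], as [anticoncentration] requires. *)
pose D X : int := gap (X :\: U) + #|X :&: U|%:Z.
have P1 : Pr p E1 <= #|U|%:R * (n.+1%:R * (1 - p + p * x0) ^+ m).
  apply: (Pr_union p_ge0 p_le1 (A := mem U) (E := fun u X => ~~ free X u)) => [X|u uU].
    by rewrite /E1 negb_forall => /existsP[v]; rewrite negb_imply => /andP[]; exists v.
  by apply: Pr_not_free => //; have := subsetP UL u uU; rewrite inE => /eqP.
have hD w X : w \in U -> D (w |: X) = D (X :\ w) + 1.
  move=> wU; rewrite /D.
  have -> : (w |: X) :\: U = (X :\ w) :\: U.
    by apply/setP => v; rewrite !in_setD in_setU1 in_set1; case: eqP => //= ->; rewrite wU.
  have -> : #|(w |: X) :&: U| = #|(X :\ w) :&: U|.+1.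
    rewrite (cardsD1 w) in_setI setU11 wU add1n; congr (_.+1); apply: eq_card => v.
    by rewrite !in_setI !in_setD1 !in_setI in_setU1; case: (v == w).
  clear; lia.
have P2 := anticoncentration p_ge0 p_le1 qp L0 hD.
have le : Pr p (fun X => near_value X m == near_value X m.+1) <= Pr p E1 + Pr p (fun X => D X == 0).
  apply: le_trans (PrU p_ge0 p_le1 _ _); apply: le_Pr => // X /eqP e; rewrite /=; apply/orP.
  have [/forall_inP fX|nf] := boolP [forall u in U, free X u]; last by left.
  by right; rewrite /D -(gap_all_free sU UL fX) /gap e subrr.
have h1 : (1 - p) * Pr p (fun X => near_value X m == near_value X m.+1) <= 
    #|U|%:R * (n.+1%:R * (1 - p + p * x0) ^+ m) + (1 - p) * Pr p (fun X => D X == 0).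
  apply: le_trans (ler_wpM2l q0 le) _; rewrite mulrDr lerD2r; apply: le_trans P1.
  by apply: ler_piMl; [apply: Pr_ge0 | rewrite lerBlDr lerDl].
apply: le_trans (ler_wpM2l (ler0n _ #|U|) h1) _; rewrite mulrDr; lra.
Qed.

End TieProbability.

(** Intervals of length [m] shifted by 2, so that two of them differ in at least two elements on
    each side. *)
Definition window (j : nat) : V := [set x : 'I_n | (2 * j <= x < 2 * j + m)%N].

Lemma card_window j : (2 * j + m <= n)%N -> #|window j| = m.
Proof.
move=> jn; rewrite -sum1_card.
have -> : \sum_(x in window j) 1 = (\sum_(2 * j <= x < 2 * j + m) 1)%N.
  rewrite (big_nat_widen _ _ n) //= (big_nat_widenl _ 0) //= big_mkord; apply: eq_bigl => x.
  by rewrite inE andbC.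
by rewrite sum_nat_const_nat addKn muln1.
Qed.

Lemma window_sep i j : (1 < m)%N -> (2 * i + m <= n)%N -> i != j -> (1 < #|window i :\: window j|)%N.
Proof.
move=> m1 h ij.
have [a [a1 a2 a3]] : exists a, [/\ 2 * i <= a, a.+1 < 2 * i + m & (a.+1 < 2 * j) || (2 * j + m <= a)]%N.
  case: (ltngtP i j) ij => // ij _.
    exists (2 * i)%N; split; [by []| by move: m1; clear; lia | by apply/orP; left; move: ij; clear; lia].
  exists (2 * i + m - 2)%N; split; [move: m1; clear; lia | move: m1; clear; lia |].
  by apply/orP; right; move: ij m1; clear; lia.
have an1 : (a.+1 < n)%N by apply: leq_trans a2 h.
have an : (a < n)%N by apply: ltnW.
have <- : #|[set Ordinal an; Ordinal an1]| = 2%N.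
  by rewrite cards2 (_ : Ordinal an != Ordinal an1) // -val_eqE /= neq_ltn ltnSn.
have key x : (a <= x <= a.+1)%N -> ~~ (2 * j <= x < 2 * j + m)%N && (2 * i <= x < 2 * i + m)%N.
  case/andP=> x1 x2; apply/andP; split; last by move: x1 x2 a1 a2; clear; lia.
  by apply/negP => /andP[x3 x4]; case/orP: a3 => a3; move: a3 x1 x2 x3 x4; clear; lia.
apply: subset_leq_card; apply/subsetP => x; rewrite in_set2 in_setD /window => /orP[] /eqP ->;
  by rewrite [_ \in _]inE [X in _ && X]inE; apply: key; rewrite /= ?leqnn ?leqnSn.
Qed.

Lemma exists_separated K : n = (2 * m).+1 -> (1 < m)%N -> (2 * K <= m)%N ->
  exists U, [/\ U \subset layer n m, separated U & #|U| = K].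
Proof.
move=> nm m1 Km; exists [set window j | j : 'I_K].
have le (j : 'I_K) : (2 * j + m <= n)%N by have := ltn_ord j; move: nm Km; clear; move: (val j) => /= a; lia.
have inj : injective (fun j : 'I_K => window j).
  move=> i j /= e; apply/val_inj; apply/eqP; apply: contraT => ij.
  by have := window_sep m1 (le i) ij; rewrite e setDv cards0.
split.
- by apply/subsetP => _ /imsetP[j _ ->]; rewrite inE card_window ?le.
- move=> _ _ /imsetP[i _ ->] /imsetP[j _ ->] ij; apply: window_sep => //.
  by apply: contraNneq ij => ->.
- by rewrite card_imset // card_ord.
Qed.

End Tie.

(** * The limit *)

Section Asymptotics.
Variable R : realType.

Definition eventually (P : nat -> Prop) := exists n0, forall n, (n0 <= n)%N -> P n.

Lemma eventuallyI (P Q : nat -> Prop) : eventually P -> eventually Q -> eventually (fun n => P n /\ Q n).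
Proof.
move=> [a ha] [b hb]; exists (maxn a b) => n; rewrite geq_max => /andP[an bn].
by split; [apply: ha | apply: hb].
Qed.

Lemma eventuallyW (P Q : nat -> Prop) : (forall n, P n -> Q n) -> eventually P -> eventually Q.
Proof. by move=> PQ [a ha]; exists a => n /ha /PQ. Qed.

Lemma eventually_geq k : eventually (fun n => (k <= n)%N).
Proof. by exists k. Qed.

Lemma eventually_linear (a b : R) : 0 < a -> eventually (fun n => b <= a * n%:R).
Proof.
move=> a0; exists (Num.bound (`|b| / a)) => n hn.
have h : `|b| / a < (Num.bound (`|b| / a))%:R by apply: archi_boundP; rewrite divr_ge0 // ltW.
have h2 : ((Num.bound (`|b| / a))%:R : R) <= n%:R by rewrite ler_nat.
by apply: le_trans (ler_norm _) _; rewrite mulrC -ler_pdivrMr // ltW // (lt_le_trans h).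
Qed.

(** From [1 + e * n <= expR (e * n)] with [e = c / (k + 1)], the power [k + 1] of a linear function
    is below [expR (c * n)]; this leaves one spare factor of order [n]. *)
Lemma eventually_expR (C c d : R) (k : nat) : 0 <= C -> 0 < c -> 0 < d ->
  eventually (fun n => C * n.+1%:R ^+ k * expR (- (c * n%:R)) <= d).
Proof.
move=> C0 c0 d0; set e := c / k.+1%:R.
have e0 : 0 < e by rewrite divr_gt0 // ltr0n.
pose a := Num.min 1 e; have a0 : 0 < a by rewrite lt_min ltr01.
have ak0 : 0 < a ^+ k.+1 by rewrite exprn_gt0.
apply: eventuallyW (eventually_linear (C / (a ^+ k.+1 * d)) ltr01) => n; rewrite mul1r => hn.
set x : R := n.+1%:R; have x0 : 0 < x by rewrite ltr0n.
have lin : a * x <= expR (e * n%:R).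
  apply: le_trans (expR_ge1Dx _); rewrite /x -natr1 mulrDr mulr1 addrC; apply: lerD; first by rewrite ge_min lexx.
  by apply: ler_wpM2r => //; rewrite ge_min lexx orbT.
have pw : a ^+ k.+1 * x ^+ k.+1 <= expR (c * n%:R).
  have -> : c * n%:R = k.+1%:R * (e * n%:R).
    by rewrite /e mulrA [_ * (c / _)]mulrC divfK ?pnatr_eq0.
  by rewrite expRM_natl -exprMn; apply: lerXn2r; rewrite ?nnegrE ?expR_ge0 // mulr_ge0 // ltW.
rewrite expRN ler_pdivrMr ?expR_gt0 //; apply: le_trans (ler_wpM2l (ltW d0) pw).
have hx : C / (a ^+ k.+1 * d) <= x by apply: (le_trans hn); rewrite ler_nat.
move: hx; rewrite ler_pdivrMr ?mulr_gt0 // => hx.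
have := ler_wpM2r (exprn_ge0 k (ltW x0)) hx; rewrite [x ^+ k.+1]exprS.
by move/le_trans; apply; rewrite le_eqVlt; apply/orP; left; apply/eqP; ring.
Qed.

Lemma expn2_le_expR n : (2 ^ n)%:R <= expR n%:R :> R.
Proof.
rewrite -[X in expR X]mulr1 expRM_natl natrX; apply: lerXn2r; rewrite ?nnegrE ?expR_ge0 //.
by have := expR_ge1Dx (1 : R); lra.
Qed.

End Asymptotics.

Lemma bin_ge n k : (0 < k < n)%N -> (n <= 'C(n, k))%N.
Proof.
elim: n k => [|n IH] [|k] //= ; rewrite ltnS => kn; rewrite binS.
have [<-|kn'] := eqVneq k.+1 n; first by rewrite binn binSn add1n.
have k1 : (k.+1 < n)%N by rewrite ltn_neqAle kn' kn.
have : (0 < 'C(n, k))%N by rewrite bin_gt0 ltnW.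
by have := IH k.+1; rewrite k1 => /(_ isT); clear; lia.
Qed.

(** * The regularity event and its failure probability *)

Section Regular.
Variables (R : realType) (p kap eps eta : R) (M n : nat).
Notation V := {set 'I_n}.
Notation nu := (n%:R : R).
Implicit Types (X : {set V}).

Definition quiet X := [forall i : 'I_n, ((n <= 4 * i) && (n <= 4 * (n - i.+1)))%N ==> quiet_up p X eta i].

(* [good X] only needs [regular] for [X] and for its dual. *)
Definition regular X : bool :=
  [&& [forall k : 'I_n.+1, sparse (badd p X eps) k M],
      [forall i : 'I_n.+1, mixing p X (p ^+ 2 * kap ^+ 2 / 32) i],
      quiet X & ~~ low_twins kap X].

Lemma regular_sparse X : [forall k : 'I_n.+1, sparse (badd p X eps) k M] -> forall k, sparse (badd p X eps) k M.
Proof.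
move=> /forallP h k; have [kn|nk] := ltnP k n.+1; first exact: (h (Ordinal kn)).
apply/forallP => z; rewrite (_ : [set v in _ | _] = set0) ?cards0 //; apply/setP => v.
rewrite in_set0; apply/negbTE/negP; rewrite inE => /and3P[_ /eqP cv _].
by have := card_leqn v; rewrite cv leqNgt nk.
Qed.

Lemma regular_quiet X i : (0 < n)%N -> quiet X -> (n <= 4 * i)%N -> (n <= 4 * (n - i.+1))%N -> quiet_up p X eta i.
Proof.
move=> n0 /forallP h i1 i2; have i3 : (i < n)%N by move: n0 i2; clear; lia.
by have := h (Ordinal i3); rewrite /= i1 i2.
Qed.

Lemma regular_good X : (0 < n)%N -> regular X -> regular (dual X) -> good p kap eps eta M X.
Proof.
move=> n0 /and4P[s1 m1 q1 t1] /and4P[s2 m2 q2 t2]; split.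
- exact: regular_sparse.
- by move=> k; apply: sparse_badu_dual => j _; apply: regular_sparse.
- move=> i i1 i2; have i3 : (i < n)%N by move: n0 i2; clear; lia.
  split; first by have /forallP/(_ (Ordinal (ltnW i3 : i < n.+1)%N)) := m1.
    exact: regular_quiet.
  apply: quiet_dn_dual => //; apply: regular_quiet => //; move: i1 i2 i3; clear; lia.
- move=> u v w nv /adj_addP[x xu ev] /adj_addP[y yu ew] vw; apply: contra t1 => /andP[lv lw].
  apply/existsP; exists u; apply/existsP; exists x; apply/existsP; exists y.
  rewrite xu yu -ev -ew lv lw !andbT /=; apply/andP; split.
    by apply: contraNneq vw => xy; rewrite ev ew xy.
  by move: nv; rewrite ev cardsU1 xu add1n.
Qed.

Hypotheses (p_ge0 : 0 <= p) (p_le1 : p <= 1).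

Lemma Pr_not_regular (x0 : R) (t : nat) : (16 <= n)%N -> (M < n)%N -> 0 <= eps -> 0 < eta ->
    0 < p ^+ 2 * kap ^+ 2 / 32 -> 0 < x0 <= 1 -> 2 * (kap * nu) <= t.+1%:R ->
  Pr p (predC regular) <=
    (n.+1 * 2 ^ n)%:R * ((n.+1 ^ (8 * M.+1))%:R * ((2 ^ M.+1)%:R * expR (- (M.+1%:R * eps ^+ 2 / 16 * nu)))) +
    ((2 ^ n * n * 2 ^ n * 2 ^ n)%:R * (2 * expR (- ((p ^+ 2 * kap ^+ 2 / 32 / 2) ^+ 2 / 8 * nu ^+ 2))) +
    (n%:R * ((2 ^ n * 2)%:R * expR (- (eta ^+ 2 / (8 * (64 * 64)) * nu ^+ 2))) +
    (2 ^ n * n * n)%:R * (x0 ^- t * (1 - p + p * x0) ^+ n))).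
Proof.
move=> n16 Mn e0 et0 g0 x01 tk; have n0 : (0 < n)%N by apply: leq_trans n16.
pose E1 X := ~~ [forall k : 'I_n.+1, sparse (badd p X eps) k M].
pose E2 X := ~~ [forall i : 'I_n.+1, mixing p X (p ^+ 2 * kap ^+ 2 / 32) i].
pose E3 X := ~~ quiet X.
have P3 : Pr p E3 <= n%:R * ((2 ^ n * 2)%:R * expR (- (eta ^+ 2 / (8 * (64 * 64)) * nu ^+ 2))).
  pose A := [pred i : 'I_n | (n <= 4 * i)%N && (n <= 4 * (n - i.+1))%N].
  apply: (@le_trans _ _ (#|A|%:R * ((2 ^ n * 2)%:R * expR (- (eta ^+ 2 / (8 * (64 * 64)) * nu ^+ 2))))).
    apply: (Pr_union p_ge0 p_le1 (A := A) (E := fun (i : 'I_n) X => ~~ quiet_up p X eta i)) => [X|i /andP[i1 i2]].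
      by rewrite /E3 negb_forall => /existsP[i]; rewrite negb_imply => /andP[]; exists i.
    apply: Pr_not_quiet_up => //; have := sph2_size_ge R n16 i1; rewrite -natrX -!natrM ler_nat; apply; move: i2; clear; move: (val i) => /= a; lia.
  by apply: ler_wpM2r; rewrite ?mulr_ge0 ?expR_ge0 // ler_nat; apply: leq_trans (max_card _) _; rewrite card_ord.
apply: (@le_trans _ _ (Pr p (predU E1 (predU E2 (predU E3 (low_twins kap)))))).
  by apply: le_Pr => // X; rewrite /= !negb_and negbK.
apply: le_trans (PrU p_ge0 p_le1 _ _) _; apply: lerD; first exact: Pr_not_sparse.
apply: le_trans (PrU p_ge0 p_le1 _ _) _; apply: lerD; first exact: Pr_not_mixing.
apply: le_trans (PrU p_ge0 p_le1 _ _) _; apply: lerD => //; exact: Pr_low_twins.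
Qed.

Lemma Pr_not_regular_dual : Pr p (fun X => ~~ regular (dual X)) = Pr p (predC regular).
Proof. exact: (Pr_dual p (predC regular)). Qed.

Hypothesis P : params p kap eps eta M n.

Lemma failure_even k : n = (2 * k)%N ->
  Pr p (predC (@largest_antichains_near_middle n)) <= Pr p (predC regular) + Pr p (predC regular).
Proof.
move=> nk; have n0 : (0 < n)%N by apply: leq_trans (pr_n P).
rewrite -[X in _ + X]Pr_not_regular_dual; apply: le_trans (PrU p_ge0 p_le1 _ _); apply: le_Pr => // X.
apply: contraR; rewrite /= negb_or !negbK => /andP[r1 r2].
by apply: (near_even P _ _ nk); apply: regular_good => //; rewrite dualK.
Qed.

Lemma failure_odd m : n = (2 * m).+1 ->
  Pr p (predC (@largest_antichains_near_middle n)) <= Pr p (predC regular) + (Pr p (predC regular) +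
   (Pr p (fun X => p / 100 * 'C(n, m)%:R <= `|#|X :&: layer n m|%:R - p * 'C(n, m)%:R|) +
   (Pr p (fun X => p / 100 * 'C(n, m.+1)%:R <= `|#|X :&: layer n m.+1|%:R - p * 'C(n, m.+1)%:R|) +
   (Pr p (@iso_nested n) + Pr p (fun X => near_value X m == near_value X m.+1))))).
Proof.
move=> nm; have n0 : (0 < n)%N by apply: leq_trans (pr_n P).
have eN : 'C(n, m) = 'C(n, m.+1).
  rewrite -(@bin_sub n m.+1); last by move: nm; clear; lia.
  by congr ('C(_, _)); move: nm; clear; lia.
rewrite -[X in _ <= _ + (X + _)]Pr_not_regular_dual.
pose E3 (X : {set V}) := p / 100 * 'C(n, m)%:R <= `|#|X :&: layer n m|%:R - p * 'C(n, m)%:R|.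
pose E4 (X : {set V}) := p / 100 * 'C(n, m.+1)%:R <= `|#|X :&: layer n m.+1|%:R - p * 'C(n, m.+1)%:R|.
pose E6 (X : {set V}) := near_value X m == near_value X m.+1.
pose E := predU (predC regular) (predU (fun X => ~~ regular (dual X)) (predU E3 (predU E4 (predU (@iso_nested n) E6)))).
apply: (@le_trans _ _ (Pr p E)); last first.
  do 5 (apply: le_trans (PrU p_ge0 p_le1 _ _) _; rewrite lerD2l //).
apply: le_Pr => // X; apply: contraR.
rewrite /E /= !negb_or => /and5P[/negbNE r1 /negbNE r2 s0 s1 /andP[ni tie]].
have h1 : good p kap eps eta M X by apply: regular_good.
have h2 : good p kap eps eta M (dual X) by apply: regular_good => //; rewrite dualK.
move: s0 s1; rewrite /E3 /E4 -!ltNge eN -card_layer; set N := #|layer n m.+1|%:R => s0 s1.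
have a0 := ler_norm (#|X :&: layer n m|%:R - p * N); have b0 := ler_norm (- (#|X :&: layer n m|%:R - p * N)).
have b1 := ler_norm (- (#|X :&: layer n m.+1|%:R - p * N)); rewrite !normrN in b0 b1.
apply: (near_odd P h1 h2 nm) => //; rewrite -/N; [lra | lra | lra |].
move=> v w _ _ cvw wv; apply: contra ni => /andP[dv uw].
have : #|v :\: w| == 2%N by rewrite cardsD (setIidPr wv) cvw -addn2 addKn.
case/cards2P=> x [y [xy e]].
have ev : v = x |: (y |: w).
  by rewrite -(setID v w) (setIidPr wv) e setUC setUA.
have inD z : z \in v :\: w -> z \notin w by rewrite in_setD => /andP[].
apply/existsP; exists w; apply/existsP; exists x; apply/existsP; exists y.
by rewrite !inD ?e ?set21 ?set22 //= xy -ev dv.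
Qed.

End Regular.

Section Limits.
Variables (R : realType) (p : R).
Hypotheses (hp : 1 / 2 < p) (hp1 : p < 1).

Lemma params_eventually (kap : R) : 0 < kap -> kap <= p / 8 ->
  exists (eps eta : R) (M : nat), [/\ 0 < eps, 0 < eta, 3 <= M.+1%:R * eps ^+ 2 / 16
    & eventually (params p kap eps eta M)].
Proof.
move=> k0 kp; have [hp' hp1'] := (hp, hp1); have p0 : 0 < p by lra.
pose g := p ^+ 2 * kap ^+ 2 / 32; have g0 : 0 < g by rewrite divr_gt0 // mulr_gt0 // exprn_gt0.
pose A := 4 / kap + 10 * (256 * 128) / g; pose F := 1 + 1 / kap.
have A0 : 0 < A.
  by rewrite /A addr_gt0 // divr_gt0 // !mulr_gt0.
have F0 : 0 < F by rewrite /F addr_gt0 // divr_gt0.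
have S0 : 0 < 1 + A + F by apply: addr_gt0 => //; apply: addr_gt0.
(* One choice for three constraints: [eps], [eps * A] and [eps * F] add up to [p / 16], so each of
   them is at most that. *)
pose eps := p / 16 / (1 + A + F).
have e0 : 0 < eps by rewrite !divr_gt0.
have eS : eps * (1 + A + F) = p / 16 by rewrite /eps divfK // gt_eqF.
have eA0 : 0 < eps * A by rewrite mulr_gt0.
have eF0 : 0 < eps * F by rewrite mulr_gt0.
have eS' : eps + eps * A + eps * F = p / 16 by rewrite -eS; ring.
have kA : eps * A <= 1 / 4 by lra.
have kF : eps * F <= p / 16 by lra.
have ke : kap + eps <= p / 4 by lra.
(* The equality case of [pr_om]. *)
pose eta := g / (160 * 100) * kap / 8.
have et0 : 0 < eta.
  by rewrite /eta divr_gt0 // mulr_gt0 // divr_gt0 // mulr_gt0.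
(* With [48 = 3 * 16] the exponent of [linear_deviation] for [M + 1] vertices is at least [3 * n],
   well above the [2 ^ n] centres. *)
pose M := (Num.bound (48 / eps ^+ 2)).+1.
exists eps, eta, M; split=> //.
  have h : 48 / eps ^+ 2 < (Num.bound (48 / eps ^+ 2))%:R.
    by apply: archi_boundP; rewrite divr_ge0 // sqr_ge0.
  have e20 : 0 < eps ^+ 2 by rewrite exprn_gt0.
  have : 48 / eps ^+ 2 <= M.+1%:R by apply: (le_trans (ltW h)); rewrite ler_nat /M; clear; lia.
  by rewrite ler_pdivrMr // => h2; lra.
have k20 : 0 < kap ^+ 2 by rewrite exprn_gt0.
have om : 8 * eta / kap <= g / (160 * 100).
  rewrite ler_pdivrMr // le_eqVlt; apply/orP; left; apply/eqP; rewrite /eta; move: (g / _) => c.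
  by field.
have ev := eventually_linear.
have ek0 : 0 < eta * kap ^+ 2 by rewrite mulr_gt0.
have p160 : 0 < p / 16 by rewrite divr_gt0.
have kg0 : 0 < kap ^+ 2 * g by rewrite mulr_gt0.
have half0 : 0 < 1 / 2 :> R by rewrite divr_gt0.
have m1 := ev _ _ 4 k0; have m2 := eventually_geq 400.
have m3 := ev _ _ (512 * 512 * eps * M%:R) et0; have m4 := ev _ _ (32 * M%:R) k20.
have m5 := ev _ _ (8 * M%:R) ek0; have m6 := ev _ _ (64 * 64 * M%:R) et0.
have m7 := ev _ _ (2 * M%:R / kap + 1) p160; have m8 := ev _ _ (400 * M%:R * (1 + 2 / kap)) half0.
have m9 := ev _ _ ((M%:R + 3) * (4 * (2 * M%:R)) * (160 * 100)) kg0.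
have m10 := ev _ _ ((M%:R + 3) * (4 * (2 * M%:R))) k0.
have m11 := ev _ _ (M%:R * (M%:R + 2)) k0.
have H := eventuallyI m1 (eventuallyI m2 (eventuallyI m3 (eventuallyI m4 (eventuallyI m5 (eventuallyI m6
  (eventuallyI m7 (eventuallyI m8 (eventuallyI m9 (eventuallyI m10 m11))))))))).
apply: eventuallyW H => n [? [? [? [? [? [? [? [? [? [? ?]]]]]]]]]].
by split.
Qed.

Lemma pow2_expR (j n : nat) (z : R) : (2 ^ n)%:R ^+ j * expR (- z) <= expR (j%:R * n%:R - z).
Proof.
rewrite expRD expRM_natl; apply: ler_wpM2r; first exact: expR_ge0.
by apply: lerXn2r; rewrite ?nnegrE ?expR_ge0 // expn2_le_expR.
Qed.

Lemma pow_y (y b : R) n : 2 * y = expR (- b) -> (2 ^ n)%:R * y ^+ n = expR (- (b * n%:R)).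
Proof. by move=> yE; rewrite natrX -exprMn yE -expRM_natl mulrN mulrC. Qed.

(** [a] and [b] are the exponential rates of the last failure term: [2 ^ n] times
    [(1 - p + p * x0) ^+ n] is [expR (- (b * n))], while the allowance [x0 ^- t] with
    [t <= 2 * kap * n] costs at most [expR (b * n / 2)] because [4 * a * kap <= b]. *)
Lemma regular_eventually (x0 a b kap eps eta : R) (M : nat) (d : R) :
    0 < x0 < 1 -> x0 = expR (- a) -> 0 <= a -> 2 * (1 - p + p * x0) = expR (- b) -> 0 < b ->
    0 < kap -> 0 < eps -> 0 < eta -> 3 <= M.+1%:R * eps ^+ 2 / 16 -> 4 * a * kap <= b -> 0 < d ->
  eventually (fun n => Pr p (predC (@regular R p kap eps eta M n)) <= d).
Proof.
move=> /andP[x0_gt0 x0_lt1] x0E a_ge0 yE b_gt0 k0 e0 et0 hM hk d0; have [hp' hp1'] := (hp, hp1); have p0 : 0 < p by lra.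
pose g := p ^+ 2 * kap ^+ 2 / 32; have g0 : 0 < g by rewrite divr_gt0 // mulr_gt0 // exprn_gt0.
have d4 : 0 < d / 4 by rewrite divr_gt0.
have c2 : 0 < (g / 2) ^+ 2 / 8 by rewrite divr_gt0 // exprn_gt0 // divr_gt0.
have c3 : 0 < eta ^+ 2 / (8 * (64 * 64)) by apply: divr_gt0; [rewrite exprn_gt0 | lra].
have H1 := @eventually_expR R (2 ^ M.+1)%:R 2 (d / 4) (8 * M.+1).+1 (ler0n _ _) (ltr0n _ 2) d4.
have H2 := @eventually_expR R 2 1 (d / 4) 1 (ler0n _ _) ltr01 d4.
have H3 := eventually_linear 4 c2.
have H4 := eventually_linear 2 c3.
have b2 : 0 < b / 2 by rewrite divr_gt0.
have H5 := @eventually_expR R 1 (b / 2) (d / 4) 2 ler01 b2 d4.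
have H6 := eventuallyI (eventually_geq 16) (eventually_geq M.+1).
have H := eventuallyI H1 (eventuallyI H2 (eventuallyI H3 (eventuallyI H4 (eventuallyI H5 H6)))).
apply: eventuallyW H => n [h1 [h2 [h3 [h4 [h5 [n16 Mn]]]]]].
set nu : R := n%:R in h1 h2 h3 h4 h5; set x : R := n.+1%:R in h1 h2 h5.
have nu0 : 0 <= nu by [].
have x1 : 0 <= x by []. have nx : nu <= x by rewrite ler_nat.
pose t := Num.truncn (2 * (kap * nu)).
have kn0 : 0 <= 2 * (kap * nu) by rewrite !mulr_ge0 // ltW.
have /andP[t1 t2] := truncn_itv kn0.
have x01 : 0 < x0 <= 1 by rewrite x0_gt0 ltW.
apply: le_trans (Pr_not_regular (ltW p0) (ltW hp1) n16 Mn (ltW e0) et0 g0 x01 (ltW t2)) _.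
rewrite -/g -/nu.
have q1 : (n.+1 * 2 ^ n)%:R * ((n.+1 ^ (8 * M.+1))%:R * ((2 ^ M.+1)%:R * expR (- (M.+1%:R * eps ^+ 2 / 16 * nu)))) <= d / 4.
  apply: le_trans h1; have := pow2_expR 1 n (M.+1%:R * eps ^+ 2 / 16 * nu).
  rewrite expr1 mul1r -/nu; set s := M.+1%:R * _ / _ in hM *; set z := expR (- (s * nu)) => hz.
  have hz2 : (2 ^ n)%:R * z <= expR (- (2 * nu)).
    by apply: (le_trans hz); rewrite ler_expR; have := ler_wpM2r nu0 hM; lra.
  have -> : (n.+1 * 2 ^ n)%:R * ((n.+1 ^ (8 * M.+1))%:R * ((2 ^ M.+1)%:R * z)) =
     (2 ^ M.+1)%:R * x ^+ (8 * M.+1).+1 * ((2 ^ n)%:R * z).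
    rewrite natrM (natrX _ n.+1) -/x exprS; move: (x ^+ _) ((2 ^ n)%:R) ((2 ^ M.+1)%:R) => A B C; ring.
  by apply: ler_wpM2l => //; apply: mulr_ge0 => //; apply: exprn_ge0.
have q2 : (2 ^ n * n * 2 ^ n * 2 ^ n)%:R * (2 * expR (- ((g / 2) ^+ 2 / 8 * nu ^+ 2))) <= d / 4.
  apply: le_trans h2; have := pow2_expR 3 n ((g / 2) ^+ 2 / 8 * nu ^+ 2).
  set s := (g / 2) ^+ 2 / 8 in h3 *; set z := expR (- (s * _)) => hz.
  have hz2 : (2 ^ n)%:R ^+ 3 * z <= expR (- (1 * nu)).
    by apply: (le_trans hz); rewrite ler_expR -/nu; have := ler_wpM2r nu0 h3; rewrite expr2 mulrA; lra.
  have -> : (2 ^ n * n * 2 ^ n * 2 ^ n)%:R * (2 * z) = 2 * nu * ((2 ^ n)%:R ^+ 3 * z).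
    by rewrite !natrM -/nu; ring.
  rewrite expr1; apply: ler_pM => //; last by rewrite ler_pM2l.
    by rewrite mulr_ge0.
  by rewrite mulr_ge0 ?exprn_ge0 ?expR_ge0.
have q3 : nu * ((2 ^ n * 2)%:R * expR (- (eta ^+ 2 / (8 * (64 * 64)) * nu ^+ 2))) <= d / 4.
  apply: le_trans h2; have := pow2_expR 1 n (eta ^+ 2 / (8 * (64 * 64)) * nu ^+ 2).
  set s := eta ^+ 2 / _ in h4 *; set z := expR (- (s * _)) => hz.
  have hz2 : (2 ^ n)%:R * z <= expR (- (1 * nu)).
    by rewrite -[(2 ^ n)%:R]expr1; apply: (le_trans hz); rewrite ler_expR -/nu; have := ler_wpM2r nu0 h4; rewrite expr2 mulrA; lra.
  have -> : nu * ((2 ^ n * 2)%:R * z) = 2 * nu * ((2 ^ n)%:R * z).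
    by rewrite natrM; ring.
  rewrite expr1; apply: ler_pM => //; last by rewrite ler_pM2l.
    by rewrite mulr_ge0.
  by rewrite mulr_ge0 ?expR_ge0.
have q4 : (2 ^ n * n * n)%:R * (x0 ^- t * (1 - p + p * x0) ^+ n) <= d / 4.
  apply: le_trans h5; rewrite mul1r.
  have xt : x0 ^- t = expR (t%:R * a) by rewrite x0E -expRM_natl mulrN -expRN opprK.
  have -> : (2 ^ n * n * n)%:R * (x0 ^- t * (1 - p + p * x0) ^+ n) = nu ^+ 2 * (expR (t%:R * a) * ((2 ^ n)%:R * (1 - p + p * x0) ^+ n)).
    by rewrite xt !natrM -/nu; ring.
  rewrite (pow_y _ yE) -/nu -expRD; apply: ler_pM; rewrite ?sqr_ge0 ?expR_ge0 //.
    by apply: lerXn2r; rewrite ?nnegrE.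
  rewrite ler_expR; have := ler_wpM2r a_ge0 t1; have := ler_wpM2r nu0 hk.
  rewrite (_ : 4 * a * kap * nu = 2 * (2 * (kap * nu) * a)); last by ring.
  rewrite -/t; lra.
lra.
Qed.

Lemma tie_eventually (x0 d : R) : 0 < x0 -> x0 < 1 -> 0 < d ->
  eventually (fun n => forall m, n = (2 * m).+1 ->
    Pr p (fun X : {set {set 'I_n}} => near_value X m == near_value X m.+1) <= d).
Proof.
move=> x0_gt0 x0_lt1 d0; set y := 1 - p + p * x0; have [hp' hp1'] := (hp, hp1); have p0 : 0 < p by lra. have q0 : 0 < 1 - p by lra.
have qp : 1 - p <= p by lra.
have y0 : 0 < y by rewrite addr_gt0 // mulr_gt0.
have y1 : y < 1.
  have h : p * x0 < p * 1 by rewrite ltr_pM2l.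
  rewrite /y; lra.
pose e := - ln y; have e0 : 0 < e by rewrite oppr_gt0 ln_lt0 // y0.
have ye : y = expR (- e) by rewrite opprK lnK // posrE.
have qd0 : 0 < (1 - p) * d / 2 by rewrite divr_gt0 // mulr_gt0.
pose L := (Num.bound (2 / ((1 - p) * d / 2))).+1.
have L0 : 0 < (L%:R : R) by rewrite ltr0n.
have hL : 2 / L%:R <= (1 - p) * d / 2.
  have h : 2 / ((1 - p) * d / 2) < (Num.bound (2 / ((1 - p) * d / 2)))%:R.
    by apply: archi_boundP; apply: divr_ge0 => //; apply: ltW.
  have h2 : 2 / ((1 - p) * d / 2) <= L%:R by apply: (le_trans (ltW h)); rewrite ler_nat leqnSn.
  by move: h2; rewrite ler_pdivrMr // => h2; rewrite ler_pdivrMr // mulrC.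
(* With [L ^ 2] separated sets, [K / L + L] is [K * (2 / L)], which bounds the tie probability by a
   constant over [L], up to the chance that some set is not free. *)
pose K := (L ^ 2)%N.
have KE : (K%:R : R) = L%:R ^+ 2 by rewrite natrX.
have C0 : 0 <= K%:R * expR (e / 2) by rewrite mulr_ge0 ?expR_ge0.
have e20 : 0 < e / 2 by rewrite divr_gt0.
have H := eventuallyI (eventually_expR 1 C0 e20 qd0) (eventually_geq (4 * K + 5)).
apply: eventuallyW H => n [h1 nK] m nm.
have m1 : (1 < m)%N by move: nK nm; clear; lia.
have Km : (2 * K <= m)%N by move: nK nm; clear; lia.
have [U [UL sU cU]] := exists_separated nm m1 Km.
have x01 : 0 < x0 <= 1 by rewrite x0_gt0 ltW.
have := Pr_tie (ltW p0) (ltW hp1) qp nm UL sU x01 L0; rewrite cU.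
set P := Pr p _ => hP.
have ym : K%:R * (n.+1%:R * y ^+ m) <= (1 - p) * d / 2.
  apply: le_trans h1; rewrite expr1 ye -expRM_natl.
  have -> : m%:R * - e = e / 2 + - (e / 2 * n%:R).
    have -> : n%:R = 2 * m%:R + 1 :> R by rewrite nm -natr1 natrM.
    by field.
  by rewrite expRD le_eqVlt; apply/orP; left; apply/eqP; ring.
have hP2 : K%:R * ((1 - p) * P) <= K%:R * ((1 - p) * d).
  apply: (le_trans hP).
  have -> : K%:R / L%:R + L%:R = K%:R * (2 / L%:R) :> R.
    by rewrite KE; field; rewrite gt_eqF.
  rewrite -mulrDr; apply: ler_wpM2l => //; lra.
move: hP2; rewrite ler_pM2l; last by rewrite KE exprn_gt0.
by rewrite ler_pM2l.
Qed.

Lemma failure_eventually (d : R) : 0 < d ->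
  eventually (fun n => Pr p (predC (@largest_antichains_near_middle n)) <= d).
Proof.
move=> d0; have [hp' hp1'] := (hp, hp1); have p0 : 0 < p by lra.
(* This puts [1 - p + p * x0] halfway between [1 - p] and [1 / 2], so twice it is below 1. *)
pose x0 := (p - 1 / 2) / (2 * p).
have px0 : p * x0 = (p - 1 / 2) / 2 by rewrite /x0; field; rewrite gt_eqF.
have x0_gt0 : 0 < x0 by rewrite /x0 divr_gt0 // ?mulr_gt0 //; lra.
have x0_lt1 : x0 < 1 by rewrite -(ltr_pM2l p0) px0; lra.
pose a := - ln x0; pose b := - ln (2 * (1 - p + p * x0)).
have y2 : 0 < 2 * (1 - p + p * x0) < 1 by rewrite px0; apply/andP; split; lra.
have a_gt0 : 0 < a by rewrite oppr_gt0 ln_lt0 // x0_gt0.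
have b_gt0 : 0 < b by rewrite oppr_gt0 ln_lt0.
have x0E : x0 = expR (- a) by rewrite opprK lnK // posrE.
have yE : 2 * (1 - p + p * x0) = expR (- b) by rewrite opprK lnK // posrE; case/andP: y2.
pose kap := Num.min (p / 8) (b / (4 * a)).
have kap0 : 0 < kap by rewrite lt_min !divr_gt0 // mulr_gt0.
have kp : kap <= p / 8 by rewrite ge_min lexx.
have hk : 4 * a * kap <= b.
  rewrite mulrC -ler_pdivlMr ?mulr_gt0 //; by rewrite ge_min lexx orbT.
have [eps [eta [M [e0 et0 hM evP]]]] := params_eventually kap0 kp.
have d8 : 0 < d / 8 by rewrite divr_gt0.
have x01 : 0 < x0 < 1 by rewrite x0_gt0.
have H1 := regular_eventually x01 x0E (ltW a_gt0) yE b_gt0 kap0 e0 et0 hM hk d8.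
have H2 := tie_eventually x0_gt0 x0_lt1 d8.
have c0 : 0 < (p / 100) ^+ 2 / 8 by rewrite divr_gt0 // exprn_gt0 // divr_gt0.
have H3 := @eventually_expR R 2 _ (d / 8) 0 (ler0n _ _) c0 d8.
have H4 := @eventually_expR R 1 b (d / 8) 2 ler01 b_gt0 d8.
have H := eventuallyI evP (eventuallyI H1 (eventuallyI H2 (eventuallyI H3 H4))).
apply: eventuallyW H => n [P [h1 [h2 [h3 h4]]]].
have pge := ltW p0; have ple := ltW hp1.
have [odd_n|even_n] := boolP (odd n); last first.
  have nk : n = (2 * n./2)%N by rewrite mul2n even_halfK.
  by apply: le_trans (failure_even pge ple P nk) _; lra.
have nm : n = (2 * n./2).+1 by rewrite mul2n odd_halfK //; case: (n) odd_n.
move: nm; set m := n./2 => nm.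
have n400 := pr_n P.
have sz k : (0 < k < n)%N -> Pr p (fun X : {set {set 'I_n}} => p / 100 * 'C(n, k)%:R <= `|#|X :&: layer n k|%:R - p * 'C(n, k)%:R|) <= d / 8.
  move=> kn; have kn' : (k <= n)%N by case/andP: kn => _ /ltnW.
  apply: le_trans (Pr_layer_size pge ple kn') _; apply: le_trans h3; rewrite expr0 mulr1.
  apply: ler_wpM2l => //; rewrite ler_expR lerN2; apply: ler_wpM2l; first exact: ltW.
  by rewrite ler_nat bin_ge.
have is1 : Pr p (@iso_nested n) <= d / 8.
  have x01' : 0 < x0 <= 1 by rewrite x0_gt0 ltW.
  apply: le_trans (Pr_iso_nested n pge ple x01') _; apply: le_trans h4; rewrite mul1r.
  have -> : (2 ^ n * n * n)%:R * (1 - p + p * x0) ^+ n = n%:R ^+ 2 * ((2 ^ n)%:R * (1 - p + p * x0) ^+ n).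
    by rewrite !natrM; ring.
  rewrite (pow_y _ yE); apply: ler_wpM2r; first exact: expR_ge0.
  by apply: lerXn2r; rewrite ?nnegrE // ler_nat.
have s0 := sz m; have s1 := sz m.+1; have tt := h2 m nm.
have r0 : (0 < m < n)%N by move: n400 nm; clear; lia.
have r1 : (0 < m.+1 < n)%N by move: n400 nm; clear; lia.
apply: le_trans (failure_odd pge ple P nm) _.
have := s0 r0; have := s1 r1; lra.
Qed.

End Limits.

From mathcomp Require Import classical_sets topology normedtype.
Import numFieldNormedType.Exports.
Local Open Scope classical_set_scope.

Theorem theorem1p2 (R : realType) (p : R) (hp : 1 / 2 < p) (hp1 : p < 1) :
  (fun n : nat => Pr_random_family p (@largest_antichains_near_middle n))
    @ \oo --> (1 : R).
Proof.
have p0 : 0 <= p by lra. have p1 := ltW hp1.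
apply/cvgrPdist_le => e e0; have [N hN] := failure_eventually hp hp1 e0.
exists N => // n /= Nn; have := hN n Nn.
change (Pr_random_family p _) with (Pr p (@largest_antichains_near_middle n)).
by rewrite -Pr_compl ger0_norm // Pr_ge0.
Qed.
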